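(* Let $d\in\mathbb{N}$, $s>d/2$ and $0<r\le\infty$. Then $$\lim_{n\to\infty}n^{s/d-1/2}\,a_n\big(I_d:H^{s,r}(\mathbb{T}^d)\to L_\infty(\mathbb{T}^d)\big)=\sqrt{\frac{d}{2s-d}}\;\mathrm{vol}(B_r^d)^{s/d},$$ where $B_r^d=\{x\in\mathbb{R}^d:|x|_r\le 1\}$ and $\mathrm{vol}$ is Lebesgue measure on $\mathbb{R}^d$.
   Context: $\mathbb{T}^d=[0,2\pi)^d$ is the $d$-dimensional torus with the normalized Lebesgue measure $(2\pi)^{-d}dx$. For $f\in L_1(\mathbb{T}^d)$, $\hat f(k)=(2\pi)^{-d}\int_{\mathbb{T}^d}f(x)e^{-ik\cdot x}dx$. For $x\in\mathbb{R}^d$, $|x|_r=(\sum_{j=1}^d|x_j|^r)^{1/r}$ for $0<r<\infty$ and $|x|_\infty=\max_j|x_j|$. For $s>0$, $0<r\le\infty$, the isotropic Sobolev space $H^{s,r}(\mathbb{T}^d)$ consists of all $f\in L_2(\mathbb{T}^d)$ with finite norm $\|f|H^{s,r}(\mathbb{T}^d)\|=\big(\sum_{k\in\mathbb{Z}^d}(1+\sum_{j=1}^d|k_j|^r)^{2s/r}|\hat f(k)|^2\big)^{1/2}$, where for $r=\infty$ the weight $(1+\sum_j|k_j|^r)^{s/r}$ is interpreted as $\max(1,|k|_\infty)^s$. $I_d$ is the inclusion map. For a bounded linear operator $T:X\to Y$ between Banach spaces, $a_n(T)=\inf\{\|T-A\|: A:X\to Y \text{ bounded linear},\ \operatorname{rank}A<n\}$.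 *)

(* Defs.v *)
From HB Require Import structures.
From mathcomp Require Import all_boot all_order all_algebra.
From mathcomp Require Import all_classical all_reals all_analysis.
From mathcomp Require Import complex.
From mathcomp Require Import ess_sup_inf.
Set Implicit Arguments.
Unset Strict Implicit.
Unset Printing Implicit Defensive.
Import Order.TTheory GRing.Theory Num.Theory.
Import numFieldNormedType.Exports.
Local Open Scope classical_set_scope.
Local Open Scope ring_scope.

Section Spaces.
Variable R : realType.

Definition mR : measurableType _ := measurableTypeR R.

(* Rsp n is R^(n+1) *)
Fixpoint Rsp (n : nat) : {dd : measure_display & measurableType dd} :=
  match n with
  | 0 => existT _ _ mR
  | m.+1 => existT _ _ ((mR * projT2 (Rsp m))%type : measurableType _)
  end.

(* coordinates x_0, x_1, ..., x_n of a point of R^(n+1) (0 beyond n) *)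
Fixpoint coordn (n : nat) : projT2 (Rsp n) -> nat -> R :=
  match n return projT2 (Rsp n) -> nat -> R with
  | 0 => fun x i => if i is 0 then x else 0
  | m.+1 => fun x i => if i is j.+1 then @coordn m x.2 j else x.1
  end.

(* Lebesgue measure on R^(n+1): the iterated product (Tonelli form)          *)
(* lambda_{n+2}(A) = \int lambda_{n+1}(x-section of A) d lambda_1(x).        *)
Fixpoint lebn (n : nat) : set (projT2 (Rsp n)) -> \bar R :=
  match n return set (projT2 (Rsp n)) -> \bar R with
  | 0 => @lebesgue_measure R
  | m.+1 => ((@lebesgue_measure R) \x (@lebn m))%E
  end.

Lemma two_pi_gt0 : (0 : R) < 2 * pi.
Proof. by rewrite mulr_gt0 ?pi_gt0. Qed.

(* Normalized Lebesgue measure (2 pi)^(-(n+1)) dx on the cube [0,2pi]^(n+1), *)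
(* i.e. the product of n+1 uniform probabilities on [0, 2 pi].              *)
Fixpoint torn (n : nat) : probability (projT2 (Rsp n)) R :=
  match n return probability (projT2 (Rsp n)) R with
  | 0 => uniform_prob two_pi_gt0
  | m.+1 => Probability.clone _ (mR * projT2 (Rsp m))%type R
              (uniform_prob two_pi_gt0 \x @torn m)%E _
  end.

(* The d-dimensional objects (d >= 1 is assumed where used). *)
Definition Td (d : nat) : measurableType _ := projT2 (Rsp d.-1).
Definition Pd (d : nat) : probability (Td d) R := @torn d.-1.
Definition vold (d : nat) : set (Td d) -> \bar R := @lebn d.-1.
Definition coord (d : nat) (x : Td d) (j : 'I_d) : R := @coordn d.-1 x j.

End Spaces.

Section Torus.
Variable R : realType.
Local Notation C := (R[i]).

Definition cnorm (z : C) : R :=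
  Num.sqrt (complex.Re z ^+ 2 + complex.Im z ^+ 2).

Definition cexpi (t : R) : C := Complex (cos t) (sin t).

Variable d : nat.
Local Notation T := (Td R d).
Local Notation P := (Pd R d).

Definition cmeasurable (f : T -> C) : Prop :=
  measurable_fun setT (fun x => complex.Re (f x)) /\
  measurable_fun setT (fun x => complex.Im (f x)).

Definition inL2 (f : T -> C) : Prop :=
  cmeasurable f /\ (\int[P]_x ((cnorm (f x)) ^+ 2)%:E < +oo)%E.

Definition dotk (k : {ffun 'I_d -> int}) (x : T) : R :=
  \sum_(j < d) (k j)%:~R * coord x j.

Definition fourier (f : T -> C) (k : {ffun 'I_d -> int}) : C :=
  Complex
    (Rintegral P setT (fun x => complex.Re (f x * cexpi (- dotk k x))))
    (Rintegral P setT (fun x => complex.Im (f x * cexpi (- dotk k x)))).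

Definition sob_weight2 (s : R) (r : \bar R) (k : {ffun 'I_d -> int}) : R :=
  match r with
  | EFin r' => powR (1 + \sum_(j < d) powR `|(k j)%:~R : R| r') (2 * s / r')
  | _ => powR (Num.max 1 (\big[Num.max/0]_(j < d) `|(k j)%:~R : R|)) (2 * s)
  end.

Definition Hnorm2 (s : R) (r : \bar R) (f : T -> C) : \bar R :=
  \esum_(k in [set: {ffun 'I_d -> int}])
     (sob_weight2 s r k * (cnorm (fourier f k)) ^+ 2)%:E.

Definition inH (s : R) (r : \bar R) (f : T -> C) : Prop :=
  inL2 f /\ (Hnorm2 s r f < +oo)%E.

Definition Hnorm (s : R) (r : \bar R) (f : T -> C) : R :=
  Num.sqrt (fine (Hnorm2 s r f)).

Definition Linf_norm (g : T -> C) : \bar R :=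
  ess_sup P (fun x => (cnorm (g x))%:E).

Definition inLinf (g : T -> C) : Prop :=
  cmeasurable g /\ (Linf_norm g < +oo)%E.

Definition ae_eq (f g : T -> C) : Prop := {ae P, forall x, f x = g x}.

(* A bounded linear operator H^{s,r}(T^d) -> L_oo(T^d), given on            *)
(* representatives: A respects a.e.-equality, is linear modulo a.e.        *)
(* equality, maps into L_oo and is bounded.                                *)
Definition bdd_lin_op (s : R) (r : \bar R) (A : (T -> C) -> (T -> C)) : Prop :=
  [/\ forall f, inH s r f -> inLinf (A f),
      forall f g, inH s r f -> inH s r g -> ae_eq f g -> ae_eq (A f) (A g),
      forall (a b : C) f g, inH s r f -> inH s r g ->
        ae_eq (A (fun x => a * f x + b * g x)) (fun x => a * A f x + b * A g x)
    & exists M : R, forall f, inH s r f ->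
        (Linf_norm (A f) <= (M * Hnorm s r f)%:E)%E].

Definition rank_lt (s : R) (r : \bar R) (n : nat) (A : (T -> C) -> (T -> C)) :=
  exists m : nat, (m < n)%N /\
  exists g : 'I_m -> (T -> C), forall f, inH s r f ->
    exists c : 'I_m -> C, ae_eq (A f) (fun x => \sum_(i < m) c i * g i x).

Definition opnorm_IminusA (s : R) (r : \bar R) (A : (T -> C) -> (T -> C)) : \bar R :=
  ereal_sup [set Linf_norm (fun x => f x - A f x) |
              f in [set f | inH s r f /\ Hnorm s r f <= 1]].

Definition approx_number (s : R) (r : \bar R) (n : nat) : \bar R :=
  ereal_inf [set opnorm_IminusA s r A |
              A in [set A | bdd_lin_op s r A /\ rank_lt s r n A]].

End Torus.

Definition lr_norm (R : realType) (d : nat) (r : \bar R) (x : 'I_d -> R) : R :=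
  match r with
  | EFin r' => powR (\sum_(j < d) powR `|x j| r') r'^-1
  | _ => \big[Num.max/0]_(j < d) `|x j|
  end.

Definition unit_ball (R : realType) (d : nat) (r : \bar R) : set (Td R d) :=
  [set x | lr_norm r (coord x) <= 1].

(* Main.v *)
Require Import Defs.
From HB Require Import structures.
From mathcomp Require Import all_boot all_order all_algebra.
From mathcomp Require Import all_classical all_reals all_analysis.
From mathcomp Require Import complex.
From mathcomp Require Import ess_sup_inf.
From mathcomp Require Import finmap measurable_realfun spectral zify ring lra.
Import Order.TTheory GRing.Theory Num.Theory.
Import numFieldNormedType.Exports.
Local Open Scope classical_set_scope.
Local Open Scope ring_scope.

(* Write d = n + 1, v_k = W(k)^(-2s) for the squared inverse weights, V for the
   volume of the unit ball and N(t) for the number of lattice points with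
   W(k) < t.  Comparing unit cubes with dilated balls gives N(t) ~ V t^d, and
   cutting the region W >= t into geometric shells gives
   sum_(W(k) >= t) v_k ~ V d / (2s - d) t^(d - 2s).

   Upper bound: by Cauchy-Schwarz the Fourier projection onto {W < t}
   approximates the identity within (sum_(W >= t) v_k)^(1/2), and it has rank
   N(t).  That f is almost everywhere the sum of its Fourier series rests on
   the uniqueness of Fourier coefficients.

   Lower bound: let A have rank < m and ||I - A|| <= M.  On the span of N
   exponentials, normalised in H^s, A kills a subspace of dimension L > N - m.
   If phi_1, ..., phi_L is an H^s-orthonormal basis of it, testing I - A on all
   unit combinations gives sum_l |phi_l(x)|^2 <= M^2 almost everywhere.
   Integrating yields sum_k q_k v_k <= M^2 with 0 <= q_k <= 1 and
   sum_k q_k > N - m, and minimising over such q gives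
   M^2 >= sum_(W(k) >= t) v_k + t^(-2s) (N(t) - m) for every t.

   With t^d = m / V, up to a factor close to 1, both bounds agree to leading
   order. *)

(** * Lattice point counting *)

(** The two bounds meet because every exponential has modulus one: the Cauchy-Schwarz bound for a
    tail is the same at all points, so replacing a supremum by a mean over the torus costs nothing
    to leading order. In the lower bound this mean is the trace of the diagonal matrix of the [v_k]
    compressed to the killed subspace. The [q_k] are the diagonal of the orthogonal projection onto
    that subspace, and minimising over them amounts to discarding the [m] largest weights. Two
    obstacles shape the details. For [r < 1] the functional [|x|_r] is not a norm, so cubes and
    balls are compared through the coordinatewise bounds [|y_j| <= |z_j| + 1] instead of the
    triangle inequality. Moreover operators act on functions up to null sets: each test function
    brings its own exceptional set, so pointwise suprema have to be taken over countable
    families. *)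

Section SigmaFiniteProduct.
Context {R : realType} {d1 d2} {T1 : measurableType d1} {T2 : measurableType d2}.
Variables (m1 : {sigma_finite_measure set T1 -> \bar R})
  (m2 : {sigma_finite_measure set T2 -> \bar R}).

(** Section measures are measurable functions only for a sigma-finite factor, so the property has to
    survive each step of the iterated product [lebm]. *)
Lemma sigma_finite_prod : sigma_finite setT (m1 \x m2)%E.
Proof.
have /sigma_finiteP[F [TF ndF Foo]] := sigma_finiteT m1.
have /sigma_finiteP[G [TG ndG Goo]] := sigma_finiteT m2.
exists (fun n => F n `*` G n).
  apply/seteqP; split=> // -[x y] _.
  have [n _ Fx] : (\bigcup_i F i) x by rewrite -TF.
  have [m _ Gy] : (\bigcup_i G i) y by rewrite -TG.
  exists (maxn n m) => //; split => /=.
  - have /subsetPset := ndF _ _ (leq_maxl n m); exact.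
  - have /subsetPset := ndG _ _ (leq_maxr n m); exact.
move=> k; have [mF Fk] := Foo k; have [mG Gk] := Goo k; split.
  exact: measurableX.
by rewrite product_measure1E // lte_mul_pinfty // ge0_fin_numE.
Qed.

Definition sfprod : {sigma_finite_measure set (T1 * T2)%type -> \bar R} :=
  HB.pack_for {sigma_finite_measure set (T1 * T2)%type -> \bar R}
    (m1 \x m2)%E (Measure_isSigmaFinite.Build _ _ _ (m1 \x m2)%E sigma_finite_prod).

End SigmaFiniteProduct.

(** * Lebesgue measure of boxes and dilates; comparison of gauges *)

Section LebesguePower.
Context {R : realType}.
Local Notation mu := (@lebesgue_measure R).

(** The set function [lebn] of the statement, carried as a sigma-finite measure so that the theory
    of product measures applies at every level. *)
Fixpoint lebm (n : nat) :
    {sigma_finite_measure set (projT2 (Rsp R n)) -> \bar R} :=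
  match n return {sigma_finite_measure set (projT2 (Rsp R n)) -> \bar R} with
  | 0 => (mu : {sigma_finite_measure set (mR R) -> \bar R})
  | m.+1 => sfprod (mu : {sigma_finite_measure set (mR R) -> \bar R}) (lebm m)
  end.

Lemma lebmE n : lebm n = @lebn R n :> (set _ -> \bar R).
Proof. by elim: n => //= n <-. Qed.

Lemma measurable_coordn n i :
  measurable_fun setT (fun x : projT2 (Rsp R n) => coordn x i).
Proof.
elim: n i => [|n IH] [|i] /=.
- exact: measurable_id.
- exact: measurable_cst.
- exact: measurable_fst.
- exact: (measurableT_comp (IH i) measurable_snd).
Qed.

Definition box n (a b : nat -> R) : set (projT2 (Rsp R n)) :=
  [set x | forall j, (j <= n)%N -> a j <= coordn x j < b j].

Lemma boxS n a b :
  box n.+1 a b = `[a 0%N, b 0%N[ `*` box n (a \o S) (b \o S).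
Proof.
apply/seteqP; split=> [[x y] H|[x y] [/= H1 H2]] /=.
- split; first by have := H 0%N isT; rewrite /= in_itv.
  by move=> j jn; exact: (H j.+1 jn).
- by case=> [_|j jn] /=; [move: H1; rewrite in_itv | exact: H2].
Qed.

Lemma box0 a b : box 0 a b = [set` `[a 0%N, b 0%N[].
Proof.
apply/seteqP; split=> x /=; first by move=> /(_ 0%N isT); rewrite in_itv.
by rewrite in_itv => H [|].
Qed.

Lemma measurable_box n a b : measurable (box n a b).
Proof.
elim: n a b => [|n IH] a b; first by rewrite box0; exact: measurable_itv.
by rewrite boxS; apply: measurableX => //; exact: measurable_itv.
Qed.

Lemma lebm_box n a b : (forall j, a j <= b j) ->
  lebm n (box n a b) = (\prod_(j < n.+1) (b j - a j))%:E.
Proof.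
have I (x y : R) : x <= y -> mu `[x, y[ = (y - x)%:E.
  move=> xy; rewrite lebesgue_measure_itv /= lte_fin.
  by case: ltP => // yx; have -> : x = y; [exact/le_anti/andP|rewrite subrr].
elim: n a b => [|n IH] a b ab; first by rewrite box0 big_ord1 /= I.
rewrite boxS big_ord_recl /= product_measure1E; last 2 first.
- exact: measurable_itv.
- exact: measurable_box.
transitivity ((b 0%N - a 0%N)%:E * lebm n (box n (a \o S) (b \o S)))%E.
  by congr (_ * _)%E; exact: I.
by rewrite IH // => j; exact: ab.
Qed.

(** [t] times the measure of the preimage is a measure in [A] that gives each []a, b]] its length;
    uniqueness of Lebesgue measure concludes. *)
Lemma lebesgue_measure_scale (t : R) (A : set (mR R)) : 0 < t -> measurable A ->
  mu ( *%R t @^-1` A) = (t^-1%:E * mu A)%E.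
Proof.
move=> t0 mA.
have mt : measurable_fun setT ( *%R t : mR R -> mR R) by exact: mulrl_measurable.
pose nu : {measure set (mR R) -> \bar R} := pushforward mu ( *%R t : mR R -> mR R).
have t0' : 0 <= t by exact: ltW.
pose nu' : {measure set (mR R) -> \bar R} := mscale (NngNum t0') (nu mt).
have E : mu A = nu' A.
  apply: lebesgue_measure_unique => // _ [[a b]] _ <-.
  rewrite /nu' /mscale /nu /pushforward /=.
  transitivity (t%:E * mu [set` `](t^-1 * a)%R, (t^-1 * b)%R]])%E; last first.
    congr (_ * mu _)%E; apply/seteqP; split=> x /=;
      by rewrite !in_itv /= ler_pdivlMl // ltr_pdivrMl.
  rewrite !lebesgue_measure_itv /= !lte_fin ltr_pM2l ?invr_gt0 //.
  case: ifP => _; last by rewrite mule0.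
  by rewrite -EFinB -EFinM -mulrBr mulrA divff ?mul1r ?gt_eqF.
rewrite E /nu' /mscale /nu /pushforward /= muleA -EFinM mulVf ?mul1e //.
by rewrite gt_eqF.
Qed.

Lemma ge0_integral_scale (t : R) (g : mR R -> \bar R) : 0 < t ->
  measurable_fun setT g -> (forall x, 0 <= g x)%E ->
  (\int[mu]_x g (t * x)%R = t^-1%:E * \int[mu]_x g x)%E.
Proof.
move=> t0 mg g0.
have mt : measurable_fun setT ( *%R t : mR R -> mR R) by exact: mulrl_measurable.
have t0' : 0 <= t^-1 by rewrite invr_ge0 ltW.
rewrite -(ge0_integral_mscale _ _ (NngNum t0')) //.
transitivity (\int[pushforward mu ( *%R t : mR R -> mR R)]_x g x)%E.
  by rewrite ge0_integral_pushforward.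
apply: eq_measure_integral => A mA _.
by rewrite /= /pushforward lebesgue_measure_scale.
Qed.

Fixpoint scaln (n : nat) (t : R) : projT2 (Rsp R n) -> projT2 (Rsp R n) :=
  match n return projT2 (Rsp R n) -> projT2 (Rsp R n) with
  | 0 => fun x => (t * x : R)
  | m.+1 => fun x => (t * x.1 : R, scaln m t x.2)
  end.

Lemma coordn_scaln n t x i : coordn (scaln n t x) i = t * coordn x i.
Proof. by elim: n x i => [|n IH] x [|i] //=; rewrite mulr0. Qed.

Lemma lebm_scale n (t : R) (A : set (projT2 (Rsp R n))) : 0 < t -> measurable A ->
  lebm n (scaln n t @^-1` A) = ((t^-1 ^+ n.+1)%:E * lebm n A)%E.
Proof.
move=> t0; elim: n A => [|n IH] A mA.
  by rewrite expr1; exact: lebesgue_measure_scale.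
rewrite /= /product_measure1.
transitivity (\int[mu]_x ((t^-1 ^+ n.+1)%:E * (lebm n \o xsection A) (t * x)%R))%E.
  apply: eq_integral => x _ /=.
  have -> : xsection (scaln n.+1 t @^-1` A) x = scaln n t @^-1` xsection A (t * x).
    by apply/seteqP; split=> y; rewrite /xsection /= => H; apply/mem_set; move/set_mem: H.
  by rewrite IH //; exact: measurable_xsection.
rewrite ge0_integralZl //; last 2 first.
- have := measurable_fun_xsection (lebm n) mA => m.
  apply: (measurableT_comp m); exact: mulrl_measurable.
- by rewrite lee_fin exprn_ge0 // invr_ge0 ltW.
rewrite ge0_integral_scale //; last exact: measurable_fun_xsection.
by rewrite muleA -EFinM -exprSr.
Qed.

Definition qsum (d : nat) (r : R) (y : 'I_d -> R) := \sum_(j < d) powR `|y j| r.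

(** The Sobolev weight without its exponent [s], defined for real vectors so that a lattice point
    can be compared with the points of its cube. *)
Definition gaugeW (d : nat) (r : \bar R) (y : 'I_d -> R) : R :=
  match r with
  | EFin r' => powR (1 + qsum d r' y) r'^-1
  | _ => Num.max 1 (\big[Num.max/0]_(j < d) `|y j|)
  end.

Lemma qsum_ge0 d r y : 0 <= qsum d r y.
Proof. by apply: sumr_ge0 => j _; exact: powR_ge0. Qed.

Lemma bigmax_norm_ge0 d (y : 'I_d -> R) : 0 <= \big[Num.max/0]_(j < d) `|y j|.
Proof. exact: bigmax_ge_id. Qed.

Lemma gaugeW_ge1 d r y : (0 < r)%E -> 1 <= gaugeW d r y.
Proof.
case: r => [r| |] //= r0; last by rewrite le_max lexx.
rewrite -[leLHS](congr1 (@^~ r^-1) (@powR1 R)); apply: ge0_ler_powR; rewrite ?nnegrE.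
- by rewrite invr_ge0 ltW.
- by [].
- by rewrite addr_ge0 // qsum_ge0.
- by rewrite lerDl qsum_ge0.
Qed.

Lemma lr_norm_ge0 d r (y : 'I_d -> R) : 0 <= lr_norm r y.
Proof. by case: r => [r| |] /=; rewrite ?powR_ge0 // bigmax_norm_ge0. Qed.

Lemma lr_norm_le_gaugeW d r y : (0 < r)%E -> lr_norm r y <= gaugeW d r y.
Proof.
case: r => [r| |] //= r0; last by rewrite le_max lexx orbT.
apply: ge0_ler_powR; rewrite ?nnegrE.
- by rewrite invr_ge0 ltW.
- exact: qsum_ge0.
- by rewrite addr_ge0 // qsum_ge0.
- by rewrite lerDr.
Qed.

Lemma le_lr_norm d r (y : 'I_d -> R) j : (0 < r)%E -> `|y j| <= lr_norm r y.
Proof.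
case: r => [r| |] //= r0; last exact: le_bigmax.
rewrite lte_fin in r0.
have -> : `|y j| = powR (powR `|y j| r) r^-1.
  by rewrite -powRrM divff ?gt_eqF // powRr1.
apply: ge0_ler_powR; rewrite ?nnegrE ?powR_ge0 //.
- by rewrite invr_ge0 ltW.
- exact: qsum_ge0.
rewrite (bigD1 j) //= lerDl; apply: sumr_ge0 => i _; exact: powR_ge0.
Qed.

Lemma lr_normZ d r t (y : 'I_d -> R) : (0 < r)%E -> 0 <= t ->
  lr_norm r (fun j => t * y j) = t * lr_norm r y.
Proof.
case: r => [r| |] //= r0 t0.
- rewrite lte_fin in r0.
  under eq_bigr do rewrite normrM (ger0_norm t0) powRM //.
  rewrite -mulr_sumr powRM ?powR_ge0 //; last exact: qsum_ge0.
  by rewrite -powRrM divff ?gt_eqF // powRr1.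
- under eq_bigr do rewrite normrM (ger0_norm t0).
  elim/big_rec2 : _ => [|j x z _ ->]; first by rewrite mulr0.
  by rewrite maxr_pMr.
Qed.

(** For [b > 1 / e] one has [b + 1 <= (1 + e) b]; for smaller [b] the constant covers everything.
    This works for all [r > 0], where convexity or subadditivity would each cover only a range. *)
Lemma powR_addl1 (e r : R) : 0 < e -> 0 < r ->
  exists C, 0 <= C /\ forall a b, 0 <= a -> 0 <= b -> a <= b + 1 ->
    powR a r <= powR (1 + e) r * powR b r + C.
Proof.
move=> e0 r0; exists (powR (e^-1 + 1) r); split=> [|a b a0 b0 ab]; first exact: powR_ge0.
have [be|be] := leP b e^-1.
  apply: (@le_trans _ _ (powR (e^-1 + 1) r)); last first.
    by rewrite lerDr mulr_ge0 ?powR_ge0.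
  apply: ge0_ler_powR; rewrite ?nnegrE //; first exact: ltW.
    by rewrite addr_ge0 // invr_ge0 ltW.
  by rewrite (le_trans ab) // lerD2r.
have e1 : 0 <= 1 + e by rewrite addr_ge0 // ltW.
rewrite -powRM //.
apply: (@le_trans _ _ (powR ((1 + e) * b) r)); last by rewrite lerDl powR_ge0.
apply: ge0_ler_powR; rewrite ?nnegrE //; first exact: ltW.
  by rewrite mulr_ge0 // addr_ge0 // ltW.
rewrite (le_trans ab) // mulrDl mul1r lerD2l //.
by rewrite -ler_pdivrMl // mulr1 ltW.
Qed.

(** Substitute for the triangle inequality. Far from the origin, a unit shift of the coordinates and
    the summand 1 inside the gauge together cost a factor [1 + e]; [C] takes care of the bounded
    region. *)
Lemma gaugeW_le d r (e : R) : (0 < r)%E -> 0 < e -> exists C, 0 < C /\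
  forall y z, (forall j, `|y j| <= `|z j| + 1) ->
    gaugeW d r y <= Num.max ((1 + e) * lr_norm r z) C.
Proof.
case: r => [r| |] //= r0 e0; last first.
  exists (1 + e^-1); split; first by rewrite addr_gt0 ?invr_gt0.
  move=> y z yz; set M := \big[Num.max/0]_(j < d) `|z j|.
  have My : \big[Num.max/0]_(j < d) `|y j| <= M + 1.
    apply: bigmax_le => [|j _]; first by rewrite addr_ge0 ?bigmax_norm_ge0.
    by rewrite (le_trans (yz j)) // lerD2r; exact: le_bigmax.
  have M0 : 0 <= M by exact: bigmax_norm_ge0.
  have ei : 0 < e^-1 by rewrite invr_gt0.
  rewrite ge_max !le_max; apply/andP; split.
    by apply/orP; right; lra.
  have [be|be] := leP M e^-1.
    by apply/orP; right; apply: (le_trans My); lra.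
  apply/orP; left; apply: (le_trans My); rewrite mulrDl mul1r lerD2l.
  by rewrite -ler_pdivrMl // mulr1 ltW.
rewrite lte_fin in r0.
have e20 : 0 < e / 2 by rewrite divr_gt0.
have [C [C0 HC]] := powR_addl1 (e / 2) r e20 r0.
pose K := 1 + d%:R * C.
have K0 : 0 < K by rewrite ltr_pwDl // mulr_ge0.
(* The coordinates are compared with factor [1 + e / 2] only: the slack [D] up to [1 + e] absorbs
   the additive constant [K] as soon as [Q > K / D]. *)
pose D := powR (1 + e) r - powR (1 + e / 2) r.
have D0 : 0 < D.
  rewrite subr_gt0; apply: gt0_ltr_powR => //; rewrite ?nnegrE; lra.
have KD : 0 < powR (1 + e / 2) r * (K / D) + K.
  by rewrite ltr_wpDl // mulr_ge0 ?powR_ge0 // divr_ge0 // ltW.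
exists (powR (powR (1 + e / 2) r * (K / D) + K) r^-1); split.
  exact: powR_gt0.
move=> y z yz; set Q := qsum d r z.
have Q0 : 0 <= Q := qsum_ge0 _ _ _.
have H : 1 + qsum d r y <= powR (1 + e / 2) r * Q + K.
  rewrite /K addrCA lerD2l /Q /qsum mulr_sumr.
  have -> : d%:R * C = \sum_(j < d) C by rewrite sumr_const card_ord mulr_natl.
  rewrite -big_split /=; apply: ler_sum => j _; exact: HC.
have ri : 0 <= r^-1 by rewrite invr_ge0 ltW.
have P1 : 0 <= 1 + qsum d r y by rewrite addr_ge0 // qsum_ge0.
rewrite le_max; apply/orP; have [QK|QK] := leP Q (K / D); [right|left].
  apply: ge0_ler_powR; rewrite ?nnegrE //; first exact: ltW.
  by apply: (le_trans H); rewrite lerD2r ler_wpM2l ?powR_ge0.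
have -> : (1 + e) * powR Q r^-1 = powR (powR (1 + e) r * Q) r^-1.
  rewrite powRM ?powR_ge0 // -powRrM divff ?gt_eqF // powRr1 //; lra.
apply: ge0_ler_powR; rewrite ?nnegrE ?mulr_ge0 ?powR_ge0 //.
rewrite (le_trans H) // -lerBrDl -mulrBl -/D.
by rewrite -ler_pdivrMl // mulrC ltW.
Qed.

End LebesguePower.

Section ShellConstants.
Context {R : realType}.
Implicit Types m v eta h t p : R.

(** Here [m] is the dimension, [m + v] the exponent of the weight and [exp h] the ratio of the
    shells. If counts are known up to a factor [c], a shell contains, in units of its inner ball,
    between [exp(mh) / c - c] and [c exp(mh) - 1 / c] points, and summing over shells divides by
    [1 - exp(-vh)]. The target [m / v] is the integral of [m t^(m-1) t^(-m-v)] over [t > 1]. *)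
Lemma shell_constants m v eta : 0 < m -> 0 < v -> 0 < eta -> eta < 1 ->
  exists h c, [/\ 0 < h, 1 < c,
    c * expR (m * h) - c^-1 <= (1 + eta) * (m / v) * (1 - expR (- (v * h))) &
    (1 - eta) * (m / v) * (1 - expR (- (v * h))) <=
      expR (- ((m + v) * h)) * (expR (m * h) / c - c)].
Proof.
(* With this [h] the weight varies across one shell by the factor [1 + eta / 2]. *)
move=> m0 v0 e0 e1; pose h := ln (1 + eta / 2) / (m + v).
have mv0 : 0 < m + v by rewrite addr_gt0.
have h0 : 0 < h by rewrite divr_gt0 // ln_gt0 //; lra.
have hE : expR ((m + v) * h) = 1 + eta / 2.
  by rewrite /h mulrC divfK ?gt_eqF // lnK // posrE; lra.
set u := expR (m * h); set x := expR (- (v * h)).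
have mh0 : 0 < m * h by rewrite mulr_gt0.
have vh0 : 0 < v * h by rewrite mulr_gt0.
have u1 : 1 + m * h <= u by exact: expR_ge1Dx.
have u0 : 0 < u by exact: expR_gt0.
have x0 : 0 < x by exact: expR_gt0.
have xx : 1 - v * h <= x by exact: expR_ge1Dx.
have xv : x * expR (v * h) = 1 by rewrite -expRD addNr expR0.
have xi : (1 + v * h) * x <= 1.
  have : x * (1 + v * h) <= x * expR (v * h) by rewrite ler_pM2l //; exact: expR_ge1Dx.
  by rewrite xv mulrC.
have uu : u - 1 <= m * h * u.
  have : u * (1 - m * h) <= 1; last lra.
  apply: (@le_trans _ _ (u * expR (- (m * h)))); last by rewrite -expRD subrr expR0.
  by rewrite ler_pM2l //; exact: expR_ge1Dx.
have ux : u = (1 + eta / 2) * x.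
  by rewrite -hE -expRD; congr expR; ring.
have x1 : 0 < 1 - x.
  have vhx : 0 < v * h * x by rewrite mulr_gt0.
  lra.
pose a := m / v * (1 - x).
have a0 : 0 < a by rewrite mulr_gt0 // divr_gt0.
have av : v * a = m * (1 - x) by rewrite /a mulrA [v * _]mulrC divfK // gt_eqF.
have H1 : u - 1 <= (1 + eta / 2) * a.
  apply: (le_trans uu); rewrite ux -(ler_pM2l v0).
  have -> : v * (m * h * ((1 + eta / 2) * x)) = (1 + eta / 2) * m * (v * h * x) by ring.
  have -> : v * ((1 + eta / 2) * a) = (1 + eta / 2) * m * (1 - x).
    by rewrite mulrCA av; ring.
  by rewrite ler_pM2l ?mulr_gt0 //; lra.
have H2 : a <= u - 1.
  rewrite -(ler_pM2l v0) av; apply: (@le_trans _ _ (m * (v * h))).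
    by rewrite ler_pM2l //; lra.
  by rewrite mulrCA ler_pM2l //; lra.
(* The counting error has to be small against the shell width, hence is fixed after [h]: passing
   from [c = 1] to [c = 1 + de] changes [u - 1] by at most [de * (u + 1)], a quarter of
   [eta * a]. *)
pose de := eta / 4 * a / (u + 1).
have de0 : 0 < de by rewrite /de !mulr_gt0 // ?invr_gt0; lra.
have du : de * (u + 1) = eta / 4 * a by rewrite /de divfK // gt_eqF //; lra.
have ea : 0 < eta * a by rewrite mulr_gt0.
have c0 : 0 < 1 + de by lra.
have ci : 1 - de <= (1 + de)^-1.
  rewrite -(ler_pM2r c0) mulVf ?gt_eqF //.
  have := sqr_ge0 de; rewrite expr2; lra.
exists h, (1 + de); split => //; first lra.
- rewrite -[leRHS]mulrA -/u -/x -/a; lra.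
- rewrite -[leLHS]mulrA -/u -/x -/a.
  rewrite expRN hE; set E := 1 + eta / 2.
  have E0 : 0 < E by rewrite /E; lra.
  rewrite -(ler_pM2l E0) mulrA [leRHS]mulrA mulfV ?gt_eqF // mul1r.
  have : u * (1 - de) <= u / (1 + de) by rewrite ler_pM2l.
  have : E * (1 - eta) * a <= (1 - eta / 4) * a.
    rewrite ler_pM2r // /E; have : 0 <= eta * eta by rewrite mulr_ge0 // ltW.
    lra.
  lra.
Qed.

Lemma powR_geometric t h p j : 0 < t ->
  powR (t * expR h ^+ j) (- p) = powR t (- p) * expR (- (p * h)) ^+ j.
Proof.
move=> t0; rewrite powRM ?exprn_ge0 ?expR_ge0 //; last exact: ltW.
congr (_ * _); rewrite -expRM_natl -expRM_natl /powR gt_eqF ?expR_gt0 // expRK.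
by congr expR; ring.
Qed.

Lemma geometric_partial (x : R) J :
  (1 - x) * \sum_(j < J) x ^+ j = 1 - x ^+ J.
Proof. by rewrite -opprB mulNr -subrX1 opprB. Qed.

End ShellConstants.

(** * Lattice points in dilated balls and tails of the weights *)

Section Counting.
Context {R : realType} (n : nat) (r : \bar R).
Hypothesis r_gt0 : (0 < r)%E.
Local Notation X := (projT2 (Rsp R n)).
Local Notation lattice := {ffun 'I_n.+1 -> int}.

Definition crd (x : X) (j : 'I_n.+1) : R := coordn x j.
Definition latR (k : lattice) (j : 'I_n.+1) : R := (k j)%:~R.
Definition gball (t : R) : set X := [set x | lr_norm r (crd x) <= t].
Definition latW (k : lattice) : R := gaugeW n.+1 r (latR k).
Definition latball (t : R) : set lattice := [set k | latW k < t].
Definition cube (k : lattice) : set X :=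
  [set x | forall j, latR k j <= crd x j < latR k j + 1].

Lemma measurable_lr_norm : measurable_fun setT (fun x : X => lr_norm r (crd x)).
Proof.
have mc j : measurable_fun setT (fun x : X => `|crd x j|).
  by apply: measurableT_comp => //; exact: measurable_coordn.
rewrite /lr_norm; case: r r_gt0 => [r'| |] // _.
- apply: (measurableT_comp (measurable_powR _)).
  by apply: measurable_sum => j; exact: (measurableT_comp (measurable_powR _)).
- elim: (index_enum _) => [|j l IH].
    rewrite (_ : (fun x : X => _) = cst 0); first exact: measurable_cst.
    by apply/funext => x; rewrite big_nil.
  rewrite (_ : (fun x : X => _) = (fun x : X => Num.max `|crd x j|
    (\big[Num.max/0]_(j <- l) `|crd x j|))); first exact: measurable_maxr.
  by apply/funext => x; rewrite big_cons.
Qed.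

Lemma measurable_gball t : measurable (gball t).
Proof.
have -> : gball t = (fun x : X => lr_norm r (crd x)) @^-1` [set` `]-oo, t]].
  by apply/seteqP; split => x /=; rewrite in_itv.
by rewrite -[X in measurable X]setTI; apply: measurable_lr_norm.
Qed.

Lemma gball_scale t : 0 < t -> gball t = scaln n t^-1 @^-1` gball 1.
Proof.
move=> t0; have E x : lr_norm r (crd (scaln n t^-1 x)) = t^-1 * lr_norm r (crd x).
  rewrite -lr_normZ ?invr_ge0 ?ltW //; congr (lr_norm r _).
  by apply/funext => j; exact: coordn_scaln.
apply/seteqP; split=> x /=; rewrite /gball /= E ler_pdivrMl // mulr1 //.
Qed.

Definition gvol : R := fine (lebm n (gball 1)).

Lemma gball_fin : (lebm n (gball 1) < +oo)%E.
Proof.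
apply: (@le_lt_trans _ _ (lebm n (box n (fun=> -2) (fun=> 2)))); last first.
  rewrite lebm_box ?ltry // => _; lra.
apply: le_measure; [exact/mem_set/measurable_gball|exact/mem_set/measurable_box|].
move=> x xb j jn; have jn' : (j < n.+1)%N by [].
have := le_lr_norm _ _ (crd x) (Ordinal jn') r_gt0; rewrite /crd /=.
move=> /le_trans /(_ xb); rewrite ler_norml => /andP[]; lra.
Qed.

Lemma lebm_gball t : 0 < t -> lebm n (gball t) = (t ^+ n.+1 * gvol)%:E.
Proof.
move=> t0; rewrite gball_scale // lebm_scale ?invr_gt0 //; last exact: measurable_gball.
by rewrite invrK EFinM fineK // ge0_fin_numE // gball_fin.
Qed.

Lemma cubeE k : cube k = box n (fun j => latR k (inord j)) (fun j => latR k (inord j) + 1).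
Proof.
apply/seteqP; split => x H j.
- by move=> jn; have := H (inord j); rewrite /crd inordK.
- by have := H j; rewrite inord_val; apply; rewrite -ltnS.
Qed.

Lemma measurable_cube k : measurable (cube k).
Proof. by rewrite cubeE; exact: measurable_box. Qed.

Lemma lebm_cube k : lebm n (cube k) = 1%E.
Proof.
rewrite cubeE lebm_box => [|j]; last by rewrite lerDl.
by rewrite big1 // => j _; rewrite addrC addKr.
Qed.

(** Half-open cubes tile the space: this gives both that they are disjoint and that every point lies
    in one. *)
Lemma cube_floor x k : cube k x <-> k = [ffun j => Num.floor (crd x j)].
Proof.
split=> [xk|-> j]; last first.
  rewrite /latR ffunE; have := floor_itv (crd x j).
  by rewrite intrD.
apply/ffunP => j; rewrite ffunE; apply/esym/floor_def.
by have := xk j; rewrite /latR intrD.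
Qed.

Lemma cube_near k x j : cube k x -> `|crd x j| <= `|latR k j| + 1 /\
  `|latR k j| <= `|crd x j| + 1.
Proof.
move=> /(_ j) /andP[H1 H2].
have H : `|crd x j - latR k j| <= 1 by rewrite ler_norml; apply/andP; split; lra.
split.
- by rewrite -[crd x j](subrK (latR k j)) (le_trans (ler_normD _ _)) // addrC lerD2l.
- rewrite -[X in `|X| <= _](subrK (crd x j)) (le_trans (ler_normD _ _)) // addrC.
  by rewrite lerD2l distrC.
Qed.

Lemma latW_ge1 k : 1 <= latW k.
Proof. exact: gaugeW_ge1. Qed.

Lemma latW_gt0 k : 0 < latW k.
Proof. exact: lt_le_trans (latW_ge1 k). Qed.

(** The gauge dominates each coordinate, so the set lies in the box [[-m, m]^(n+1)], parametrised by
    ordinals shifted by [m]. *)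
Lemma finite_latball t : finite_set (latball t).
Proof.
pose m := `|Num.ceil t|%N.
pose g (f : {ffun 'I_n.+1 -> 'I_(m + m).+1}) : lattice :=
  [ffun j => (f j)%:Z - m%:Z].
apply: (@sub_finite_set _ _ [set g f | f in setT]); last first.
  by apply: finite_image; exact: finite_finset.
move=> k kt /=.
have kb j : `|k j| <= m%:Z.
  have H : `|latR k j| < t.
    apply: le_lt_trans kt; apply: le_trans (lr_norm_le_gaugeW _ _ _ r_gt0).
    exact: le_lr_norm.
  have : `|(k j)%:~R : R| <= (Num.ceil t)%:~R by rewrite (le_trans (ltW H)) // ceil_ge.
  rewrite -intr_norm ler_int => /le_trans; apply; rewrite /m abszE; exact: ler_norm.
exists [ffun j => inord (absz (k j + m%:Z))] => //.
apply/ffunP => j; rewrite !ffunE inordK.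
  by move: (kb j); move: (k j : int) => z; rewrite ler_norml => /andP[? ?]; lia.
by move: (kb j); move: (k j : int) => z; rewrite ler_norml => /andP[? ?]; lia.
Qed.

Definition latcount (t : R) : nat := #|` fset_set (latball t)|.

Lemma lebm_cubes t : lebm n (\bigcup_(k in latball t) cube k) = (latcount t)%:R%:E.
Proof.
rewrite measure_fin_bigcup; last first.
- by move=> k _; exact: measurable_cube.
- move=> k l _ _ [x [/cube_floor -> /cube_floor ->]] //.
- exact: finite_latball.
rewrite (eq_fsbigr (fun=> 1%E)) => [|k _]; last exact: lebm_cube.
rewrite fsbig_finite /=; last exact: finite_latball.
by rewrite sumEFin big_const_seq count_predT iter_addr_0 /latcount /= cardfE.
Qed.

(** The union of the cubes at the points of [latball t] has measure [latcount t] and lies between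
    the balls of radius [t / b] and [b t], where [b^(n+1) = c]. *)
Lemma latcount_sandwich (c : R) : 1 < c -> exists t0, 1 < t0 /\ forall t, t0 <= t ->
  gvol * t ^+ n.+1 / c <= (latcount t)%:R <= c * (gvol * t ^+ n.+1).
Proof.
move=> c1.
pose b := powR c (n.+1%:R^-1).
have c0 : 0 < c by lra.
have bc : b ^+ n.+1 = c.
  by rewrite -powR_mulrn ?powR_ge0 // /b -powRrM mulVf ?powRr1 ?ltW // pnatr_eq0.
have b1 : 1 < b.
  rewrite ltNge; apply/negP => b1.
  have : b ^+ n.+1 <= 1 by rewrite exprn_ile1 // powR_ge0.
  by rewrite bc; lra.
have b0 : 0 < b by lra.
(* Comparing gauges with a factor [a] strictly below [b] leaves room for the strict inequality that
   defines [latball]. *)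
pose a := (1 + b) / 2.
have a1 : 0 < a - 1 by rewrite /a; lra.
have ab : a < b by rewrite /a; lra.
have a0 : 0 < a by lra.
have [C [C0 HC]] := gaugeW_le n.+1 r (a - 1) r_gt0 a1.
rewrite addrC subrK in HC.
have mU t : measurable (\bigcup_(k in latball t) cube k).
  by apply: fin_bigcup_measurable => [|k _]; [exact: finite_latball|exact: measurable_cube].
exists (C + 2); split; first lra.
move=> t Ct; have t0 : 0 < t by lra.
apply/andP; split.
- have <- : (b^-1 * t) ^+ n.+1 * gvol = gvol * t ^+ n.+1 / c.
    by rewrite exprMn exprVn bc; ring.
  rewrite -lee_fin -lebm_gball ?mulr_gt0 ?invr_gt0 // -lebm_cubes.
  apply: le_measure; [exact/mem_set/measurable_gball|exact/mem_set/mU|].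
  move=> x xb; exists [ffun j => Num.floor (crd x j)]; last exact/cube_floor.
  rewrite /latball /= /latW.
  apply: (@le_lt_trans _ _ (Num.max (a * lr_norm r (crd x)) C)).
    by apply: HC => j; have [] := cube_near _ _ j ((cube_floor x _).2 erefl).
  rewrite gt_max; apply/andP; split; last lra.
  apply: (@le_lt_trans _ _ (a * (b^-1 * t))); first by rewrite ler_pM2l.
  by rewrite mulrA gtr_pMl // -[ltRHS](divff (lt0r_neq0 b0)) ltr_pM2r ?invr_gt0.
- have -> : c * (gvol * t ^+ n.+1) = (b * t) ^+ n.+1 * gvol by rewrite exprMn bc; ring.
  rewrite -lee_fin -lebm_gball ?mulr_gt0 // -lebm_cubes.
  apply: le_measure; [exact/mem_set/mU|exact/mem_set/measurable_gball|].
  move=> x [k kt xk]; rewrite /gball /=.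
  apply: (@le_trans _ _ (gaugeW n.+1 r (crd x))); first exact: lr_norm_le_gaugeW.
  apply: (@le_trans _ _ (Num.max (a * lr_norm r (latR k)) C)).
    by apply: HC => j; have [] := cube_near _ _ j xk.
  rewrite ge_max; apply/andP; split.
    apply: ler_pM => //; [exact: ltW|exact: lr_norm_ge0|exact: ltW|].
    by apply: le_trans (ltW kt); exact: lr_norm_le_gaugeW.
  by rewrite -[C]mul1r ler_pM; lra.
Qed.

(** The origin is counted at [t0], and the count is at most [2 * gvol * t0^(n+1)]. *)
Lemma gvol_gt0 : 0 < gvol.
Proof.
have [t0 [t1 /(_ _ (lexx t0)) /andP[_ H]]] := latcount_sandwich 2 ltac:(lra).
have k0 : latball t0 [ffun=> 0].
  rewrite /latball /= /latW (_ : latR _ = fun=> 0); last first.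
    by apply/funext => j; rewrite /latR ffunE.
  rewrite /gaugeW; case: r r_gt0 => [r'| |] // r0.
  - rewrite /qsum big1 ?addr0 ?powR1 // => j _.
    by rewrite normr0 powR0 // gt_eqF.
  - apply/le_lt_trans: t1; rewrite ge_max lexx; apply: bigmax_le => // j _.
    by rewrite normr0.
have : (0 < latcount t0)%N.
  rewrite cardfs_gt0; apply/fset0Pn; exists [ffun=> 0].
  by rewrite in_fset_set; [exact/mem_set|exact: finite_latball].
rewrite -(ltr0n R) => /lt_le_trans /(_ H).
by rewrite pmulr_rgt0 // pmulr_lgt0 // exprn_gt0 //; lra.
Qed.

(** Tails are handled through finite sums: an upper bound is asked of every finite [K], a lower
    bound of a suitable one. *)
Definition latsum (p : R) (K : {fset lattice}) : R :=
  \sum_(k <- K) powR (latW k) (- p).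

Lemma shell_card a b (K : {fset lattice}) : a <= b ->
  (forall k, k \in K -> a <= latW k < b) ->
  (#|` K|%:R : R) <= (latcount b)%:R - (latcount a)%:R.
Proof.
move=> ab HK; rewrite lerBrDr -natrD ler_nat /latcount.
have fa := finite_latball a; have fb := finite_latball b.
have sub : (K `|` fset_set (latball a) `<=` fset_set (latball b))%fset.
  apply/fsubsetP => k; rewrite in_fsetU in_fset_set // => /orP[/HK /andP[_ H]|].
    by rewrite in_fset_set //; exact/mem_set.
  rewrite in_fset_set // => /set_mem H; apply/mem_set; exact: lt_le_trans H ab.
have dis : (K `&` fset_set (latball a) = fset0)%fset.
  apply/fsetP => k; rewrite in_fsetI in_fset0; apply/negbTE/negP => /andP[/HK /andP[H _]].
  by rewrite in_fset_set // => /set_mem; rewrite /latball /= ltNge H.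
have := fsubset_leq_card sub; rewrite cardfsU dis cardfs0 subn0; exact.
Qed.

Lemma shell_fset a b : a <= b -> exists K : {fset lattice},
  (forall k, k \in K -> a <= latW k < b) /\
  (#|` K|%:R : R) = (latcount b)%:R - (latcount a)%:R.
Proof.
move=> ab; have fa := finite_latball a; have fb := finite_latball b.
exists (fset_set (latball b) `\` fset_set (latball a))%fset; split=> [k|].
  rewrite in_fsetD !in_fset_set // => /andP[/negP Ha /set_mem Hb].
  rewrite Hb andbT leNgt; apply/negP => H; apply: Ha; exact/mem_set.
rewrite cardfsD (_ : (_ `&` _)%fset = fset_set (latball a)); last first.
  apply/fsetIidPr/fsubsetP => k; rewrite !in_fset_set // => /set_mem H.
  apply/mem_set; exact: lt_le_trans H ab.
rewrite natrB //; apply: fsubset_leq_card; apply/fsubsetP => k.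
by rewrite !in_fset_set // => /set_mem H; apply/mem_set; exact: lt_le_trans H ab.
Qed.

Lemma powR_neg_le (p a b : R) : 0 <= p -> 0 < a -> a <= b -> powR b (- p) <= powR a (- p).
Proof.
move=> p0 a0 ab; rewrite !powRN lef_pV2 ?posrE ?powR_gt0 //; last exact: lt_le_trans ab.
by apply: ge0_ler_powR => //; rewrite nnegrE; apply: ltW => //; exact: lt_le_trans ab.
Qed.

(** Each shell is charged the weight at its inner radius, where it is largest; the induction splits
    off the outermost shell. The lower estimate uses outer radii in the same way. *)
Lemma shell_sum_upper p (t q : R) J (K : {fset lattice}) : 0 <= p -> 0 < t -> 1 < q ->
  (forall k, k \in K -> t <= latW k < t * q ^+ J) ->
  latsum p K <= \sum_(j < J) powR (t * q ^+ j) (- p) *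
     ((latcount (t * q ^+ j.+1))%:R - (latcount (t * q ^+ j))%:R).
Proof.
move=> p0 t0 q1; have q0 : 0 < q by lra.
elim: J K => [|J IH] K HK.
  rewrite big_ord0 /latsum big_seq big1 // => k /HK.
  by rewrite mulr1 => /andP[/le_lt_trans/[apply]]; rewrite ltxx.
rewrite big_ord_recr /= /latsum (bigID (fun k => latW k < t * q ^+ J)) /=.
apply: lerD.
  rewrite -big_filter; set l := [seq _ <- _ | _].
  have := IH [fset k in l]%fset; rewrite /latsum.
  rewrite (perm_big l) /=; first apply; last first.
    apply: uniq_perm; [exact: fset_uniq|exact/filter_uniq/fset_uniq|].
    by move=> k; rewrite inE.
  by move=> k; rewrite !inE mem_filter => /andP[-> /HK /andP[->]].
rewrite -big_filter; set l := [seq _ <- _ | _].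
apply: (@le_trans _ _ (\sum_(k <- l) powR (t * q ^+ J) (- p))).
  rewrite big_seq [leRHS]big_seq; apply: ler_sum => k.
  rewrite mem_filter -leNgt => /andP[H _]; apply: powR_neg_le => //.
  by rewrite mulr_gt0 // exprn_gt0.
rewrite big_const_seq count_predT iter_addr_0 -[leLHS]mulr_natr.
rewrite ler_wpM2l ?powR_ge0 //.
have -> : size l = #|` [fset k in l]%fset|.
  apply: perm_size; apply: uniq_perm; [exact/filter_uniq/fset_uniq|exact: fset_uniq|].
  by move=> k; rewrite inE.
apply: shell_card.
  by rewrite ler_pM2l // ler_eXn2l // leqnSn.
move=> k; rewrite !inE mem_filter -leNgt => /andP[-> /HK /andP[_ ->]] //.
Qed.

Lemma shell_sum_lower p (t q : R) J : 0 <= p -> 0 < t -> 1 < q ->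
  exists K : {fset lattice}, (forall k, k \in K -> t <= latW k < t * q ^+ J) /\
  \sum_(j < J) powR (t * q ^+ j.+1) (- p) *
     ((latcount (t * q ^+ j.+1))%:R - (latcount (t * q ^+ j))%:R) <= latsum p K.
Proof.
move=> p0 t0 q1; have q0 : 0 < q by lra.
elim: J => [|J [K [HK IH]]].
  by exists fset0; rewrite /latsum !(big_ord0, big_seq_fset0); split => // k; rewrite inE.
have tJ : 0 < t * q ^+ J by rewrite mulr_gt0 // exprn_gt0.
have qJ : t * q ^+ J <= t * q ^+ J.+1 by rewrite ler_pM2l // ler_eXn2l // leqnSn.
have [L [HL cL]] := shell_fset _ _ qJ.
have dis : [disjoint K & L]%fset.
  apply/fdisjointP => k /HK /andP[_ H]; apply/negP => /HL /andP[].
  by move=> /(lt_le_trans H); rewrite ltxx.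
exists (K `|` L)%fset; split.
  move=> k; rewrite in_fsetU => /orP[/HK|/HL] /andP[H1 H2]; apply/andP; split => //.
  - exact: lt_le_trans H2 qJ.
  - apply: le_trans H1; rewrite ler_peMr //; first exact: ltW.
    by rewrite exprn_ege1 // ltW.
rewrite big_ord_recr /= /latsum (perm_big (K ++ L)) ?big_cat /=; last first.
  apply: uniq_perm; [exact: fset_uniq| |by move=> k; rewrite in_fsetU mem_cat].
  rewrite cat_uniq !fset_uniq andbT /=; apply/hasPn => k kL /=.
  by apply/negP => kK; move/fdisjointP/(_ _ kK)/negP: dis.
apply: lerD => //; rewrite -cL mulr_natr -iter_addr_0 -(count_predT L) -big_const_seq.
rewrite big_seq [leRHS]big_seq; apply: ler_sum => k /HL /andP[H1 H2].
by apply: powR_neg_le; [|exact: latW_gt0|exact: ltW].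
Qed.

Lemma tail_upper (p eta : R) : n.+1%:R < p -> 0 < eta -> eta < 1 ->
  exists t0, 1 < t0 /\ forall t, t0 <= t -> forall K : {fset lattice},
  (forall k, k \in K -> t <= latW k) ->
  latsum p K <= (1 + eta) *
    (gvol * (n.+1%:R / (p - n.+1%:R)) * (powR t (- p) * t ^+ n.+1)).
Proof.
move=> mp e0 e1; set m : R := n.+1%:R; have m0 : 0 < m by rewrite ltr0n.
have v0 : 0 < p - m by rewrite subr_gt0.
have [h [c [h0 c1 Hup _]]] := shell_constants m (p - m) eta m0 v0 e0 e1.
have [t0 [t01 HN]] := latcount_sandwich c c1.
exists t0; split=> // t tt0 K HK.
have t1 : 1 < t by exact: lt_le_trans tt0.
have t_gt0 : 0 < t by lra.
have q1 : 1 < expR h by rewrite expR_gt1.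
have p0 : 0 <= p by lra.
(* A finite [K] meets finitely many shells: [B] bounds every gauge on [K], and
   [exp(h)^J >= 1 + J h > B]. *)
pose B := \sum_(k <- K) latW k.
have B0 : 0 <= B by apply: sumr_ge0 => k _; exact/ltW/latW_gt0.
pose J := Num.bound (B / h).
have BJ : B < t * expR h ^+ J.
  have : B / h < J%:R by apply: archi_boundP; rewrite divr_ge0 // ltW.
  rewrite ltr_pdivrMr // => H.
  have : 1 + J%:R * h <= expR h ^+ J by rewrite -expRM_natl; exact: expR_ge1Dx.
  have : expR h ^+ J <= t * expR h ^+ J.
    by rewrite ler_peMl ?exprn_ge0 ?expR_ge0 //; exact: ltW.
  by move: (expR h ^+ J) H => Q; lra.
have HK' k : k \in K -> t <= latW k < t * expR h ^+ J.
  move=> kK; rewrite HK //=; apply: le_lt_trans BJ.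
  rewrite /B (big_fsetD1 k) //= lerDl; apply: sumr_ge0 => l _; exact/ltW/latW_gt0.
apply: (le_trans (shell_sum_upper p t (expR h) J K p0 t_gt0 q1 HK')).
set u := expR (m * h) in Hup; set x := expR (- ((p - m) * h)) in Hup.
have x0 : 0 < x by exact: expR_gt0.
have x1 : x < 1 by rewrite expR_lt1 oppr_lt0 mulr_gt0.
have uE : expR h ^+ n.+1 = u by rewrite -expRM_natl.
pose A := gvol * (powR t (- p) * t ^+ n.+1).
have A0 : 0 <= A by rewrite !mulr_ge0 ?powR_ge0 ?exprn_ge0 // ltW // gvol_gt0.
apply: (@le_trans _ _ (\sum_(j < J) A * (c * u - c^-1) * x ^+ j)).
  apply: ler_sum => j _; rewrite powR_geometric //.
  have tj i : t0 <= t * expR h ^+ i.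
    by apply: (le_trans tt0); rewrite ler_peMr // ?exprn_ege1 // ltW.
  have /andP[_ N1] := HN _ (tj j.+1); have /andP[N2 _] := HN _ (tj j).
  set y := expR (- (p * h)).
  have E i : (t * expR h ^+ i) ^+ n.+1 = t ^+ n.+1 * u ^+ i by rewrite exprMn exprAC uE.
  have xE : x = u * y by rewrite /x /u /y -expRD; congr expR; ring.
  have y0 : 0 < y by exact: expR_gt0.
  have -> : A * (c * u - c^-1) * x ^+ j = powR t (- p) * y ^+ j *
    (c * (gvol * (t * expR h ^+ j.+1) ^+ n.+1) - gvol * (t * expR h ^+ j) ^+ n.+1 / c).
    rewrite /A !E xE exprMn (exprS _ j); move: (t ^+ n.+1) => T; ring.
  rewrite ler_wpM2l //; last exact: lerB.
  by rewrite mulr_ge0 ?powR_ge0 // exprn_ge0 // ltW.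
rewrite -mulr_sumr.
have -> : (1 + eta) * (gvol * (m / (p - m)) * (powR t (- p) * t ^+ n.+1)) =
   A * ((1 + eta) * (m / (p - m))) by rewrite /A; ring.
rewrite -mulrA ler_wpM2l //.
have x1' : 0 < 1 - x by rewrite subr_gt0.
rewrite -(ler_pM2r x1') -[leLHS]mulrA [X in _ * X]mulrC geometric_partial.
(* The sign allows the partial geometric sum to be replaced by the full one. *)
have cu : 0 <= c * u - c^-1.
  have ci : c^-1 <= 1 by rewrite invf_le1 ?ltW // (lt_trans ltr01).
  have u1 : 1 < u by rewrite expR_gt1 mulr_gt0.
  by rewrite subr_ge0 (le_trans ci) // ltW // mulr_egt1.
apply: le_trans Hup.
by rewrite ler_piMr // gerBl exprn_ge0 // ltW.
Qed.

(** One factor [1 - eta] comes from the shell constants. The other pays for stopping after [J]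
    shells, with [J] such that the remainder [x^J] of the geometric series is at most [eta]. *)
Lemma tail_lower (p eta : R) : n.+1%:R < p -> 0 < eta -> eta < 1 ->
  exists t0, 1 < t0 /\ forall t, t0 <= t -> exists K : {fset lattice},
  (forall k, k \in K -> t <= latW k) /\
  (1 - eta) ^+ 2 *
    (gvol * (n.+1%:R / (p - n.+1%:R)) * (powR t (- p) * t ^+ n.+1)) <= latsum p K.
Proof.
move=> mp e0 e1; set m : R := n.+1%:R; have m0 : 0 < m by rewrite ltr0n.
have v0 : 0 < p - m by rewrite subr_gt0.
have [h [c [h0 c1 _ Hlo]]] := shell_constants m (p - m) eta m0 v0 e0 e1.
have [t0 [t01 HN]] := latcount_sandwich c c1.
exists t0; split=> // t tt0.
have t1 : 1 < t by exact: lt_le_trans tt0.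
have t_gt0 : 0 < t by lra.
have q1 : 1 < expR h by rewrite expR_gt1.
have p0 : 0 <= p by lra.
set u := expR (m * h) in Hlo; set x := expR (- ((p - m) * h)) in Hlo.
have x0 : 0 < x by exact: expR_gt0.
have x1 : x < 1 by rewrite expR_lt1 oppr_lt0 mulr_gt0.
have uE : expR h ^+ n.+1 = u by rewrite -expRM_natl.
have vh0 : 0 < (p - m) * h by rewrite mulr_gt0.
pose J := Num.bound (eta^-1 / ((p - m) * h)).
have xJ : x ^+ J <= eta.
  have : eta^-1 / ((p - m) * h) < J%:R.
    by apply: archi_boundP; rewrite divr_ge0 ?invr_ge0 // ltW.
  rewrite ltr_pdivrMr // => H.
  rewrite /x -expRM_natl mulrN expRN -[leRHS]invrK lef_pV2 ?posrE ?expR_gt0 ?invr_gt0 //.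
  have := expR_ge1Dx (J%:R * ((p - m) * h)); lra.
have [K [HK HS]] := shell_sum_lower p t (expR h) J p0 t_gt0 q1.
exists K; split=> [k /HK /andP[]//|]; apply: le_trans HS.
pose A := gvol * (powR t (- p) * t ^+ n.+1).
have A0 : 0 <= A by rewrite !mulr_ge0 ?powR_ge0 ?exprn_ge0 // ltW // gvol_gt0.
set y := expR (- (p * h)).
have pE : m + (p - m) = p by ring.
rewrite pE -/y in Hlo.
apply: (@le_trans _ _ (\sum_(j < J) A * (y * (u / c - c)) * x ^+ j)); last first.
  apply: ler_sum => j _; rewrite powR_geometric // -/y.
  have tj i : t0 <= t * expR h ^+ i.
    by apply: (le_trans tt0); rewrite ler_peMr // ?exprn_ege1 // ltW.
  have /andP[N1 _] := HN _ (tj j.+1); have /andP[_ N2] := HN _ (tj j).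
  have E i : (t * expR h ^+ i) ^+ n.+1 = t ^+ n.+1 * u ^+ i by rewrite exprMn exprAC uE.
  have xE : x = u * y by rewrite /x /u /y -expRD; congr expR; ring.
  have y0 : 0 < y by exact: expR_gt0.
  have -> : A * (y * (u / c - c)) * x ^+ j = powR t (- p) * y ^+ j.+1 *
    (gvol * (t * expR h ^+ j.+1) ^+ n.+1 / c - c * (gvol * (t * expR h ^+ j) ^+ n.+1)).
    rewrite /A !E xE exprMn !(exprS _ j); move: (t ^+ n.+1) => T; ring.
  rewrite ler_wpM2l //; last exact: lerB.
  by rewrite mulr_ge0 ?powR_ge0 // exprn_ge0 // ltW.
rewrite -mulr_sumr.
have -> : (1 - eta) ^+ 2 * (gvol * (m / (p - m)) * (powR t (- p) * t ^+ n.+1)) =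
   A * ((1 - eta) ^+ 2 * (m / (p - m))) by rewrite /A; ring.
rewrite -mulrA ler_wpM2l //.
have x1' : 0 < 1 - x by rewrite subr_gt0.
rewrite -(ler_pM2r x1') -[leRHS]mulrA [X in _ <= _ * X]mulrC geometric_partial.
have e1' : 0 < 1 - eta by lra.
have mv : 0 < m / (p - m) by rewrite divr_gt0.
have -> : (1 - eta) ^+ 2 * (m / (p - m)) * (1 - x) =
  (1 - eta) * (m / (p - m)) * (1 - x) * (1 - eta) by ring.
apply: ler_pM => //; last by rewrite lerB.
- by apply: mulr_ge0; [apply: mulr_ge0|]; exact: ltW.
- exact: ltW.
Qed.

End Counting.

(** * Uniqueness of Fourier coefficients *)

Section StepPolynomials.
Context {R : realType}.
Implicit Types u y z : R.

Lemma bernoulli_onem y N : 0 <= y <= 1 -> 1 - N%:R * y <= (1 - y) ^+ N.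
Proof.
move=> /andP[y0 y1]; elim: N => [|N IH]; first by rewrite mul0r subr0.
rewrite exprS; apply: (@le_trans _ _ ((1 - y) * (1 - N%:R * y))); last first.
  by rewrite ler_wpM2l // subr_ge0.
have : 0 <= N%:R * y * y by rewrite !mulr_ge0.
rewrite -natr1; lra.
Qed.

(** By Bernoulli the left side is at most [((1 - y) (1 + y))^N]. *)
Lemma onem_expr_le y N : 0 <= y <= 1 -> (1 - y) ^+ N * (1 + N%:R * y) <= 1.
Proof.
move=> /andP[y0 y1]; have y1' : 0 <= 1 - y by rewrite subr_ge0.
apply: (@le_trans _ _ ((1 - y) ^+ N * (1 + y) ^+ N)).
  rewrite ler_wpM2l ?exprn_ge0 //; elim: N => [|N IH]; first by rewrite mul0r addr0.
  rewrite exprS; apply: (@le_trans _ _ ((1 + y) * (1 + N%:R * y))); last first.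
    by rewrite ler_wpM2l // addr_ge0.
  have : 0 <= N%:R * y * y by rewrite !mulr_ge0.
  rewrite -natr1; lra.
rewrite -exprMn exprn_ile1 //.
  by rewrite mulr_ge0 // addr_ge0.
have : 0 <= y * y by rewrite mulr_ge0.
lra.
Qed.

(** With [y] the square root of [z], one factor [y^n] keeps [n y^n] below a geometric sum and the
    other tends to 0. *)
Lemma cvg_natr_exprn z : 0 <= z < 1 -> (fun n => n%:R * z ^+ n) @ \oo --> (0 : R).
Proof.
move=> /andP[z0 z1]; pose y := Num.sqrt z.
have y0 : 0 <= y by exact: sqrtr_ge0.
have y1 : y < 1 by rewrite -[ltRHS]sqrtr1 ltr_sqrt.
have yz : y ^+ 2 = z by rewrite sqr_sqrtr.
have y1' : 0 < 1 - y by rewrite subr_gt0.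
have B n : n%:R * y ^+ n <= (1 - y)^-1.
  rewrite -(ler_pM2l y1') mulfV ?gt_eqF //.
  apply: (@le_trans _ _ ((1 - y) * \sum_(i < n) y ^+ i)); last first.
    by rewrite geometric_partial gerBl exprn_ge0.
  have -> : n%:R * y ^+ n = \sum_(i < n) y ^+ n by rewrite sumr_const card_ord mulr_natl.
  rewrite ler_pM2l //; apply: ler_sum => i _; apply: ler_wiXn2l; [by []|exact: ltW|exact/ltnW/ltn_ord].
apply: (@squeeze_cvgr _ _ _ _ (fun=> 0) (fun n => (1 - y)^-1 * y ^+ n)).
- near=> n; rewrite mulr_ge0 ?exprn_ge0 //=.
  by rewrite -yz -exprM mul2n -addnn exprD mulrA ler_wpM2r ?exprn_ge0.
- exact: cvg_cst.
- rewrite -[X in _ --> X](mulr0 (1 - y)^-1); apply: cvgMr.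
  by apply: cvg_expr; rewrite ger0_norm.
Unshelve. all: by end_near. Qed.

(** A device of elementary proofs of the Stone-Weierstrass theorem. With [N = n 2^n], the product
    [N u^n = n (2u)^n] tends to 0 for [u < 1/2] and to infinity for [u >= 1/2], which makes the
    power tend to 1 and to 0 respectively. *)
Definition step_poly n u := (1 - u ^+ n) ^+ (n * 2 ^ n).

Lemma step_poly_itv n u : 0 <= u <= 1 -> 0 <= step_poly n u <= 1.
Proof.
move=> /andP[u0 u1]; have un : 0 <= u ^+ n <= 1.
  by rewrite exprn_ge0 //= exprn_ile1.
by rewrite /step_poly exprn_ge0 ?exprn_ile1 //; lra.
Qed.

Lemma cvg_step_poly u : 0 <= u <= 1 ->
  (fun n => step_poly n u) @ \oo --> ((u < 2^-1)%R%:R : R).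
Proof.
move=> uI; have /andP[u0 u1] := uI.
have un n : 0 <= u ^+ n <= 1 by rewrite exprn_ge0 //= exprn_ile1.
have E n : (n * 2 ^ n)%:R * u ^+ n = n%:R * (2 * u) ^+ n :> R.
  by rewrite natrM natrX exprMn mulrA.
case: ltP => h.
- apply: (@squeeze_cvgr _ _ _ _ (fun n => 1 - n%:R * (2 * u) ^+ n) (fun=> 1)).
  + near=> n; have /andP[_ ->] := step_poly_itv n u uI; rewrite andbT -E.
    exact: bernoulli_onem.
  + rewrite -[X in _ --> X]subr0; apply: cvgB; first exact: cvg_cst.
    by apply: cvg_natr_exprn; lra.
  + exact: cvg_cst.
- apply: (@squeeze_cvgr _ _ _ _ (fun=> 0) (fun n => n.+1%:R^-1)).
  + near=> n; have /andP[s0 s1] := step_poly_itv n u uI; rewrite s0 /=.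
    have : step_poly n u * (1 + n%:R * (2 * u) ^+ n) <= 1.
      by rewrite -E; exact: onem_expr_le.
    have n1 : 0 < n.+1%:R :> R by rewrite ltr0n.
    rewrite -[n.+1%:R^-1]div1r ler_pdivlMr //; apply: le_trans.
    rewrite ler_wpM2l // -natr1 addrC lerD2l ler_peMr // exprn_ege1 //; lra.
  + exact: cvg_cst.
  + exact: cvg_harmonic.
Unshelve. all: by end_near. Qed.

End StepPolynomials.

Section BoundedMeasurable.
Context {R : realType} {d : measure_display} {T : measurableType d}.
Implicit Types f g h : T -> R.

Definition bmeas f := measurable_fun setT f /\ exists M, forall x, `|f x| <= M.

Lemma bmeas_cst (c : R) : bmeas (fun=> c).
Proof. by split; [exact: measurable_cst | exists `|c|]. Qed.

Lemma bmeasD f g : bmeas f -> bmeas g -> bmeas (fun x => f x + g x).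
Proof.
move=> [mf [M HM]] [mg [N HN]]; split; first exact: measurable_funD.
by exists (M + N) => x; rewrite (le_trans (ler_normD _ _)) // lerD.
Qed.

Lemma bmeasM f g : bmeas f -> bmeas g -> bmeas (fun x => f x * g x).
Proof.
move=> [mf [M HM]] [mg [N HN]]; split; first exact: measurable_funM.
by exists (M * N) => x; rewrite normrM ler_pM.
Qed.

Lemma bmeasX f n : bmeas f -> bmeas (fun x => f x ^+ n).
Proof.
move=> bf; elim: n => [|n IH]; first exact: bmeas_cst.
by under eq_fun do rewrite exprS; exact: bmeasM.
Qed.

Lemma bmeas_comp {d' : measure_display} {T' : measurableType d'} (g : T' -> R) (p : T -> T') :
  measurable_fun setT p -> measurable_fun setT g -> (exists M, forall x, `|g x| <= M) ->
  bmeas (g \o p).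
Proof.
move=> mp mg [M HM]; split; first exact: measurableT_comp mp.
by exists M => x; exact: HM.
Qed.

Lemma bmeas_cos f : measurable_fun setT f -> bmeas (fun x => cos (f x)).
Proof.
move=> mf; split; last by exists 1 => x; rewrite ler_norml cos_geN1 cos_le1.
apply: (measurableT_comp (f := @cos R)) => //.
by apply: continuous_measurable_fun; exact: continuous_cos.
Qed.

Lemma bmeas_sin f : measurable_fun setT f -> bmeas (fun x => sin (f x)).
Proof.
move=> mf; split; last by exists 1 => x; rewrite ler_norml sin_geN1 sin_le1.
apply: (measurableT_comp (f := @sin R)) => //.
by apply: continuous_measurable_fun; exact: continuous_sin.
Qed.

Lemma bmeas_indic (A : set T) : measurable A -> bmeas (\1_A : T -> R).
Proof.
move=> mA; split; first exact: measurable_indic.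
by exists 1 => x; rewrite indicE; case: (x \in A); rewrite ?normr1 ?normr0.
Qed.

Lemma bmeas_bounded f : bmeas f -> [bounded f x | x in setT].
Proof.
move=> [_ [M HM]]; exists M; split; first exact: num_real.
by move=> N MN x _ /=; apply: (le_trans (HM x)); exact: ltW.
Qed.

Variable P : probability T R.

Lemma bmeas_integrable f : bmeas f -> P.-integrable setT (EFin \o f).
Proof.
move=> bf; apply: measurable_bounded_integrable => //; last exact: bmeas_bounded.
- by apply: (@le_lt_trans _ _ 1%E); [exact: probability_le1 | exact: ltry].
- by case: bf.
Qed.

Lemma integrableMbmeas h f : P.-integrable setT (EFin \o h) -> bmeas f ->
  P.-integrable setT (EFin \o (fun x => h x * f x)).
Proof.
move=> ih bf; apply: (integrableMl measurableT ih); first by case: bf.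
exact: bmeas_bounded.
Qed.

End BoundedMeasurable.

(** * Functions orthogonal to a family of test functions, and their multipliers *)

Section TestFunctions.
Context {R : realType} {d : measure_display} {T : measurableType d}.
Variables (P : probability T R) (Phi : set (T -> R)).
Hypothesis bPhi : forall phi, Phi phi -> bmeas phi.
Implicit Types f g h u v : T -> R.

Definition annihilates h := P.-integrable setT (EFin \o h) /\
  forall phi, Phi phi -> (\int[P]_x (h x * phi x)%:E = 0)%E.

Lemma annihilatesD h1 h2 : annihilates h1 -> annihilates h2 ->
  annihilates (fun x => h1 x + h2 x).
Proof.
move=> [i1 H1] [i2 H2]; split.
  have := integrableD measurableT i1 i2; exact.
move=> phi Hphi.
under eq_integral do rewrite mulrDl EFinD.
rewrite integralD //; [|exact: integrableMbmeas (bPhi _ _)..].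
by rewrite H1 // H2 // adde0.
Qed.

Lemma annihilatesZ (c : R) h : annihilates h -> annihilates (fun x => c * h x).
Proof.
move=> [i1 H1]; split.
  have := integrableZl measurableT c i1; exact.
move=> phi Hphi.
under eq_integral do rewrite -mulrA EFinM.
rewrite integralZl //; [|exact: integrableMbmeas (bPhi _ _)].
by rewrite H1 // mule0.
Qed.

Lemma annihilates_ae h1 h2 : measurable_fun setT h2 -> {ae P, forall x, h1 x = h2 x} ->
  annihilates h1 -> annihilates h2.
Proof.
move=> m2 E [i1 H1]; split.
  apply/integrableP; split; first exact/measurable_EFinP.
  have -> : (\int[P]_x `|(EFin \o h2) x| = \int[P]_x `|(EFin \o h1) x|)%E.
    apply: ae_eq_integral => //.
    - by apply: measurableT_comp => //; exact/measurable_EFinP.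
    - by apply: measurableT_comp => //; apply: measurable_int i1.
    - by apply: filterS E => x /= ->.
  by case/integrableP: i1.
move=> phi Hphi; rewrite -(H1 _ Hphi); apply: ae_eq_integral => //.
- by apply/measurable_EFinP; apply: measurable_funM => //; case: (bPhi _ Hphi).
- apply/measurable_EFinP; apply: measurable_funM; last by case: (bPhi _ Hphi).
  exact/measurable_EFinP/(measurable_int _ i1).
- by apply: filterS E => x /= ->.
Qed.

(* When products of functions in [Phi] are spanned by [Phi], every [phi] in
   [Phi] is a multiplier; multipliers form an algebra closed under bounded
   pointwise limits, so the sets with multiplier indicator form a sigma-algebra. *)
Definition multiplier u := bmeas u /\
  forall h, annihilates h -> annihilates (fun x => h x * u x).

Lemma multiplier_cst c : multiplier (fun=> c).
Proof.
split=> [|h Hh]; first exact: bmeas_cst.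
by under eq_fun do rewrite mulrC; exact: annihilatesZ.
Qed.

Lemma multiplierD u v : multiplier u -> multiplier v -> multiplier (fun x => u x + v x).
Proof.
move=> [bu Hu] [bv Hv]; split=> [|h Hh]; first exact: bmeasD.
under eq_fun do rewrite mulrDr; apply: annihilatesD; [exact: Hu|exact: Hv].
Qed.

Lemma multiplierM u v : multiplier u -> multiplier v -> multiplier (fun x => u x * v x).
Proof.
move=> [bu Hu] [bv Hv]; split=> [|h Hh]; first exact: bmeasM.
under eq_fun do rewrite mulrA; apply: Hv; exact: Hu.
Qed.

Lemma multiplierN u : multiplier u -> multiplier (fun x => - u x).
Proof.
move=> Hu; under eq_fun do rewrite -mulN1r; apply: multiplierM Hu; exact: multiplier_cst.
Qed.

Lemma multiplierX u n : multiplier u -> multiplier (fun x => u x ^+ n).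
Proof.
move=> Hu; elim: n => [|n IH]; first exact: multiplier_cst.
by under eq_fun do rewrite exprS; exact: multiplierM.
Qed.

(** Dominated convergence with majorant [M N |h|], where [N] bounds the test function. *)
Lemma multiplier_lim (u_ : nat -> T -> R) u (M : R) : (forall n, multiplier (u_ n)) ->
  (forall n x, `|u_ n x| <= M) -> (forall x, u_ ^~ x @ \oo --> u x) -> multiplier u.
Proof.
move=> Hu uM cu.
have mu : measurable_fun setT u.
  apply: (measurable_fun_cvg (h := u_)) => [n|x _]; last exact: cu.
  by have [[]] := Hu n.
have bu : bmeas u.
  split => //; exists M => x.
  have cn : `|u_ n x| @[n --> \oo] --> `|u x| by apply: cvg_norm; exact: cu.
  by apply: (cvgr_to_le cn); near=> n; exact: uM.
split=> // h [ih Hh]; split; first exact: integrableMbmeas.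
move=> phi Hphi; have bphi := bPhi _ Hphi; have [_ [N HN]] := bphi.
have ihphi : P.-integrable setT (EFin \o (fun x => `|h x| * (M * N))).
  apply: integrableMbmeas; last exact: bmeas_cst.
  by have := integrable_norm ih.
have mh : measurable_fun setT h by exact/measurable_EFinP/(measurable_int _ ih).
have mphi : measurable_fun setT phi by case: bphi.
have Z n : (\int[P]_x (h x * u_ n x * phi x)%:E = 0)%E.
  by have [_ /(_ _ (conj ih Hh)) [_]] := Hu n; apply.
have [|||||_ _] := @dominated_convergence _ _ _ P setT measurableT
  (fun n x => (h x * u_ n x * phi x)%:E) (fun x => (h x * u x * phi x)%:E)
  (EFin \o (fun x => `|h x| * (M * N))).
- move=> n; apply/measurable_EFinP; apply: measurable_funM => //.
  by apply: measurable_funM => //; have [[]] := Hu n.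
- apply/measurable_EFinP; apply: measurable_funM => //; exact: measurable_funM.
- apply: aeW => x _; apply: cvg_EFin; first exact: nearW.
  by apply: cvgMl; apply: cvgMr; exact: cu.
- exact: ihphi.
- apply: aeW => x n _ /=; rewrite lee_fin !normrM -mulrA ler_wpM2l // ler_pM //.
- under eq_fun do rewrite Z; move=> H.
  have := @cvg_unique _ _ _ _ _ _ H (cvg_cst _); exact.
Unshelve. all: by end_near. Qed.

Lemma multiplier_ae u v : bmeas v -> {ae P, forall x, u x = v x} ->
  multiplier u -> multiplier v.
Proof.
move=> bv E [bu Hu]; split=> // h Hh; apply: annihilates_ae (Hu _ Hh).
- apply: measurable_funM; last by case: bv.
  by case: Hh => ih _; exact/measurable_EFinP/(measurable_int _ ih).
- by apply: filterS E => x ->.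
Qed.

Definition multiplier_set (A : set T) := measurable A /\ multiplier (\1_A).

Lemma multiplier_setC A : multiplier_set A -> multiplier_set (~` A).
Proof.
move=> [mA HA]; split; first exact: measurableC.
rewrite (_ : \1_(~` A) = (fun x => 1 + - \1_A x)).
  by apply: multiplierD; [exact: multiplier_cst|exact: multiplierN].
apply/funext => x; rewrite !indicE in_setC; case: (x \in A) => /=; ring.
Qed.

Lemma multiplier_setI A B : multiplier_set A -> multiplier_set B -> multiplier_set (A `&` B).
Proof.
move=> [mA HA] [mB HB]; split; first exact: measurableI.
rewrite (_ : \1_(A `&` B) = (fun x => \1_A x * \1_B x)); first exact: multiplierM.
by apply/funext => x; rewrite !indicE in_setI; case: (x \in A); case: (x \in B) => /=; ring.
Qed.

Lemma multiplier_set0 : multiplier_set set0.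
Proof.
split=> //; rewrite (_ : \1_set0 = fun=> 0); first exact: multiplier_cst.
by apply/funext => x; rewrite indicE in_set0.
Qed.

Lemma multiplier_sigma_algebra : sigma_algebra setT multiplier_set.
Proof.
split; first exact: multiplier_set0.
- by move=> A HA; rewrite setTD; exact: multiplier_setC.
move=> A HA.
(* Finite unions come from complements and intersections; at each point their indicators are
   eventually constant, equal to the indicator of the countable union. *)
have HU n : multiplier_set (\big[setU/set0]_(i < n) A i).
  elim: n => [|n IH]; first by rewrite big_ord0; exact: multiplier_set0.
  rewrite big_ord_recr /= -[X in multiplier_set X]setCK setCU.
  by apply: multiplier_setC; apply: multiplier_setI; exact: multiplier_setC.
split; first by apply: bigcupT_measurable => n; case: (HA n).
apply: (@multiplier_lim (fun n => \1_(\big[setU/set0]_(i < n) A i)) _ 1).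
- by move=> n; case: (HU n).
- by move=> n x; rewrite indicE; case: (_ \in _); rewrite ?normr1 ?normr0.
move=> x; rewrite indicE; have [/set_mem [k _ Akx]|xA] := boolP (x \in \bigcup_k A k).
  apply: cvg_near_cst; exists k.+1 => // n /= kn.
  rewrite indicE mem_set // -bigcup_mkord; exists k => //.
apply: cvg_near_cst; apply: nearW => n; rewrite indicE memNset //.
rewrite -bigcup_mkord => -[k _ Akx]; move/negP: xA; apply; apply/mem_set.
by exists k.
Qed.

Lemma multiplier_set_ae (A B : set T) : measurable B -> {ae P, forall x, A x <-> B x} ->
  multiplier_set A -> multiplier_set B.
Proof.
move=> mB E [mA HA]; split=> //; apply: multiplier_ae HA; first exact: bmeas_indic.
apply: filterS E => x E; rewrite !indicE.
have -> // : (x \in A) = (x \in B) by apply/idP/idP => /set_mem H; apply/mem_set/E.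
Qed.

(* The step polynomials of [(1 - t) / 2] converge to the indicator of [0 < t] on [-1, 1]. *)
Lemma multiplier_set_gt0 t : multiplier t -> (forall x, `|t x| <= 1) ->
  multiplier_set [set x | 0 < t x].
Proof.
move=> Ht t1; pose u x := (1 + - t x) * 2^-1.
have Hu : multiplier u.
  apply: multiplierM; last exact: multiplier_cst.
  by apply: multiplierD; [exact: multiplier_cst|exact: multiplierN].
have uI x : 0 <= u x <= 1.
  by have := t1 x; rewrite ler_norml /u => /andP[? ?]; lra.
have mA : measurable [set x | 0 < t x].
  rewrite (_ : [set _ | _] = t @^-1` [set` `]0, +oo[]).
    by rewrite -[X in measurable X]setTI; case: Ht => -[mt _] _; exact: mt.
  by apply/seteqP; split=> x /=; rewrite in_itv /= andbT.
split=> //; apply: (@multiplier_lim (fun n x => step_poly n (u x)) _ 1).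
- move=> n; apply: multiplierX; apply: multiplierD; first exact: multiplier_cst.
  by apply: multiplierN; exact: multiplierX.
- by move=> n x; have /andP[s0 s1] := step_poly_itv n _ (uI x); rewrite ger0_norm.
- move=> x; have := cvg_step_poly _ (uI x).
  rewrite indicE (_ : (x \in _) = (u x < 2^-1)) //.
  apply/idP/idP => [/set_mem /= H|H]; last apply/mem_set => /=; move: H; rewrite /u; lra.
Qed.

(** Multiplying [h] by an indicator and testing against 1 shows that [h] has integral 0 over every
    measurable set. *)
Lemma annihilates_eq0 h : (forall A, measurable A -> multiplier_set A) ->
  Phi (fun=> 1) -> annihilates h -> {ae P, forall x, h x = 0}.
Proof.
move=> HA H1 [ih Hh].
have E : ae_eq P setT (EFin \o h) (cst 0%E).
  apply: integral_ae_eq => // E _ mE.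
  rewrite integral0 integral_mkcond; have [_ [_ /(_ _ (conj ih Hh)) [_ /(_ _ H1) <-]]] := HA _ mE.
  apply: eq_integral => x _; rewrite patchE indicE mulr1.
  by case: ifP => _ /=; rewrite ?mulr1 ?mulr0.
by apply: filterS E => x /(_ I) [].
Qed.

End TestFunctions.

(** * Means of cosines and sines over a period *)

Section UniformMoments.
Context {R : realType}.
Local Notation mu := (@lebesgue_measure R).
Local Notation U := (uniform_prob (two_pi_gt0 R)).

Lemma uniform_itv : U [set` `]0, (2 * pi)[] = 1%E.
Proof.
have E := integral_uniform (two_pi_gt0 R) (f := fun x => (\1_([set` `]0, (2 * pi)[]) x)%:E).
have {E} := E.
rewrite integral_indic ?setIT //= => ->.
- rewrite integral_indic //= setIidl; last by apply: subset_itvW.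
  rewrite lebesgue_measure_itv /= lte_fin two_pi_gt0 -EFinB -EFinM subr0 mulVf //.
  by rewrite gt_eqF // two_pi_gt0.
- by apply/measurable_EFinP; exact: measurable_indic.
- by move=> x; rewrite lee_fin.
Qed.

(** The density formula [integral_uniform] is for nonnegative integrands, so it is applied to
    [1 + g], with primitive [x + G x]; the constant is subtracted afterwards. *)
Lemma uniform_moment (g G : R -> R) : (forall x, `|g x| <= 1) -> continuous g ->
  (forall x : R, is_derive x 1 G (g x)) -> G (2 * pi) = G 0 ->
  (\int[U]_x (g x)%:E = 0)%E.
Proof.
move=> g1 cg dG GG.
have mg : measurable_fun (setT : set (mR R)) g by exact: continuous_measurable_fun.
have tp := two_pi_gt0 R.
have ig : U.-integrable setT (EFin \o g).
  by apply: bmeas_integrable; split=> //; exists 1.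
have H : (\int[U]_x (1 + g x)%:E = 1)%E.
  rewrite integral_uniform //; last 2 first.
  - by apply/measurable_EFinP; exact: measurable_funD.
  - by move=> x; rewrite lee_fin; have := g1 x; rewrite ler_norml => /andP[]; lra.
  have dF (x : R) : is_derive x 1 (fun x => x + G x) (1 + g x).
    by apply: is_deriveD.
  rewrite (@continuous_FTC2 _ (fun x => 1 + g x) (fun x => x + G x)) //.
  - rewrite GG -EFinB -EFinM subr0 add0r; congr EFin.
    by rewrite addrK mulVf // gt_eqF.
  - by apply: continuous_subspaceT => x; apply: cvgD; [exact: cvg_cst|exact: cg].
  - have cF (x : R) : {for x, continuous (fun x => x + G x)}.
      by apply/differentiable_continuous/derivable1_diffP; case: (dF x).
    split.
    + by move=> x _; case: (dF x).
    + by apply: cvg_at_right_filter; exact: cF.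
    + by apply: cvg_at_left_filter; exact: cF.
  - by move=> x _; rewrite derive1E; case: (dF x).
have fin : (\int[U]_x (g x)%:E)%E \is a fin_num by exact: integrable_fin_num.
move: H; under eq_integral do rewrite EFinD.
rewrite integralD //; last by apply: bmeas_integrable; exact: bmeas_cst.
rewrite integral_cst //= mul1e (_ : U setT = 1%E); last exact: probability_setT.
rewrite -(fineK fin) -EFinD => -[] H; congr EFin; lra.
Qed.

Lemma cos_sin_int2pi (k : int) :
  cos (k%:~R * (2 * pi)) = 1 :> R /\ sin (k%:~R * (2 * pi)) = 0 :> R.
Proof.
have [c1 s1] : cos (2 * pi) = 1 :> R /\ sin (2 * pi) = 0 :> R.
  by rewrite mulr_natl cos2pi sin2pi.
have N (m : nat) : cos (m%:R * (2 * pi)) = 1 :> R /\ sin (m%:R * (2 * pi)) = 0 :> R.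
  elim: m => [|m [IHc IHs]]; first by rewrite mul0r cos0 sin0.
  by rewrite -natr1 mulrDl mul1r cosD sinD IHc IHs c1 s1; split; ring.
case: k => m; first exact: N.
have [Hc Hs] := N m.+1.
by rewrite NegzE mulrNz mulNr cosN sinN Hc Hs oppr0.
Qed.

Lemma is_derive_scale (f : R -> R) (f' c x : R) : is_derive (c * x) 1 f f' ->
  is_derive x 1 (fun y => f (c * y)) (c * f').
Proof.
move=> df.
have dc : is_derive x 1 (fun y : R => c * y) c.
  have := is_deriveZ c (is_derive_id x (1 : R)); rewrite [c *: 1]mulr1; exact.
have := @is_derive1_comp _ f (fun y : R => c * y) x f' c df dc; by rewrite mulrC.
Qed.

Lemma uniform_cos (k : int) : (\int[U]_x (cos (k%:~R * x))%:E = (k == 0)%:R%:E)%E.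
Proof.
have [->|k0] := eqVneq k 0.
  under eq_integral do rewrite mul0r cos0.
  by rewrite integral_cst //= mul1e; exact: probability_setT.
have k0' : k%:~R != 0 :> R by rewrite intr_eq0.
have cg : continuous (fun x : R => cos (k%:~R * x)).
  by move=> x; apply: continuous_comp; [exact: mulrl_continuous|exact: continuous_cos].
apply: (@uniform_moment (fun x : R => cos (k%:~R * x)) (fun x : R => (k%:~R)^-1 * sin (k%:~R * x))).
- by move=> x; exact: cos_max.
- exact: cg.
- move=> x; have := is_derive_scale _ _ _ _ (is_derive_sin (k%:~R * x)) => D.
  have := is_deriveZ (k%:~R^-1 : R) D.
  by rewrite /= [_ *: _]mulrA mulVf // mul1r.
- by have [_ ->] := cos_sin_int2pi k; rewrite !mulr0 sin0 mulr0.
Qed.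

Lemma uniform_sin (k : int) : (\int[U]_x (sin (k%:~R * x))%:E = 0)%E.
Proof.
have [->|k0] := eqVneq k 0.
  under eq_integral do rewrite mul0r sin0.
  by rewrite integral0.
have k0' : k%:~R != 0 :> R by rewrite intr_eq0.
have cg : continuous (fun x : R => sin (k%:~R * x)).
  by move=> x; apply: continuous_comp; [exact: mulrl_continuous|exact: continuous_sin].
apply: (@uniform_moment (fun x : R => sin (k%:~R * x)) (fun x : R => - (k%:~R)^-1 * cos (k%:~R * x))).
- by move=> x; exact: sin_max.
- exact: cg.
- move=> x; have := is_derive_scale _ _ _ _ (is_derive_cos (k%:~R * x)) => D.
  have := is_deriveZ (- k%:~R^-1 : R) D.
  by rewrite /= [_ *: _]mulrA mulrN mulNr mulVf // mulN1r opprK.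
- by have [-> _] := cos_sin_int2pi k; rewrite mulr0 cos0.
Qed.

End UniformMoments.

Section ProductIntegral.
Context {R : realType} {d1 d2 : measure_display}.
Context {T1 : measurableType d1} {T2 : measurableType d2}.
Variables (P1 : probability T1 R) (P2 : probability T2 R).

Lemma integral_separated (f : T1 -> R) (g : T2 -> R) : bmeas f -> bmeas g ->
  (\int[(P1 \x P2)%E]_z (f z.1 * g z.2)%:E =
   (\int[P1]_x (f x)%:E) * (\int[P2]_y (g y)%:E))%E.
Proof.
move=> bf bg.
have bfg : @bmeas R _ (T1 * T2)%type (fun z => f z.1 * g z.2).
  apply: bmeasM.
  - by apply: (@bmeas_comp _ _ (T1 * T2)%type _ _ f fst) => //; case: bf.
  - by apply: (@bmeas_comp _ _ (T1 * T2)%type _ _ g snd) => //; case: bg.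
have ifg := bmeas_integrable (P1 \x P2)%E _ bfg.
rewrite -(integral12_prod_meas1 ifg) /fubini_F /=.
have ig := bmeas_integrable P2 _ bg.
have gfin : (\int[P2]_y (g y)%:E)%E \is a fin_num by exact: integrable_fin_num.
under eq_integral => x _.
  under eq_integral do rewrite EFinM.
  rewrite integralZl // -(fineK gfin) muleC.
  over.
rewrite integralZl //; last exact: bmeas_integrable.
by rewrite fineK // muleC.
Qed.

End ProductIntegral.

Section TorusMoments.
Context {R : realType}.

Definition dotn n (k : nat -> int) (x : projT2 (Rsp R n)) : R :=
  \sum_(j < n.+1) (k j)%:~R * coordn x j.

Lemma measurable_dotn n k : measurable_fun setT (dotn n k).
Proof.
apply: measurable_sum => j; apply: (measurableT_comp (mulrl_measurable _)).
exact: measurable_coordn.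
Qed.

Lemma dotnS n k (x : projT2 (Rsp R n.+1)) :
  dotn n.+1 k x = (k 0%N)%:~R * x.1 + dotn n (k \o S) x.2.
Proof. by rewrite /dotn big_ord_recl. Qed.

Lemma dotn0 k (x : projT2 (Rsp R 0)) : dotn 0 k x = (k 0%N)%:~R * (x : R).
Proof. by rewrite /dotn big_ord1. Qed.

(** The addition formulas split off the first coordinate and mix cosines with sines, so the
    induction carries both moments. *)
Lemma torn_cos_sin n (k : nat -> int) :
  (\int[torn R n]_x (cos (dotn n k x))%:E = [forall j : 'I_n.+1, k j == 0]%:R%:E)%E /\
  (\int[torn R n]_x (sin (dotn n k x))%:E = 0)%E.
Proof.
elim: n k => [|n IH] k.
  have -> : [forall j : 'I_1, k j == 0] = (k 0%N == 0).
    by apply/forallP/idP => [/(_ ord0)//|? j]; rewrite ord1.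
  split.
  - by under eq_integral do rewrite dotn0; exact: uniform_cos.
  - by under eq_integral do rewrite dotn0; exact: uniform_sin.
have [IHc IHs] := IH (k \o S).
have bc1 : bmeas (fun x : mR R => cos ((k 0%N)%:~R * x)).
  by apply: bmeas_cos; exact: mulrl_measurable.
have bs1 : bmeas (fun x : mR R => sin ((k 0%N)%:~R * x)).
  by apply: bmeas_sin; exact: mulrl_measurable.
have bc2 : bmeas (fun x => cos (dotn n (k \o S) x)).
  by apply: bmeas_cos; exact: measurable_dotn.
have bs2 : bmeas (fun x => sin (dotn n (k \o S) x)).
  by apply: bmeas_sin; exact: measurable_dotn.
have sep (f : mR R -> R) (g : projT2 (Rsp R n) -> R) : bmeas f -> bmeas g ->
  ((torn R n.+1).-integrable setT (fun z => (f z.1 * g z.2)%:E) *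
   (\int[torn R n.+1]_z (f z.1 * g z.2)%:E =
   (\int[uniform_prob (two_pi_gt0 R)]_x (f x)%:E) * (\int[torn R n]_y (g y)%:E))%E)%type.
  move=> bf bg; split; last exact: integral_separated.
  apply: bmeas_integrable; apply: bmeasM.
  - by apply: (@bmeas_comp _ _ (mR R * projT2 (Rsp R n))%type _ _ f fst) => //; case: bf.
  - by apply: (@bmeas_comp _ _ (mR R * projT2 (Rsp R n))%type _ _ g snd) => //; case: bg.
split.
- under eq_integral do rewrite dotnS cosD EFinB.
  rewrite integralB //; [|exact: (sep _ _ bc1 bc2).1|exact: (sep _ _ bs1 bs2).1].
  rewrite (sep _ _ bc1 bc2).2 (sep _ _ bs1 bs2).2 IHc IHs mule0 sube0 uniform_cos.
  rewrite -EFinM -natrM mulnb; congr (_%:R%:E); congr nat_of_bool.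
  apply/andP/forallP => [[k0 /forallP H] j|H]; last first.
    by split; [exact: (H ord0)|apply/forallP => j; exact: (H (lift ord0 j))].
  by have [j' ->|->] := unliftP ord0 j; [exact: H|].
- under eq_integral do rewrite dotnS sinD EFinD.
  rewrite integralD //; [|exact: (sep _ _ bs1 bc2).1|exact: (sep _ _ bc1 bs2).1].
  by rewrite (sep _ _ bs1 bc2).2 (sep _ _ bc1 bs2).2 IHs mule0 uniform_sin mul0e adde0.
Qed.

Lemma torn_coord n j (B : set (mR R)) : (j <= n)%N -> measurable B ->
  torn R n ((fun x => coordn x j) @^-1` B) = uniform_prob (two_pi_gt0 R) B.
Proof.
move=> jn mB; elim: n j jn => [|n IH] [|j] jn //.
- have -> : (fun x : projT2 (Rsp R n.+1) => coordn x 0) @^-1` B = B `*` setT.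
    by apply/seteqP; split=> x //= -[].
  rewrite [LHS]product_measure1E // [X in (_ * X)%E]probability_setT mule1 //.
- have mc : measurable ((fun x : projT2 (Rsp R n) => coordn x j) @^-1` B).
    by rewrite -[X in measurable X]setTI; exact: measurable_coordn.
  have -> : (fun x : projT2 (Rsp R n.+1) => coordn x j.+1) @^-1` B =
     setT `*` ((fun x : projT2 (Rsp R n) => coordn x j) @^-1` B).
    by apply/seteqP; split=> x //= -[].
  transitivity (torn R n ((fun x => coordn x j) @^-1` B)); last exact: IH.
  by rewrite [LHS]product_measure1E // [X in (X * _)%E]probability_setT mul1e.
Qed.

(** The underlying space is all of [R^(n+1)]; only the measure knows about the cube. The open cube
    is what gives [sin (x_j / 2) > 0] later. *)
Lemma torn_coord_itv n j : (j <= n)%N ->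
  {ae torn R n, forall x, 0 < coordn x j < 2 * pi}.
Proof.
move=> jn; pose D : set (mR R) := [set` `]0, (2 * pi)[].
have mD : measurable D by exact: measurable_itv.
exists ((fun x => coordn x j) @^-1` (~` D)); split.
- by rewrite -[X in measurable X]setTI; apply: measurable_coordn => //; exact: measurableC.
- rewrite torn_coord //; last exact: measurableC.
  have UD : uniform_prob (two_pi_gt0 R) D = 1%E by exact: uniform_itv.
  by rewrite [LHS]probability_setC // [X in (1 - X)%E]UD subee.
- by move=> x /= H; rewrite /D /= in_itv.
Qed.

End TorusMoments.

(** * Trigonometric functions as test family on the torus *)

Section TorusUniqueness.
Context {R : realType} (n : nat).
Local Notation X := (Td R n.+1).
Local Notation P := (Pd R n.+1).
Local Notation coord := (@Defs.coord R n.+1).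
Local Notation lattice := {ffun 'I_n.+1 -> int}.

Lemma measurable_coord (j : 'I_n.+1) : measurable_fun setT (fun x : X => coord x j).
Proof. exact: measurable_coordn. Qed.

Lemma dotkE (k : lattice) (x : X) : dotk k x = dotn n (fun j => k (inord j)) x.
Proof. by apply: eq_bigr => j _; rewrite inord_val. Qed.

Lemma measurable_dotk (k : lattice) : measurable_fun setT (fun x : X => dotk k x).
Proof.
rewrite (_ : (fun x : X => _) = dotn n (fun j => k (inord j))).
  exact: measurable_dotn.
by apply/funext => x; exact: dotkE.
Qed.

Lemma dotkD (k l : lattice) (x : X) : dotk (k + l) x = dotk k x + dotk l x.
Proof.
by rewrite /dotk -big_split /=; apply: eq_bigr => j _; rewrite ffunE intrD mulrDl.
Qed.

Lemma dotkN (k : lattice) (x : X) : dotk (- k) x = - dotk k x.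
Proof.
by rewrite /dotk -sumrN; apply: eq_bigr => j _; rewrite ffunE mulrNz mulNr.
Qed.

Lemma dotk0 (x : X) : dotk (0 : lattice) x = 0.
Proof. by rewrite /dotk big1 // => j _; rewrite ffunE mul0r. Qed.

Lemma dotk_delta (j : 'I_n.+1) (x : X) :
  dotk [ffun i => (i == j)%:Z] x = coord x j.
Proof.
rewrite /dotk (bigD1 j) //= ffunE eqxx mul1r big1 ?addr0 // => i ij.
by rewrite ffunE (negbTE ij) mul0r.
Qed.

Lemma torus_cos_sin (k : lattice) :
  (\int[P]_x (cos (dotk k x))%:E = (k == 0)%:R%:E)%E /\
  (\int[P]_x (sin (dotk k x))%:E = 0)%E.
Proof.
have [Hc Hs] := @torn_cos_sin R n (fun j => k (inord j)).
rewrite (_ : @dotk R n.+1 k = dotn n (fun j => k (inord j))); last first.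
  by apply/funext => x; exact: dotkE.
split; last exact: Hs.
rewrite Hc; congr (_%:R%:E); congr nat_of_bool.
apply/forallP/eqP => [H|-> j]; last by rewrite ffunE.
by apply/ffunP => j; rewrite ffunE; have := H j; rewrite inord_val => /eqP.
Qed.

Definition trig_functions : set (X -> R) :=
  [set phi | exists k : lattice, phi = (fun x => cos (dotk k x)) \/
                                 phi = (fun x => sin (dotk k x))].

Lemma bmeas_trig phi : trig_functions phi -> bmeas phi.
Proof.
by move=> [k [->|->]]; [apply: bmeas_cos|apply: bmeas_sin]; exact: measurable_dotk.
Qed.

Local Notation MS := (multiplier_set P trig_functions).
Local Notation mult := (multiplier P trig_functions).

(** Common form of the product-to-sum formulas: multiplying a test function by [cos x_j] or
    [sin x_j] gives a combination of two test functions with frequencies shifted by a unit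
    vector. *)
Lemma annihilates_half h (f g u : X -> R) : P.-integrable setT (EFin \o h) ->
  trig_functions f -> trig_functions g ->
  (forall phi, trig_functions phi -> (\int[P]_x (h x * phi x)%:E = 0)%E) ->
  forall (a b : R), (forall x, u x = a * f x + b * g x) ->
  (\int[P]_x (h x * u x)%:E = 0)%E.
Proof.
move=> ih Tf Tg H a b uE.
have i1 := integrableMbmeas P _ _ ih (bmeas_trig _ Tf).
have i2 := integrableMbmeas P _ _ ih (bmeas_trig _ Tg).
rewrite (eq_integral (fun x => a%:E * (h x * f x)%:E + b%:E * (h x * g x)%:E)%E); last first.
  by move=> x _; rewrite uE -!EFinM -EFinD; congr EFin; ring.
have j1 := integrableZl measurableT a i1; have j2 := integrableZl measurableT b i2.
rewrite integralD //.
by rewrite !integralZl // !H // !mule0 adde0.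
Qed.

Lemma multiplier_cos_coord j : mult (fun x => cos (coord x j)).
Proof.
have bc : bmeas (fun x : X => cos (coord x j)) by apply: bmeas_cos; exact: measurable_coord.
split=> // h [ih H]; split; first exact: integrableMbmeas.
pose e : lattice := [ffun i => (i == j)%:Z].
move=> phi [k [->|->]].
- under eq_integral do rewrite -mulrA.
  apply: (annihilates_half h (fun x => cos (dotk (k + e) x)) (fun x => cos (dotk (k - e) x)) _ ih _ _ H 2^-1 2^-1).
  + by exists (k + e); left.
  + by exists (k - e); left.
  + by move=> x; rewrite !dotkD dotkN dotk_delta cosD cosB; field.
- under eq_integral do rewrite -mulrA.
  apply: (annihilates_half h (fun x => sin (dotk (k + e) x)) (fun x => sin (dotk (k - e) x)) _ ih _ _ H 2^-1 2^-1).
  + by exists (k + e); right.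
  + by exists (k - e); right.
  + by move=> x; rewrite !dotkD dotkN dotk_delta sinD sinB; field.
Qed.

Lemma multiplier_sin_coord j : mult (fun x => sin (coord x j)).
Proof.
have bs : bmeas (fun x : X => sin (coord x j)) by apply: bmeas_sin; exact: measurable_coord.
split=> // h [ih H]; split; first exact: integrableMbmeas.
pose e : lattice := [ffun i => (i == j)%:Z].
move=> phi [k [->|->]].
- under eq_integral do rewrite -mulrA.
  apply: (annihilates_half h (fun x => sin (dotk (k + e) x)) (fun x => sin (dotk (k - e) x)) _ ih _ _ H 2^-1 (- 2^-1)).
  + by exists (k + e); right.
  + by exists (k - e); right.
  + by move=> x; rewrite !dotkD dotkN dotk_delta sinD sinB; field.
- under eq_integral do rewrite -mulrA.
  apply: (annihilates_half h (fun x => cos (dotk (k + e) x)) (fun x => cos (dotk (k - e) x)) _ ih _ _ H (- 2^-1) 2^-1).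
  + by exists (k + e); left.
  + by exists (k - e); left.
  + by move=> x; rewrite !dotkD dotkN dotk_delta cosD cosB; field.
Qed.

Lemma torus_coord_itv (j : 'I_n.+1) : {ae P, forall x, 0 < coord x j < 2 * pi}.
Proof. by apply: torn_coord_itv; rewrite -ltnS. Qed.

Lemma measurable_ray (b : R) j : measurable [set x : X | b < coord x j].
Proof.
rewrite (_ : [set _ | _] = (fun x : X => coord x j) @^-1` [set` `]b, +oo[]).
  by rewrite -[X in measurable X]setTI; exact: measurable_coord.
by apply/seteqP; split=> x /=; rewrite in_itv /= andbT.
Qed.

(** For [b] outside the period the ray has measure 0 or 1. Otherwise it agrees almost everywhere
    with the positivity set of a trigonometric polynomial in [x_j]. *)
Lemma multiplier_ray (b : R) j : MS [set x | b < coord x j].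
Proof.
have mb := measurable_ray b j.
have [b0|b0] := leP b 0.
  apply: (multiplier_set_ae P trig_functions bmeas_trig setT) => //.
    by apply: filterS (torus_coord_itv j) => x /andP[H _]; split=> // _; exact: le_lt_trans H.
  rewrite -setC0; apply: multiplier_setC; first exact: bmeas_trig.
  by apply: multiplier_set0; exact: bmeas_trig.
have [b1|b1] := leP (2 * pi) b.
  apply: (multiplier_set_ae P trig_functions bmeas_trig set0) => //.
    apply: filterS (torus_coord_itv j) => x /andP[_ H]; split=> //= H2.
    by have := lt_trans H2 H; rewrite ltNge b1.
  by apply: multiplier_set0; exact: bmeas_trig.
(* This is [(cos (b / 2) - cos (x_j - b / 2)) / 2], that is [sin (x_j / 2) * sin ((x_j - b) / 2)].
   The half-angle sines are not test functions, but their product is a combination of them and has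
   the sign of [x_j - b] on the open period. *)
pose t (x : X) := 2^-1 * (cos (b / 2) + - (cos (coord x j) * cos (b / 2) + sin (coord x j) * sin (b / 2))).
have tE x : t x = sin (coord x j / 2) * sin ((coord x j - b) / 2).
  rewrite /t -cosB.
  have -> : b / 2 = coord x j / 2 - (coord x j - b) / 2 by field.
  have -> : coord x j - (coord x j / 2 - (coord x j - b) / 2) = coord x j / 2 + (coord x j - b) / 2.
    by field.
  by rewrite cosB cosD; field.
apply: (multiplier_set_ae P trig_functions bmeas_trig [set x | 0 < t x]) => //.
  apply: filterS (torus_coord_itv j) => x /andP[x0 x1] /=; rewrite tE.
  have s0 : 0 < sin (coord x j / 2) by apply: sin_gt0_pi; apply/andP; split; lra.
  rewrite pmulr_rgt0 //; split=> [H|bx].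
    rewrite ltNge; apply/negP => xb; move: H.
    have -> : (coord x j - b) / 2 = - ((b - coord x j) / 2) by field.
    rewrite sinN oppr_gt0 ltNge; move/negP; apply; apply: sin_ge0_pi.
    by apply/andP; split; lra.
  by apply: sin_gt0_pi; apply/andP; split; lra.
apply: multiplier_set_gt0; first exact: bmeas_trig.
- have mc c : mult (fun=> c) by apply: multiplier_cst; exact: bmeas_trig.
  have mM u v := multiplierM P trig_functions u v.
  have mD u v := multiplierD P trig_functions bmeas_trig u v.
  apply: (mM) => //; apply: (mD) => //; apply: multiplierN => //; first exact: bmeas_trig.
  apply: (mD); apply: (mM) => //; [exact: multiplier_cos_coord|exact: multiplier_sin_coord].
- by move=> x; rewrite tE normrM -[leRHS]mulr1 ler_pM // sin_max.
Qed.

Lemma multiplier_preimage (p : X -> R) : (forall b, MS [set x | b < p x]) ->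
  forall B : set (mR R), measurable B -> MS (p @^-1` B).
Proof.
move=> Hp B mB.
have S := multiplier_sigma_algebra P trig_functions bmeas_trig.
suff : (measurable : set (set (mR R))) `<=` [set B | MS (p @^-1` B)] by exact.
apply: smallest_sub.
- case: S => S0 SC SU; split=> [|A HA|A HA] /=.
  + by rewrite preimage_set0.
  + by rewrite setTD preimage_setC -setTD; exact: SC.
  + by rewrite preimage_bigcup; exact: SU.
- move=> _ [[a b] _ <-] /=.
  have -> : p @^-1` `]a, b] = [set x | a < p x] `&` ~` [set x | b < p x].
    apply/seteqP; split=> x /=; rewrite in_itv /= leNgt.
      by move=> /andP[-> /negP].
    by move=> [-> /negP ->].
  apply: multiplier_setI => //; apply: multiplier_setC => //; exact: bmeas_trig.
Qed.

Lemma multiplier_all (A : set X) : measurable A -> MS A.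
Proof.
have S := multiplier_sigma_algebra P trig_functions bmeas_trig.
(* The source stays fixed while the dimension [m] of the target decreases, so that [p] can run
   through the projections onto the last coordinates. *)
suff H m (p : X -> projT2 (Rsp R m)) :
    (forall j, (j <= m)%N -> forall b, MS [set x | b < coordn (p x) j]) ->
    forall B, measurable B -> MS (p @^-1` B).
  move=> mA; apply: (H n id) => // j jn b.
  by have := multiplier_ray b (Ordinal (jn : (j < n.+1)%N)).
elim: m p => [|m IH] p Hp B mB.
  by apply: (multiplier_preimage p) => // b; exact: (Hp 0%N).
have H1 : forall B : set (mR R), measurable B -> MS ((fst \o p) @^-1` B).
  by apply: multiplier_preimage => b; exact: (Hp 0%N).
have H2 : forall B, measurable B -> MS ((snd \o p) @^-1` B).
  by apply: IH => j jm b; exact: (Hp j.+1).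
suff : (measurable : set (set (mR R * projT2 (Rsp R m)))) `<=` [set B | MS (p @^-1` B)] by apply.
rewrite measurable_prod_measurableType; apply: smallest_sub.
- case: S => S0 SC SU; split=> [|A' HA|A' HA] /=.
  + by rewrite preimage_set0.
  + by rewrite setTD preimage_setC -setTD; exact: SC.
  + by rewrite preimage_bigcup; exact: SU.
- move=> _ [A1 mA1 [A2 mA2 <-]] /=.
  have -> : p @^-1` (A1 `*` A2) = ((fst \o p) @^-1` A1) `&` ((snd \o p) @^-1` A2) by [].
  by apply: multiplier_setI; [exact: H1|exact: H2].
Qed.

Lemma torus_uniqueness (h : X -> R) : P.-integrable setT (EFin \o h) ->
  (forall k : lattice, (\int[P]_x (h x * cos (dotk k x))%:E = 0)%E /\
                       (\int[P]_x (h x * sin (dotk k x))%:E = 0)%E) ->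
  {ae P, forall x, h x = 0}.
Proof.
move=> ih H; apply: (annihilates_eq0 P trig_functions).
- exact: multiplier_all.
- exists 0; left; apply/funext => x; by rewrite dotk0 cos0.
- split=> // phi [k [->|->]]; by case: (H k).
Qed.

End TorusUniqueness.

(** * Upper bound *)

Section ComplexNorm.
Context {R : realType}.
Local Notation C := (R[i]).
Implicit Types z w : C.

Lemma RezD z w : complex.Re (z + w) = complex.Re z + complex.Re w.
Proof. by case: z; case: w. Qed.
Lemma ImzD z w : complex.Im (z + w) = complex.Im z + complex.Im w.
Proof. by case: z; case: w. Qed.
Lemma RezN z : complex.Re (- z) = - complex.Re z.
Proof. by case: z. Qed.
Lemma ImzN z : complex.Im (- z) = - complex.Im z.
Proof. by case: z. Qed.
Lemma RezM z w : complex.Re (z * w) =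
  complex.Re z * complex.Re w - complex.Im z * complex.Im w.
Proof. by case: z; case: w. Qed.
Lemma ImzM z w : complex.Im (z * w) =
  complex.Re z * complex.Im w + complex.Im z * complex.Re w.
Proof. by case: z; case: w. Qed.

Lemma complex_eq z w : complex.Re z = complex.Re w -> complex.Im z = complex.Im w -> z = w.
Proof. by case: z => a b; case: w => c d /= -> ->. Qed.

Lemma Rez_sum (I : Type) (s : seq I) (F : I -> C) :
  complex.Re (\sum_(i <- s) F i) = \sum_(i <- s) complex.Re (F i).
Proof.
elim: s => [|i s IH]; first by rewrite !big_nil.
by rewrite !big_cons RezD IH.
Qed.

Lemma normcE_cnorm z : `|z| = ((cnorm z)%:C)%C.
Proof. by rewrite normc_def. Qed.

Lemma cnorm_ge0 z : 0 <= cnorm z.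
Proof. exact: sqrtr_ge0. Qed.

Lemma cnorm_sqr z : cnorm z ^+ 2 = complex.Re z ^+ 2 + complex.Im z ^+ 2.
Proof. by rewrite sqr_sqrtr // addr_ge0 // sqr_ge0. Qed.

Lemma cnormD z w : cnorm (z + w) <= cnorm z + cnorm w.
Proof. by rewrite -lecR rmorphD /= -!normcE_cnorm ler_normD. Qed.

Lemma cnormM z w : cnorm (z * w) = cnorm z * cnorm w.
Proof.
have : ((cnorm (z * w))%:C = (cnorm z * cnorm w)%:C)%C.
  by rewrite rmorphM /= -!normcE_cnorm normrM.
by case.
Qed.

Lemma cnorm0 : cnorm (0 : C) = 0.
Proof. by rewrite /cnorm /= !expr0n /= addr0 sqrtr0. Qed.

Lemma cnorm_sum (I : Type) (s : seq I) (F : I -> C) :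
  cnorm (\sum_(i <- s) F i) <= \sum_(i <- s) cnorm (F i).
Proof.
elim: s => [|i s IH]; first by rewrite !big_nil cnorm0.
by rewrite !big_cons (le_trans (cnormD _ _)) // lerD2l.
Qed.

Lemma cnorm_cexpi (t : R) : cnorm (cexpi t) = 1.
Proof. by rewrite /cnorm /= cos2Dsin2 sqrtr1. Qed.

Lemma cexpiD (s t : R) : cexpi (s + t) = cexpi s * cexpi t.
Proof.
apply: complex_eq; rewrite ?RezM ?ImzM /=; first exact: cosD.
by rewrite sinD; ring.
Qed.

Lemma abs_Re_le z : `|complex.Re z| <= cnorm z.
Proof.
rewrite -[leLHS]sqrtr_sqr ler_wsqrtr // lerDl sqr_ge0 //.
Qed.

Lemma abs_Im_le z : `|complex.Im z| <= cnorm z.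
Proof.
rewrite -[leLHS]sqrtr_sqr ler_wsqrtr // lerDr sqr_ge0 //.
Qed.

Lemma cauchy_schwarz (I : Type) (s : seq I) (a b : I -> R) :
  (\sum_(i <- s) a i * b i) ^+ 2 <=
  (\sum_(i <- s) a i ^+ 2) * (\sum_(i <- s) b i ^+ 2).
Proof.
set A := \sum_(i <- s) a i ^+ 2; set B := \sum_(i <- s) b i ^+ 2.
set S := \sum_(i <- s) a i * b i.
have A0 : 0 <= A by apply: sumr_ge0 => i _; exact: sqr_ge0.
have H (x y : R) : 0 <= x ^+ 2 * B - 2 * x * y * S + y ^+ 2 * A.
  rewrite /A /B /S !mulr_sumr -sumrB -big_split /=; apply: sumr_ge0 => i _.
  have -> : x ^+ 2 * b i ^+ 2 - 2 * x * y * (a i * b i) + y ^+ 2 * a i ^+ 2 =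
    (x * b i - y * a i) ^+ 2 by ring.
  exact: sqr_ge0.
have := H A S; have -> : A ^+ 2 * B - 2 * A * S * S + S ^+ 2 * A = A * (A * B - S ^+ 2) by ring.
case: (ltgtP 0 A) A0 => // [A0 _|A0 _ _]; first by rewrite pmulr_rge0 // subr_ge0.
rewrite -A0 mul0r; have [->|S0] := eqVneq S 0; first by rewrite expr0n.
(* For [A = 0] the form is affine in its second argument; this value makes it equal to -1. *)
have := H 1 ((B + 1) / (2 * S)); rewrite -A0 mulr0 addr0 expr1n mul1r mulr1.
have -> : 2 * ((B + 1) / (2 * S)) * S = B + 1 by field.
lra.
Qed.

End ComplexNorm.

Section ComplexIntegral.
Context {R : realType} {d : measure_display} {T : measurableType d}.
Variable P : probability T R.
Local Notation C := (R[i]).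
Implicit Types f g : T -> C.

Definition cintegrable f := P.-integrable setT (EFin \o (fun x => complex.Re (f x))) /\
  P.-integrable setT (EFin \o (fun x => complex.Im (f x))).

Definition cbmeas f := bmeas (fun x => complex.Re (f x)) /\ bmeas (fun x => complex.Im (f x)).

Definition cint f : C := Complex (Rintegral P setT (fun x => complex.Re (f x)))
  (Rintegral P setT (fun x => complex.Im (f x))).

Lemma integrable_add (a b : T -> R) : P.-integrable setT (EFin \o a) ->
  P.-integrable setT (EFin \o b) -> P.-integrable setT (EFin \o (fun x => a x + b x)).
Proof. by move=> ia ib; have := integrableD measurableT ia ib. Qed.

Lemma integrable_scale (c : R) (a : T -> R) : P.-integrable setT (EFin \o a) ->
  P.-integrable setT (EFin \o (fun x => c * a x)).
Proof. by move=> ia; have := integrableZl measurableT c ia. Qed.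

Lemma integrable_sub (a b : T -> R) : P.-integrable setT (EFin \o a) ->
  P.-integrable setT (EFin \o b) -> P.-integrable setT (EFin \o (fun x => a x - b x)).
Proof. by move=> ia ib; have := integrableB measurableT ia ib. Qed.

Lemma cintegrableD f g : cintegrable f -> cintegrable g -> cintegrable (fun x => f x + g x).
Proof.
move=> [f1 f2] [g1 g2]; split.
- by under eq_fun do rewrite RezD; exact: integrable_add.
- by under eq_fun do rewrite ImzD; exact: integrable_add.
Qed.

Lemma cintegrableM f g : cintegrable f -> cbmeas g -> cintegrable (fun x => f x * g x).
Proof.
move=> [f1 f2] [g1 g2]; split.
- by under eq_fun do rewrite RezM; apply: integrable_sub; exact: integrableMbmeas.
- by under eq_fun do rewrite ImzM; apply: integrable_add; exact: integrableMbmeas.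
Qed.

Lemma cbmeas_cintegrable f : cbmeas f -> cintegrable f.
Proof. by move=> [f1 f2]; split; exact: bmeas_integrable. Qed.

Lemma cbmeas_cst (c : C) : cbmeas (fun=> c).
Proof. by split; exact: bmeas_cst. Qed.

Lemma cbmeasD f g : cbmeas f -> cbmeas g -> cbmeas (fun x => f x + g x).
Proof.
move=> [f1 f2] [g1 g2]; split.
- by under eq_fun do rewrite RezD; exact: bmeasD.
- by under eq_fun do rewrite ImzD; exact: bmeasD.
Qed.

Lemma bmeasN (a : T -> R) : bmeas a -> bmeas (fun x => - a x).
Proof.
by move=> ba; under eq_fun do rewrite -mulN1r; apply: bmeasM => //; exact: bmeas_cst.
Qed.

Lemma cbmeasM f g : cbmeas f -> cbmeas g -> cbmeas (fun x => f x * g x).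
Proof.
move=> [f1 f2] [g1 g2]; split.
- under eq_fun do rewrite RezM; apply: bmeasD; first exact: bmeasM.
  by apply: bmeasN; exact: bmeasM.
- by under eq_fun do rewrite ImzM; apply: bmeasD; exact: bmeasM.
Qed.

Lemma cbmeas_sum (I : Type) (s : seq I) (F : I -> T -> C) :
  (forall i, cbmeas (F i)) -> cbmeas (fun x => \sum_(i <- s) F i x).
Proof.
move=> HF; elim: s => [|i s IH].
  by under eq_fun do rewrite big_nil; exact: cbmeas_cst.
by under eq_fun do rewrite big_cons; exact: cbmeasD.
Qed.

Lemma cintD f g : cintegrable f -> cintegrable g ->
  cint (fun x => f x + g x) = cint f + cint g.
Proof.
move=> [f1 f2] [g1 g2]; apply: complex_eq; rewrite ?RezD ?ImzD /=.
- by under eq_Rintegral do rewrite RezD; rewrite RintegralD.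
- by under eq_Rintegral do rewrite ImzD; rewrite RintegralD.
Qed.

Lemma cintZ (c : C) f : cintegrable f -> cint (fun x => c * f x) = c * cint f.
Proof.
move=> [f1 f2]; apply: complex_eq; rewrite ?RezM ?ImzM /=.
- under eq_Rintegral do rewrite RezM.
  by rewrite RintegralB // ?RintegralZl //; exact: integrable_scale.
- under eq_Rintegral do rewrite ImzM.
  by rewrite RintegralD // ?RintegralZl //; exact: integrable_scale.
Qed.

Lemma cbmeas_bound f : cbmeas f -> exists M, forall x, cnorm (f x) <= M.
Proof.
move=> [[_ [M1 H1]] [_ [M2 H2]]]; exists (M1 + M2) => x.
rewrite -[f x](_ : Complex (complex.Re (f x)) 0 + Complex 0 (complex.Im (f x)) = _); last first.
  by apply: complex_eq; rewrite ?RezD ?ImzD /= ?addr0 ?add0r.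
rewrite (le_trans (cnormD _ _)) // lerD // /cnorm /= ?expr0n /= ?addr0 ?add0r sqrtr_sqr //.
Qed.

End ComplexIntegral.

(** * Fourier coefficients on the torus and trigonometric polynomials *)

Section TorusFourier.
Context {R : realType} (n : nat).
Local Notation C := (R[i]).
Local Notation X := (Td R n.+1).
Local Notation P := (Pd R n.+1).
Local Notation lattice := {ffun 'I_n.+1 -> int}.
Local Notation cintegrable := (cintegrable P).
Local Notation cint := (cint P).
Implicit Types f g : X -> C.

Lemma fourierE f (k : lattice) : fourier f k = cint (fun x => f x * cexpi (- dotk k x)).
Proof. by []. Qed.

Lemma cbmeas_cexpi (k : lattice) : cbmeas (fun x : X => cexpi (dotk k x)).
Proof. by split; [apply: bmeas_cos|apply: bmeas_sin]; exact: measurable_dotk. Qed.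

Lemma cbmeas_cexpiN (k : lattice) : cbmeas (fun x : X => cexpi (- dotk k x)).
Proof.
rewrite (_ : (fun x => _) = fun x : X => cexpi (dotk (- k) x)); first exact: cbmeas_cexpi.
by apply/funext => x; rewrite dotkN.
Qed.

Lemma fourier_lin (a b : C) f g (k : lattice) : cintegrable f -> cintegrable g ->
  fourier (fun x => a * f x + b * g x) k = a * fourier f k + b * fourier g k.
Proof.
move=> cf cg; rewrite !fourierE.
under [X in cint X]eq_fun do rewrite mulrDl -!mulrA.
have cf' := cintegrableM P _ _ cf (cbmeas_cexpiN k).
have cg' := cintegrableM P _ _ cg (cbmeas_cexpiN k).
have sc c h : cintegrable h -> cintegrable (fun x => c * h x).
  move=> ch; rewrite (_ : (fun x => _) = fun x => h x * c).
    by apply: cintegrableM => //; exact: cbmeas_cst.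
  by apply/funext => x; rewrite mulrC.
by rewrite cintD ?cintZ //; exact: sc.
Qed.

Lemma fourier_ae f g (k : lattice) : cintegrable f -> cintegrable g ->
  {ae P, forall x, f x = g x} -> fourier f k = fourier g k.
Proof.
move=> cf cg E; rewrite !fourierE.
have [f1 f2] := cintegrableM P _ _ cf (cbmeas_cexpiN k).
have [g1 g2] := cintegrableM P _ _ cg (cbmeas_cexpiN k).
apply: complex_eq; rewrite /= /Rintegral; congr fine; apply: ae_eq_integral => //.
- exact: measurable_int f1.
- exact: measurable_int g1.
- by apply: filterS E => x /= ->.
- exact: measurable_int f2.
- exact: measurable_int g2.
- by apply: filterS E => x /= ->.
Qed.

Lemma fourier_cexpi (l k : lattice) : fourier (fun x : X => cexpi (dotk l x)) k = (l == k)%:R.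
Proof.
rewrite fourierE; under [X in cint X]eq_fun do rewrite -cexpiD -dotkN -dotkD.
have [Hc Hs] := @torus_cos_sin R n (l - k).
rewrite /cint /Rintegral /= Hc Hs subr_eq0.
by apply: complex_eq; case: (l == k).
Qed.

Definition trigpoly (K : seq lattice) (c : lattice -> C) (x : X) : C :=
  \sum_(k <- K) c k * cexpi (dotk k x).

Lemma cbmeas_trigpoly K c : cbmeas (trigpoly K c).
Proof.
apply: cbmeas_sum => k; apply: cbmeasM; [exact: cbmeas_cst|exact: cbmeas_cexpi].
Qed.

Lemma fourier_trigpoly K c (k : lattice) : uniq K ->
  fourier (trigpoly K c) k = if k \in K then c k else 0.
Proof.
elim: K => [_|l K IH /= /andP[lK uK]].
  rewrite fourierE (_ : (fun x => _) = fun=> 0).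
    by apply: complex_eq; rewrite /= Rintegral_cst // mul0r.
  by apply/funext => x; rewrite /trigpoly big_nil mul0r.
rewrite (_ : trigpoly (l :: K) c = fun x => c l * cexpi (dotk l x) + 1 * trigpoly K c x).
  rewrite fourier_lin; last 2 first.
  - by apply: cbmeas_cintegrable; exact: cbmeas_cexpi.
  - by apply: cbmeas_cintegrable; exact: cbmeas_trigpoly.
  rewrite IH // fourier_cexpi mul1r in_cons eq_sym.
  have [E|kl] := eqVneq k l; last by rewrite mulr0 add0r.
  by rewrite E (negbTE lK) mulr1 addr0.
by apply/funext => x; rewrite /trigpoly big_cons mul1r.
Qed.

Lemma measurable_cnorm f : cmeasurable f -> measurable_fun setT (fun x => cnorm (f x)).
Proof.
move=> [m1 m2]; apply: (measurableT_comp (f := @Num.sqrt R)) => //.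
  by apply: continuous_measurable_fun; exact: sqrt_continuous.
by apply: measurable_funD; exact: measurable_funX.
Qed.

Lemma cbmeas_cmeasurable f : cbmeas f -> cmeasurable f.
Proof. by move=> [[m1 _] [m2 _]]. Qed.

Lemma cbmeas_inL2 f : cbmeas f -> inL2 f.
Proof.
move=> bf; split; first exact: cbmeas_cmeasurable.
have [M HM] := cbmeas_bound _ bf.
have b2 : bmeas (fun x => cnorm (f x) ^+ 2).
  apply: bmeasX; split; first exact/measurable_cnorm/cbmeas_cmeasurable.
  by exists M => x; rewrite ger0_norm ?cnorm_ge0.
have /integrableP[_] := bmeas_integrable P _ b2.
by under eq_integral => x _ do rewrite /= ger0_norm ?sqr_ge0 //.
Qed.

Lemma inL2_cintegrable f : inL2 f -> cintegrable f.
Proof.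
move=> [cf f2]; have [m1 m2] := cf.
have i2 : P.-integrable setT (EFin \o (fun x => 1 + cnorm (f x) ^+ 2)).
  apply: integrable_add; first by apply: bmeas_integrable; exact: bmeas_cst.
  apply/integrableP; split.
    by apply/measurable_EFinP; apply: measurable_funX; exact: measurable_cnorm.
  by under eq_integral => x _ do rewrite /= ger0_norm ?sqr_ge0 //.
have B (t : R) z : t <= cnorm z -> 0 <= t -> t <= 1 + cnorm z ^+ 2.
  move=> h t0; have : 0 <= (cnorm z - 1) ^+ 2 by exact: sqr_ge0.
  have := cnorm_ge0 z; rewrite sqrrB1 mulr2n; lra.
split; apply: (le_integrable measurableT _ _ i2).
- exact/measurable_EFinP.
- move=> x _ /=; rewrite lee_fin [leRHS]ger0_norm ?addr_ge0 ?sqr_ge0 //.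
  by apply: B => //; exact: abs_Re_le.
- exact/measurable_EFinP.
- move=> x _ /=; rewrite lee_fin [leRHS]ger0_norm ?addr_ge0 ?sqr_ge0 //.
  by apply: B => //; exact: abs_Im_le.
Qed.

(** The coefficients at [k] and [-k] together determine the cosine and sine moments of the real and
    imaginary parts separately, which reduces the claim to real functions. *)
Lemma fourier_unique f : cintegrable f -> (forall k : lattice, fourier f k = 0) ->
  {ae P, forall x, f x = 0}.
Proof.
move=> cf H; have [i1 i2] := cf.
pose a x := complex.Re (f x); pose b x := complex.Im (f x).
have bc (k : lattice) : bmeas (fun x : X => cos (dotk k x)).
  by apply: bmeas_cos; exact: measurable_dotk.
have bs (k : lattice) : bmeas (fun x : X => sin (dotk k x)).
  by apply: bmeas_sin; exact: measurable_dotk.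
have jc h (k : lattice) : P.-integrable setT (EFin \o h) ->
    P.-integrable setT (EFin \o (fun x => h x * cos (dotk k x))).
  by move=> ih; exact: integrableMbmeas.
have js h (k : lattice) : P.-integrable setT (EFin \o h) ->
    P.-integrable setT (EFin \o (fun x => h x * sin (dotk k x))).
  by move=> ih; exact: integrableMbmeas.
pose Ic h (k : lattice) : R := Rintegral P setT (fun x => h x * cos (dotk k x)).
pose Is h (k : lattice) : R := Rintegral P setT (fun x => h x * sin (dotk k x)).
have E1 k : Ic a k + Is b k = 0.
  have /(congr1 (@complex.Re R)) := H k; rewrite /= => <-; rewrite /Ic /Is.
  rewrite -RintegralD //; [|exact: jc|exact: js].
  by apply: eq_Rintegral => x _; rewrite RezM /= cosN sinN mulrN opprK.
have E2 k : Ic b k - Is a k = 0.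
  have /(congr1 (@complex.Im R)) := H k; rewrite /= => <-; rewrite /Ic /Is.
  rewrite -RintegralB //; [|exact: jc|exact: js].
  by apply: eq_Rintegral => x _; rewrite ImzM /= cosN sinN mulrN addrC.
have IcN h k : Ic h (- k) = Ic h k.
  by apply: eq_Rintegral => x _; rewrite dotkN cosN.
have IsN h k : P.-integrable setT (EFin \o h) -> Is h (- k) = - Is h k.
  move=> ih; rewrite -[RHS]mulN1r /Is -RintegralZl //; last exact: js.
  by apply: eq_Rintegral => x _; rewrite dotkN sinN mulN1r mulrN.
have Z k : [/\ Ic a k = 0, Is a k = 0, Ic b k = 0 & Is b k = 0].
  have := E1 (- k); have := E2 (- k); have := E1 k; have := E2 k.
  by rewrite !IcN !IsN //; split; lra.
have V h : P.-integrable setT (EFin \o h) -> (forall k, Ic h k = 0 /\ Is h k = 0) ->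
    {ae P, forall x, h x = 0}.
  move=> ih Hh; apply: (torus_uniqueness n) => // k; have [H1 H2] := Hh k; split.
  - rewrite -(fineK (integrable_fin_num measurableT (jc _ k ih))) //=.
    by rewrite -[fine _]/(Ic h k) H1.
  - rewrite -(fineK (integrable_fin_num measurableT (js _ k ih))) //=.
    by rewrite -[fine _]/(Is h k) H2.
have Va : {ae P, forall x, a x = 0} by apply: V => // k; have [] := Z k.
have Vb : {ae P, forall x, b x = 0} by apply: V => // k; have [] := Z k.
by apply: filterS2 Va Vb => x H1 H2; exact: complex_eq.
Qed.

End TorusFourier.

Section BoundedConvergence.
Context {R : realType} {d : measure_display} {T : measurableType d}.
Variable P : probability T R.

Lemma bmeas_lim (a_ : nat -> T -> R) (a : T -> R) (M : R) :
  (forall i, measurable_fun setT (a_ i)) -> (forall i x, `|a_ i x| <= M) ->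
  (forall x, a_ ^~ x @ \oo --> a x) -> bmeas a.
Proof.
move=> ma aM ca; split; first by apply: (measurable_fun_cvg (h := a_)) => // x _; exact: ca.
exists M => x; have cn : `|a_ i x| @[i --> \oo] --> `|a x| by apply: cvg_norm; exact: ca.
by apply: (cvgr_to_le cn); near=> i; exact: aM.
Unshelve. all: by end_near. Qed.

Lemma bounded_convergence (a_ : nat -> T -> R) (a : T -> R) (M : R) :
  (forall i, measurable_fun setT (a_ i)) -> (forall i x, `|a_ i x| <= M) ->
  (forall x, a_ ^~ x @ \oo --> a x) ->
  (fun i => Rintegral P setT (a_ i)) @ \oo --> Rintegral P setT a.
Proof.
move=> ma aM ca; have ba := bmeas_lim _ _ _ ma aM ca.
have iM : P.-integrable setT (EFin \o (fun=> M)) by apply: bmeas_integrable; exact: bmeas_cst.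
have [|||||_ _ H] := @dominated_convergence _ _ _ P setT measurableT
  (fun i x => (a_ i x)%:E) (fun x => (a x)%:E) (EFin \o (fun=> M)).
- by move=> i; exact/measurable_EFinP.
- by apply/measurable_EFinP; case: ba.
- by apply: aeW => x _; apply: cvg_EFin; [exact: nearW|exact: ca].
- exact: iM.
- by apply: aeW => x i _ /=; rewrite lee_fin.
- have fa : (\int[P]_x (a x)%:E)%E \is a fin_num.
    by apply: integrable_fin_num => //; exact: bmeas_integrable.
  by apply: fine_cvg; rewrite /Rintegral fineK.
Qed.

End BoundedConvergence.

Lemma cvg_of_cauchy {R : realType} (u : nat -> R) :
  (forall e, 0 < e -> exists N, forall m, (N <= m)%N -> `|u m - u N| <= e) ->
  cvg (u @ \oo).
Proof.
move=> H; apply/cauchy_cvgP/cauchyP => e e0.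
have e20 : 0 < e / 2 by rewrite divr_gt0.
have [N HN] := H _ e20; exists (u N).
exists N => // m /= Nm; rewrite /ball /= distrC (le_lt_trans (HN _ Nm)) //.
by rewrite ltr_pdivrMr // ltr_pMr // ltr1n.
Qed.

(** * Fourier series of Sobolev functions and the projection operators *)

Section SobolevSeries.
Context {R : realType} (n : nat) (s : R) (r : \bar R).
Hypothesis r_gt0 : (0 < r)%E.
Hypothesis s_gt : n.+1%:R < 2 * s.
Local Notation C := (R[i]).
Local Notation X := (Td R n.+1).
Local Notation P := (Pd R n.+1).
Local Notation lattice := {ffun 'I_n.+1 -> int}.
Local Notation W := (@latW R n r).
Implicit Types f g : X -> C.

Lemma sob_weightE (k : lattice) : sob_weight2 s r k = powR (W k) (2 * s).
Proof.
case: r r_gt0 => [r'| |] // r0; rewrite /latW /gaugeW /sob_weight2 //.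
by rewrite -powRrM [r'^-1 * _]mulrC.
Qed.

Lemma W_gt0 (k : lattice) : 0 < W k.
Proof. exact: latW_gt0. Qed.

Lemma sob_weight_gt0 (k : lattice) : 0 < sob_weight2 s r k.
Proof. by rewrite sob_weightE powR_gt0 // W_gt0. Qed.

Lemma Hnorm2_ge0 f : (0 <= Hnorm2 s r f)%E.
Proof.
by apply: esum_ge0 => k _; rewrite lee_fin mulr_ge0 ?sqr_ge0 // ltW // sob_weight_gt0.
Qed.

Lemma Hnorm2_ge f (K : {fset lattice}) :
  ((\sum_(k <- K) sob_weight2 s r k * cnorm (fourier f k) ^+ 2)%:E <= Hnorm2 s r f)%E.
Proof.
apply: esum_ge; exists [set` K]; first by split => //; exact: finite_fset.
by rewrite -fsbig_seq ?fset_uniq // sumEFin.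
Qed.

Lemma Hnorm_sqr f : inH s r f -> Hnorm s r f ^+ 2 = fine (Hnorm2 s r f).
Proof. by move=> _; rewrite sqr_sqrtr // fine_ge0 // Hnorm2_ge0. Qed.

Lemma sum_weight_le f (K : {fset lattice}) : inH s r f ->
  \sum_(k <- K) sob_weight2 s r k * cnorm (fourier f k) ^+ 2 <= Hnorm s r f ^+ 2.
Proof.
move=> Hf; rewrite Hnorm_sqr // -lee_fin fineK; first exact: Hnorm2_ge.
by rewrite ge0_fin_numE ?Hnorm2_ge0 //; case: Hf.
Qed.

(** Cauchy-Schwarz after writing [1 = W^(-s) * W^s]. *)
Lemma sum_fourier_le f (K : {fset lattice}) : inH s r f ->
  \sum_(k <- K) cnorm (fourier f k) <= Num.sqrt (latsum n r (2 * s) K) * Hnorm s r f.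
Proof.
move=> Hf; have H0 : 0 <= Hnorm s r f by exact: sqrtr_ge0.
have L0 : 0 <= latsum n r (2 * s) K by apply: sumr_ge0 => k _; exact: powR_ge0.
have S0 : 0 <= \sum_(k <- K) cnorm (fourier f k) by apply: sumr_ge0 => k _; exact: cnorm_ge0.
rewrite -(ler_pXn2r (n := 2)) ?nnegrE ?mulr_ge0 ?sqrtr_ge0 //.
rewrite exprMn sqr_sqrtr //.
have sq (k : lattice) t : powR (W k) t ^+ 2 = powR (W k) (2 * t).
  rewrite expr2 -powRD; first by congr powR; ring.
  by rewrite (gt_eqF (W_gt0 k)) implybT.
apply: le_trans (_ : _ <= (\sum_(k <- K) powR (W k) (- s) ^+ 2) *
  (\sum_(k <- K) (powR (W k) s * cnorm (fourier f k)) ^+ 2)) _.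
  apply: le_trans (cauchy_schwarz _ _ _ _); rewrite le_eqVlt; apply/orP; left; apply/eqP.
  congr (_ ^+ 2); apply: eq_bigr => k _.
  by rewrite mulrA powRN mulVf ?mul1r // gt_eqF // powR_gt0 // W_gt0.
apply: ler_pM.
- by apply: sumr_ge0 => k _; exact: sqr_ge0.
- by apply: sumr_ge0 => k _; exact: sqr_ge0.
- by apply: ler_sum => k _; rewrite sq mulrN.
- apply: le_trans (sum_weight_le f K Hf); apply: ler_sum => k _.
  by rewrite exprMn sq sob_weightE.
Qed.

Definition tail_le (t B : R) := forall K : {fset lattice},
  (forall k, k \in K -> t <= W k) -> latsum n r (2 * s) K <= B.

Definition fsum (t : R) f : X -> C :=
  trigpoly n (fset_set (latball n r t)) (fourier f).

Lemma cnorm_trigpoly (K : seq lattice) (c : lattice -> C) (x : X) :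
  cnorm (trigpoly n K c x) <= \sum_(k <- K) cnorm (c k).
Proof.
apply: (le_trans (cnorm_sum _ _ _)); apply: ler_sum => k _.
by rewrite cnormM cnorm_cexpi mulr1.
Qed.

Lemma fsum_diff f t t' B x : inH s r f -> tail_le t B -> t <= t' ->
  cnorm (fsum t' f x - fsum t f x) <= Num.sqrt B * Hnorm s r f.
Proof.
move=> Hf HB tt'; have ft u := finite_latball n r r_gt0 u.
pose K := fset_set (latball n r t); pose K' := fset_set (latball n r t').
have sub : (K `<=` K')%fset.
  apply/fsubsetP => k; rewrite !in_fset_set // => /set_mem H; apply/mem_set.
  exact: lt_le_trans H tt'.
have -> : fsum t' f x - fsum t f x = trigpoly n (K' `\` K)%fset (fourier f) x.
  rewrite /fsum /trigpoly -/K -/K' (perm_big (K ++ (K' `\` K)%fset)) ?big_cat /=.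
    by rewrite addrAC subrr add0r.
  apply: uniq_perm; [exact: fset_uniq| |].
  - rewrite cat_uniq !fset_uniq andbT /=; apply/hasPn => k.
    by rewrite /= in_fsetD => /andP[].
  - move=> k; rewrite mem_cat in_fsetD; case: (boolP (k \in K)) => //= kK.
    by move/fsubsetP: sub; apply.
apply: (le_trans (cnorm_trigpoly _ _ _)).
apply: (le_trans (sum_fourier_le f _ Hf)); apply: ler_wpM2r; first exact: sqrtr_ge0.
apply: ler_wsqrtr; apply: HB => k; rewrite in_fsetD !in_fset_set // => /andP[/negP H _].
by rewrite leNgt; apply/negP => H'; apply: H; exact/mem_set.
Qed.

Lemma tail_small (e : R) : 0 < e -> exists t, 1 < t /\ tail_le t e.
Proof.
move=> e0; have h : 0 < (2^-1 : R) < 1 by apply/andP; split; lra.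
have /andP[h0 h1] := h.
have [t0 [t01 Ht0]] := tail_upper n r r_gt0 (2 * s) 2^-1 s_gt h0 h1.
pose D := (1 + 2^-1) * (gvol n r * (n.+1%:R / (2 * s - n.+1%:R))).
have v0 : 0 < 2 * s - n.+1%:R by rewrite subr_gt0.
have D0 : 0 < D.
  by rewrite !mulr_gt0 ?divr_gt0 // ?gvol_gt0 ?invr_gt0 //; lra.
(* The radius at which the tail estimate [D t^(n + 1 - 2s)] equals [e]; adding [t0] also enters the
   range where that estimate holds. *)
pose q := powR (D / e) (2 * s - n.+1%:R)^-1.
have q0 : 0 < q by rewrite powR_gt0 // divr_gt0.
exists (t0 + q); split; first lra.
move=> K HK; have tq : t0 <= t0 + q by lra.
apply: (le_trans (Ht0 _ tq K HK)).
set t := t0 + q; have t_gt0 : 0 < t by rewrite /t; lra.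
have -> : powR t (- (2 * s)) * t ^+ n.+1 = (powR t (2 * s - n.+1%:R))^-1.
  rewrite -powRN opprB addrC powRD; last by rewrite (gt_eqF t_gt0) implybT.
  by rewrite powR_mulrn // ltW.
have H : D / e <= powR t (2 * s - n.+1%:R).
  have -> : D / e = powR q (2 * s - n.+1%:R).
    by rewrite -powRrM mulVf ?powRr1 ?gt_eqF // divr_ge0 // ltW.
  by apply: ge0_ler_powR; rewrite ?nnegrE ?(ltW v0) ?(ltW q0) ?(ltW t_gt0) // /t; lra.
rewrite mulrA -/D ler_pdivrMr ?powR_gt0 //.
by rewrite -ler_pdivrMl // mulrC.
Qed.

Lemma tail_le_mono t t' B : tail_le t B -> t <= t' -> tail_le t' B.
Proof. by move=> H tt' K HK; apply: H => k kK; exact: le_trans (HK _ kK). Qed.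

Lemma fourier_fsum f t (k : lattice) : W k < t -> fourier (fsum t f) k = fourier f k.
Proof.
move=> kt; rewrite fourier_trigpoly ?fset_uniq // in_fset_set; last exact: finite_latball.
by rewrite mem_set.
Qed.

(** The partial sums [u i] are uniformly bounded and Cauchy at every point, so bounded convergence
    shows that their limit [g] has the coefficients of [f]. Uniqueness identifies [f] with [g]
    almost everywhere, and the bound is proved for [g] at every point. *)
Lemma sobolev_series f t B : inH s r f -> tail_le t B ->
  {ae P, forall x, cnorm (f x - fsum t f x) <= Num.sqrt B * Hnorm s r f}.
Proof.
move=> Hf HB; have H0 : 0 <= Hnorm s r f by exact: sqrtr_ge0.
have [t0 [t01 Ht0]] := tail_small 1 ltr01.
pose u (i : nat) := fsum (t0 + i%:R) f.
have bu i : cbmeas (u i) by exact: cbmeas_trigpoly.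
have ti i : t0 <= t0 + i%:R by rewrite lerDl.
have [M HM] := cbmeas_bound _ (bu 0%N).
have uM i x : cnorm (u i x) <= Hnorm s r f + M.
  rewrite -[u i x](subrK (u 0%N x)) (le_trans (cnormD _ _)) // lerD //.
  have -> : u 0%N = fsum t0 f by rewrite /u addr0.
  by apply: (le_trans (fsum_diff f _ _ _ x Hf Ht0 (ti i))); rewrite sqrtr1 mul1r.
have cau x e : 0 < e -> exists N, forall m, (N <= m)%N -> cnorm (u m x - u N x) <= e.
  move=> e0; pose e' := (e / (Hnorm s r f + 1)) ^+ 2.
  have H1 : 0 < Hnorm s r f + 1 by rewrite ltr_wpDl.
  have e'0 : 0 < e' by rewrite exprn_gt0 // divr_gt0.
  have [t1 [t11 Ht1]] := tail_small _ e'0.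
  exists (Num.bound t1) => m Nm.
  have bt : t1 <= t0 + (Num.bound t1)%:R.
    have : t1 < (Num.bound t1)%:R by apply: archi_boundP; lra.
    lra.
  have mono : t0 + (Num.bound t1)%:R <= t0 + m%:R by rewrite lerD2l ler_nat.
  apply: (le_trans (fsum_diff f _ _ _ x Hf (tail_le_mono _ _ _ Ht1 bt) mono)).
  have eH : 0 <= e / (Hnorm s r f + 1) by apply: divr_ge0; exact: ltW.
  rewrite /e' sqrtr_sqr ger0_norm // mulrAC ler_pdivrMr //.
  by rewrite ler_pM2l // lerDl.
have cR x : cvg ((fun i => complex.Re (u i x)) @ \oo).
  apply: cvg_of_cauchy => e e0; have [N HN] := cau x e e0; exists N => m Nm.
  by rewrite -RezN -RezD (le_trans (abs_Re_le _)) // HN.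
have cI x : cvg ((fun i => complex.Im (u i x)) @ \oo).
  apply: cvg_of_cauchy => e e0; have [N HN] := cau x e e0; exists N => m Nm.
  by rewrite -ImzN -ImzD (le_trans (abs_Im_le _)) // HN.
pose gr x := limn (fun i => complex.Re (u i x)).
pose gi x := limn (fun i => complex.Im (u i x)).
pose g x : C := Complex (gr x) (gi x).
have uR x : (fun i => complex.Re (u i x)) @ \oo --> gr x by exact: cR.
have uI x : (fun i => complex.Im (u i x)) @ \oo --> gi x by exact: cI.
have bg : cbmeas g.
  split.
  - apply: (bmeas_lim (fun i x => complex.Re (u i x)) gr (Hnorm s r f + M)) => // i.
    + by case: (bu i) => -[].
    + by move=> x; rewrite (le_trans (abs_Re_le _)).
  - apply: (bmeas_lim (fun i x => complex.Im (u i x)) gi (Hnorm s r f + M)) => // i.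
    + by case: (bu i) => _ [].
    + by move=> x; rewrite (le_trans (abs_Im_le _)).
have Fg k : fourier g k = fourier f k.
  pose e x : C := cexpi (- dotk k x).
  have bue i : cbmeas (fun x => u i x * e x) by apply: cbmeasM => //; exact: cbmeas_cexpiN.
  have ueM i x : cnorm (u i x * e x) <= Hnorm s r f + M.
    by rewrite cnormM cnorm_cexpi mulr1.
  have ev : \forall i \near \oo, fourier (u i) k = fourier f k.
    exists (Num.bound (W k)) => // i /= Ni; apply: fourier_fsum.
    have : W k < (Num.bound (W k))%:R by apply: archi_boundP; exact/ltW/W_gt0.
    move=> /lt_le_trans; apply; apply: (@le_trans _ _ i%:R); first by rewrite ler_nat.
    by rewrite lerDr; lra.
  have DR := bounded_convergence P (fun i x => complex.Re (u i x * e x))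
    (fun x => complex.Re (g x * e x)) (Hnorm s r f + M).
  have DI := bounded_convergence P (fun i x => complex.Im (u i x * e x))
    (fun x => complex.Im (g x * e x)) (Hnorm s r f + M).
  apply: complex_eq.
  - have L1 : (fun i => Rintegral P setT (fun x => complex.Re (u i x * e x))) @ \oo -->
        Rintegral P setT (fun x => complex.Re (g x * e x)).
      apply: DR => [i|i x|x].
      + by case: (bue i) => -[].
      + by rewrite (le_trans (abs_Re_le _)).
      + under eq_fun do rewrite RezM; rewrite RezM.
        by apply: cvgB; apply: cvgMl; [exact: uR|exact: uI].
    have L2 : (fun i => Rintegral P setT (fun x => complex.Re (u i x * e x))) @ \oo -->
        complex.Re (fourier f k).
      by apply: cvg_near_cst; apply: filterS ev => i <-.
    exact: cvg_unique L1 L2.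
  - have L1 : (fun i => Rintegral P setT (fun x => complex.Im (u i x * e x))) @ \oo -->
        Rintegral P setT (fun x => complex.Im (g x * e x)).
      apply: DI => [i|i x|x].
      + by case: (bue i) => _ [].
      + by rewrite (le_trans (abs_Im_le _)).
      + under eq_fun do rewrite ImzM; rewrite ImzM.
        by apply: cvgD; apply: cvgMl; [exact: uR|exact: uI].
    have L2 : (fun i => Rintegral P setT (fun x => complex.Im (u i x * e x))) @ \oo -->
        complex.Im (fourier f k).
      by apply: cvg_near_cst; apply: filterS ev => i <-.
    exact: cvg_unique L1 L2.
have cf : cintegrable P f by apply: inL2_cintegrable; case: Hf.
have cg : cintegrable P g by exact: cbmeas_cintegrable.
have Z : {ae P, forall x, 1 * f x + (-1) * g x = 0}.
  apply: fourier_unique.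
    apply: cintegrableD.
    - by rewrite (_ : (fun x => 1 * f x) = f) //; apply/funext => x; rewrite mul1r.
    - have := cintegrableM P _ _ cg (cbmeas_cst (-1)).
      by rewrite (_ : (fun x => _) = fun x => -1 * g x) //; apply/funext => x; rewrite mulrC.
  by move=> k; rewrite fourier_lin // Fg mul1r mulN1r subrr.
(* Convergence is known for the real and imaginary parts, so the bound passes to the limit in
   squared form. *)
have G x : cnorm (g x - fsum t f x) <= Num.sqrt B * Hnorm s r f.
  have N0 : 0 <= Num.sqrt B * Hnorm s r f by rewrite mulr_ge0 // sqrtr_ge0.
  rewrite -(ler_pXn2r (n := 2)) ?nnegrE ?cnorm_ge0 //.
  rewrite cnorm_sqr RezD ImzD RezN ImzN.
  set a := complex.Re (fsum t f x); set b := complex.Im (fsum t f x).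
  have cv : (fun i => (complex.Re (u i x) - a) ^+ 2 + (complex.Im (u i x) - b) ^+ 2) @ \oo -->
      (gr x - a) ^+ 2 + (gi x - b) ^+ 2.
    apply: cvgD.
    - rewrite expr2; under eq_fun do rewrite expr2.
      by apply: cvgM; apply: cvgB; [exact: uR|exact: cvg_cst|exact: uR|exact: cvg_cst].
    - rewrite expr2; under eq_fun do rewrite expr2.
      by apply: cvgM; apply: cvgB; [exact: uI|exact: cvg_cst|exact: uI|exact: cvg_cst].
  apply: (cvgr_to_le cv); exists (Num.bound `|t|) => // i /= Ni.
  have tt : t <= t0 + i%:R.
    apply: (le_trans (ler_norm t)).
    have : `|t| < (Num.bound `|t|)%:R by apply: archi_boundP; exact: normr_ge0.
    have : (Num.bound `|t|)%:R <= i%:R :> R by rewrite ler_nat.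
    lra.
  have := fsum_diff f _ _ _ x Hf HB tt.
  rewrite -(ler_pXn2r (n := 2)) ?nnegrE ?cnorm_ge0 //.
  by rewrite cnorm_sqr RezD ImzD RezN ImzN.
apply: filterS Z => x; rewrite mul1r mulN1r => /eqP; rewrite subr_eq0 => /eqP ->.
exact: G.
Qed.

Lemma Pd_setT_gt0 : (0 < P setT)%E.
Proof. by rewrite (_ : P setT = 1%E) ?lte01 //; exact: probability_setT. Qed.

Lemma Linf_norm_le g (c : R) : {ae P, forall x, cnorm (g x) <= c} <->
  (Linf_norm g <= c%:E)%E.
Proof.
split=> [H|/ess_supP H].
- by apply/ess_supP; apply: filterS H => x; rewrite lee_fin.
- by apply: filterS H => x; rewrite lee_fin.
Qed.

Lemma cnorm_fsum t f x : inH s r f ->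
  cnorm (fsum t f x) <= Num.sqrt (latsum n r (2 * s) (fset_set (latball n r t))) * Hnorm s r f.
Proof. by move=> Hf; apply: (le_trans (cnorm_trigpoly _ _ _)); exact: sum_fourier_le. Qed.

Lemma fsum_bdd_lin_op t : bdd_lin_op s r (fsum t).
Proof.
have cI f : inH s r f -> cintegrable P f by case=> H _; exact: inL2_cintegrable.
split.
- move=> f Hf; split; first by apply: cbmeas_cmeasurable; exact: cbmeas_trigpoly.
  apply: le_lt_trans (ltry _); apply/Linf_norm_le/nearW => x; exact: cnorm_fsum.
- move=> f g Hf Hg E; apply: nearW => x; rewrite /fsum; congr (trigpoly n _ _ x).
  by apply/funext => k; apply: fourier_ae E; exact: cI.
- move=> a b f g Hf Hg; apply: nearW => x; rewrite /fsum /trigpoly !mulr_sumr -big_split /=.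
  apply: eq_bigr => k _; rewrite fourier_lin; [|exact: cI|exact: cI].
  by rewrite mulrDl !mulrA.
- exists (Num.sqrt (latsum n r (2 * s) (fset_set (latball n r t)))) => f Hf.
  by apply/Linf_norm_le/nearW => x; exact: cnorm_fsum.
Qed.

Lemma fsum_rank_lt t m : (latcount n r t < m)%N -> rank_lt s r m (fsum t).
Proof.
move=> tm; exists (latcount n r t); split=> //.
pose K : seq lattice := fset_set (latball n r t).
exists (fun i x => cexpi (dotk (nth 0 K i) x)) => f _.
exists (fun i => fourier f (nth 0 K i)); apply: nearW => x.
by rewrite /fsum /trigpoly -/K (big_nth 0) big_mkord.
Qed.

Lemma approx_number_le m t B : tail_le t B -> (latcount n r t < m)%N ->
  (approx_number n.+1 s r m <= (Num.sqrt B)%:E)%E.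
Proof.
move=> HB tm.
apply: (@le_trans _ _ (opnorm_IminusA s r (fsum t))).
  apply: ereal_inf_lbound; exists (fsum t) => //; split; first exact: fsum_bdd_lin_op.
  exact: fsum_rank_lt.
apply: ge_ereal_sup => _ [f [Hf f1] <-].
apply/Linf_norm_le; have := sobolev_series f t B Hf HB.
apply: filterS => x /le_trans; apply.
by rewrite ler_piMr // sqrtr_ge0.
Qed.

End SobolevSeries.

(** * Lower bound *)

Section UnitaryRows.
Context {C : numClosedFieldType}.
Local Open Scope sesquilinear_scope.

Definition normsq {n} (v : 'rV[C]_n) : C := \sum_(j < n) `|v 0 j| ^+ 2.

Lemma normsqE {n} (v : 'rV[C]_n) : normsq v = (v *m v ^t*) 0 0.
Proof. by rewrite mxE; apply: eq_bigr => j _; rewrite !mxE normCK. Qed.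

Lemma normsq_mul_unitary {L N} (y : 'rV[C]_L) (Q : 'M[C]_(L, N)) :
  Q \is unitarymx -> normsq (y *m Q) = normsq y.
Proof.
move=> /unitarymxP QQ; rewrite !normsqE; congr (fun_of_matrix _ 0 0).
by rewrite trmx_mul map_mxM mulmxA -[y *m Q *m _]mulmxA QQ mulmx1.
Qed.

Lemma unitary_row_normsq {L N} (Q : 'M[C]_(L, N)) l :
  Q \is unitarymx -> \sum_(i < N) `|Q l i| ^+ 2 = 1.
Proof.
move=> /unitarymxP /matrixP /(_ l l); rewrite !mxE eqxx => E.
rewrite -[RHS]/(true%:R) -E.
by apply: eq_bigr => i _; rewrite !mxE normCK.
Qed.

(** Bessel's inequality: if [y] is the conjugate of column [i], then [y *m Q] has entry [q] at [i]
    and squared norm [q], hence [q^2 <= q]. *)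
Lemma unitary_col_normsq {L N} (Q : 'M[C]_(L, N)) i :
  Q \is unitarymx -> \sum_(l < L) `|Q l i| ^+ 2 <= 1.
Proof.
move=> uQ; set q := \sum_(l < L) _.
have q0 : 0 <= q by apply: sumr_ge0 => l _; rewrite exprn_ge0.
pose y : 'rV[C]_L := \row_l (Q l i)^*.
have ny : normsq y = q by apply: eq_bigr => l _; rewrite mxE norm_conjC.
have yQ : (y *m Q) 0 i = q by rewrite mxE; apply: eq_bigr => l _; rewrite mxE normCKC.
have : q ^+ 2 <= q.
  rewrite -[leRHS]ny -(normsq_mul_unitary y Q uQ) /normsq (bigD1 i) //= yQ ger0_norm //.
  by rewrite lerDl; apply: sumr_ge0 => j _; rewrite exprn_ge0.
have [->|qn0] := eqVneq q 0; first by rewrite ler01.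
by rewrite expr2 -[leRHS]mulr1 ler_pM2l // lt_def qn0.
Qed.

(** Schmidt orthonormalisation of a basis of the left kernel, whose dimension is at least [N - m]
    because [A] has rank at most [m]. *)
Lemma unitary_kernel {N m} (A : 'M[C]_(N, m)) : exists L (Q : 'M[C]_(L, N)),
  [/\ (N - m <= L)%N, Q \is unitarymx & Q *m A = 0].
Proof.
exists (\rank (kermx A)), (schmidt (row_base (kermx A))); split.
- by rewrite mxrank_ker leq_sub2l // rank_leq_col.
- by apply: schmidt_unitarymx; exact: rank_leq_col.
- apply/sub_kermxP; rewrite (eqmx_schmidt_free (row_base_free _)).
  by rewrite eq_row_base.
Qed.

End UnitaryRows.

(* Only countably many test vectors [z] are allowed, so that a bound holding
   almost everywhere for each [z] holds for all [z] off one null set.  The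
   vectors [floor (t * y)] with [t] large recover the dual norm of [y]. *)
Lemma real_vector_dual_bound {R : realType} (I : finType) (y : I -> R) (M : R) : 0 <= M ->
  (forall z : {ffun I -> int}, \sum_i (z i)%:~R * y i <= M * Num.sqrt (\sum_i (z i)%:~R ^+ 2)) ->
  \sum_i y i ^+ 2 <= M ^+ 2.
Proof.
move=> M0 H; set Y := \sum_i y i ^+ 2.
have Y0 : 0 <= Y by apply: sumr_ge0 => i _; exact: sqr_ge0.
pose B : R := \sum_i `|y i|; pose D : R := \sum_(i : I) 1.
have B0 : 0 <= B by exact: sumr_ge0.
have D0 : 0 <= D by exact: sumr_ge0.
have key (t : R) : 0 <= t -> B <= t * Y ->
    (t * Y - B) ^+ 2 <= M ^+ 2 * (t ^+ 2 * Y + 2 * t * B + D).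
  move=> t0 tB; pose z : {ffun I -> int} := [ffun i => Num.floor (t * y i)].
  have zl i : t * y i - 1 <= (z i)%:~R <= t * y i.
    by rewrite ffunE; have := floor_itv (t * y i); rewrite intrD => /andP[? ?]; apply/andP; split; lra.
  have S1 : t * Y - B <= \sum_i (z i)%:~R * y i.
    rewrite /Y /B mulr_sumr -sumrB; apply: ler_sum => i _.
    have /andP[z1 z2] := zl i.
    have : `|(t * y i - (z i)%:~R) * y i| <= `|y i|.
      by rewrite normrM ler_piMl // ger0_norm; lra.
    by rewrite ler_norml mulrBl expr2 => /andP[_]; lra.
  have S2 : \sum_i (z i)%:~R ^+ 2 <= t ^+ 2 * Y + 2 * t * B + D.
    rewrite /Y /B /D !mulr_sumr -!big_split /=; apply: ler_sum => i _.
    have /andP[z1 z2] := zl i.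
    have : `|(z i)%:~R| <= t * `|y i| + 1 :> R.
      rewrite -[(z i)%:~R](subrK (t * y i)) (le_trans (ler_normD _ _)) // addrC.
      by rewrite normrM (ger0_norm t0) lerD2l ler_norml; apply/andP; split; lra.
    move=> h; rewrite -[leLHS](real_normK (num_real _)) expr2.
    apply: (le_trans (ler_pM (normr_ge0 _) (normr_ge0 _) h h)).
    have -> : y i ^+ 2 = `|y i| ^+ 2 by rewrite real_normK // num_real.
    by rewrite le_eqVlt; apply/orP; left; apply/eqP; ring.
  have Z0 : 0 <= \sum_i (z i)%:~R ^+ 2 :> R by apply: sumr_ge0 => i _; exact: sqr_ge0.
  have S3 : t * Y - B <= M * Num.sqrt (t ^+ 2 * Y + 2 * t * B + D).
    by apply: (le_trans S1); apply: (le_trans (H z)); rewrite ler_wpM2l // ler_wsqrtr.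
  rewrite -[X in _ <= _ * X]sqr_sqrtr; last exact: le_trans S2.
  rewrite -exprMn ler_pXn2r ?nnegrE ?mulr_ge0 ?sqrtr_ge0 //; lra.
rewrite leNgt; apply/negP => MY.
have Y1 : 0 < Y by apply: le_lt_trans MY; exact: sqr_ge0.
pose c := Y - M ^+ 2; have c0 : 0 < c by rewrite subr_gt0.
pose E := 2 * B * Y + 2 * M ^+ 2 * B + M ^+ 2 * D.
have E0 : 0 <= E by rewrite !addr_ge0 ?mulr_ge0 ?sqr_ge0 //.
(* In the inequality [key] the quadratic coefficient favours the left side by [Y c > 0], and [E]
   collects the competing terms. The three summands give [t >= 1], the hypothesis [B <= t * Y], and
   [E < t * (Y * c)], so [key] fails. *)
pose t := 1 + B / Y + E / (Y * c).
have Yc : 0 < Y * c by rewrite mulr_gt0.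
have BY : 0 <= B / Y by rewrite divr_ge0.
have EYc : 0 <= E / (Y * c) by rewrite divr_ge0 // ltW.
have t1 : 1 <= t by rewrite /t; lra.
have tB : B <= t * Y by rewrite -ler_pdivrMr // /t; lra.
have tE : E < t * (Y * c) by rewrite -ltr_pdivrMr // /t; lra.
have t0 : 0 <= t by lra.
have := key t t0 tB.
have H1 : t * E < t * (t * (Y * c)) by rewrite ltr_pM2l //; lra.
have H2 : M ^+ 2 * D <= t * (M ^+ 2 * D) by rewrite ler_peMl // mulr_ge0 ?sqr_ge0.
have B2 : 0 <= B ^+ 2 by exact: sqr_ge0.
apply/negP; rewrite -ltNge -subr_gt0.
have -> : (t * Y - B) ^+ 2 - M ^+ 2 * (t ^+ 2 * Y + 2 * t * B + D) =
  t * (t * (Y * c)) - t * E + (t * (M ^+ 2 * D) - M ^+ 2 * D) + B ^+ 2.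
  by rewrite /c /E; ring.
lra.
Qed.

(** * Parseval's identity for trigonometric polynomials *)

Section Parseval.
Context {R : realType} (n : nat).
Local Notation C := (R[i]).
Local Notation X := (Td R n.+1).
Local Notation P := (Pd R n.+1).
Local Notation lattice := {ffun 'I_n.+1 -> int}.
Local Notation cint := (cint P).

Lemma cint0 : cint (fun=> 0) = 0.
Proof. by apply: complex_eq; rewrite /= Rintegral_cst // mul0r. Qed.

Lemma cint_sum (I : Type) (s : seq I) (F : I -> X -> C) : (forall i, cbmeas (F i)) ->
  cint (fun x => \sum_(i <- s) F i x) = \sum_(i <- s) cint (F i).
Proof.
move=> bF; elim: s => [|i s IH].
  rewrite (_ : (fun x => _) = fun=> 0) ?cint0 ?big_nil //.
  by apply/funext => x; rewrite big_nil.
rewrite big_cons -IH -cintD; last 2 first.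
- exact: cbmeas_cintegrable.
- by apply: cbmeas_cintegrable; exact: cbmeas_sum.
by congr cint; apply/funext => x; rewrite big_cons.
Qed.

Lemma conjc_sum (I : Type) (s : seq I) (F : I -> C) :
  conjc (\sum_(i <- s) F i) = \sum_(i <- s) conjc (F i).
Proof. exact: rmorph_sum. Qed.

Lemma conjcM (z w : C) : conjc (z * w) = conjc z * conjc w.
Proof. exact: rmorphM. Qed.

Lemma cexpi_conj (t : R) : conjc (cexpi t) = cexpi (- t).
Proof. by rewrite /cexpi cosN sinN. Qed.

Lemma mul_conjc (z : C) : z * conjc z = ((cnorm z ^+ 2)%:C)%C.
Proof.
apply: complex_eq; rewrite ?RezM ?ImzM /= ?cnorm_sqr; case: z => a b /=; ring.
Qed.

(** Only the conjugated factor of [f * conjc f] is expanded; the integrals that appear are the known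
    Fourier coefficients of [f]. *)
Lemma parseval_trigpoly (K : seq lattice) (c : lattice -> C) : uniq K ->
  Rintegral P setT (fun x => cnorm (trigpoly n K c x) ^+ 2) = \sum_(k <- K) cnorm (c k) ^+ 2.
Proof.
move=> uK; set f := trigpoly n K c.
have bf : cbmeas f := cbmeas_trigpoly n K c.
have E : cint (fun x => f x * conjc (f x)) = \sum_(k <- K) conjc (c k) * c k.
  transitivity (cint (fun x => \sum_(k <- K) conjc (c k) * (f x * cexpi (- dotk k x)))).
    congr cint; apply/funext => x; rewrite {2}/f /trigpoly conjc_sum mulr_sumr.
    by apply: eq_bigr => k _; rewrite conjcM cexpi_conj mulrCA.
  have bfe k : cbmeas (fun x => f x * cexpi (- dotk k x)).
    by apply: cbmeasM => //; exact: cbmeas_cexpiN.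
  rewrite cint_sum; last by move=> k; apply: cbmeasM; [exact: cbmeas_cst|exact: bfe].
  rewrite big_seq [RHS]big_seq; apply: eq_bigr => k kK.
  rewrite cintZ; last exact: cbmeas_cintegrable.
  by rewrite -[cint _]fourierE fourier_trigpoly // kK.
have := congr1 (@complex.Re R) E; rewrite Rez_sum /= => H.
transitivity (Rintegral P setT (fun x => complex.Re (f x * conjc (f x)))).
  by apply: eq_Rintegral => x _; rewrite mul_conjc.
rewrite H; apply: eq_bigr => k _; by rewrite mulrC mul_conjc.
Qed.

End Parseval.

(** * Testing an operator of small rank on trigonometric polynomials *)

Section LowerBound.
Context {R : realType} (n : nat) (s : R) (r : \bar R).
Hypothesis r_gt0 : (0 < r)%E.
Local Notation C := (R[i]).
Local Notation X := (Td R n.+1).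
Local Notation P := (Pd R n.+1).
Local Notation lattice := {ffun 'I_n.+1 -> int}.
Local Notation W := (@latW R n r).
Implicit Types f g : X -> C.

Lemma Hnorm2_trigpoly (K : {fset lattice}) (c : lattice -> C) :
  Hnorm2 s r (trigpoly n K c) =
  (\sum_(k <- K) sob_weight2 s r k * cnorm (c k) ^+ 2)%:E.
Proof.
have w0 (k : lattice) : 0 <= sob_weight2 s r k by apply/ltW; exact: sob_weight_gt0.
rewrite /Hnorm2.
transitivity (\esum_(k in [set` K]) (sob_weight2 s r k * cnorm (c k) ^+ 2)%:E).
  rewrite [RHS]esum_mkcond; apply: eq_esum => k _.
  rewrite fourier_trigpoly ?fset_uniq //.
  case: ifP => [kK|kK]; first by rewrite mem_set.
  by rewrite memNset ?cnorm0 ?expr0n ?mulr0 //= kK.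
rewrite esum_fset //; last by move=> k _; rewrite lee_fin mulr_ge0 ?sqr_ge0.
by rewrite -fsbig_seq ?fset_uniq // sumEFin.
Qed.

Lemma inH_trigpoly (K : {fset lattice}) (c : lattice -> C) : inH s r (trigpoly n K c).
Proof.
split; first by apply: cbmeas_inL2; exact: cbmeas_trigpoly.
by rewrite Hnorm2_trigpoly ltry.
Qed.

Lemma Hnorm_trigpoly (K : {fset lattice}) (c : lattice -> C) :
  Hnorm s r (trigpoly n K c) =
  Num.sqrt (\sum_(k <- K) sob_weight2 s r k * cnorm (c k) ^+ 2).
Proof. by rewrite /Hnorm Hnorm2_trigpoly. Qed.

Variable A : (X -> C) -> (X -> C).
Hypothesis A_bdd : bdd_lin_op s r A.

Lemma trigpoly_cons (k : lattice) (K : seq lattice) c (x : X) :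
  trigpoly n (k :: K) c x = c k * cexpi (dotk k x) + trigpoly n K c x.
Proof. by rewrite /trigpoly big_cons. Qed.

Lemma op_trigpoly (K : {fset lattice}) (c : lattice -> C) :
  {ae P, forall x, A (trigpoly n K c) x = \sum_(k <- K) c k * A (fun x => cexpi (dotk k x)) x}.
Proof.
have [_ _ lin _] := A_bdd.
have inHe k : inH s r (fun x : X => cexpi (dotk k x)).
  have -> : (fun x : X => cexpi (dotk k x)) = trigpoly n [fset k]%fset (fun=> 1).
    by apply/funext => x; rewrite /trigpoly big_seq_fset1 mul1r.
  exact: inH_trigpoly.
suff H (L : seq lattice) : uniq L ->
    {ae P, forall x, A (trigpoly n L c) x = \sum_(k <- L) c k * A (fun x => cexpi (dotk k x)) x}.
  by apply: H; exact: fset_uniq.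
elim: L => [_|k L IH /= /andP[_ uL]].
  (* Linearity with both scalars 0 says that [A] sends the zero function to zero almost
     everywhere. *)
  have := lin 0 0 _ _ (inHe 0) (inHe 0); apply: filterS => x.
  rewrite !mul0r addr0 big_nil => <-; congr (A _ x); apply/funext => y.
  by rewrite /trigpoly big_nil !mul0r addr0.
have inL : inH s r (trigpoly n L c).
  have -> : trigpoly n L c = trigpoly n [fset k in L]%fset c.
    apply/funext => x; apply: perm_big; apply: uniq_perm => //; first exact: fset_uniq.
    by move=> l; rewrite inE.
  exact: inH_trigpoly.
apply: filterS2 (IH uL) (lin (c k) 1 _ _ (inHe k) inL) => x H1 H2.
rewrite big_cons -H1 -[A (trigpoly n L c) x]mul1r -H2; congr (A _ x).
by apply/funext => y; rewrite trigpoly_cons mul1r.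
Qed.

Variables (m : nat) (M : R).
Hypothesis A_rank : exists g : 'I_m -> (X -> C), forall f, inH s r f ->
  exists c : 'I_m -> C, {ae P, forall x, A f x = \sum_(i < m) c i * g i x}.
Hypothesis A_close : forall f, inH s r f -> Hnorm s r f <= 1 ->
  {ae P, forall x, cnorm (f x - A f x) <= M}.

Lemma inH_cexpi (k : lattice) : inH s r (fun x : X => cexpi (dotk k x)).
Proof.
have -> : (fun x : X => cexpi (dotk k x)) = trigpoly n [fset k]%fset (fun=> 1).
  by apply/funext => x; rewrite /trigpoly big_seq_fset1 mul1r.
exact: inH_trigpoly.
Qed.

Lemma close_ge0 : 0 <= M.
Proof.
have H0 : inH s r (trigpoly n fset0 (fun=> 0)) by exact: inH_trigpoly.
have N0 : Hnorm s r (trigpoly n fset0 (fun=> 0)) <= 1.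
  by rewrite Hnorm_trigpoly big_seq_fset0 sqrtr0.
have H := A_close _ H0 N0.
rewrite -lee_fin; apply: (@le_trans _ _ (ess_sup P (fun=> 0%E))).
  by rewrite ess_sup_cst //; exact: Pd_setT_gt0.
rewrite -[leRHS](ess_sup_cst (mu := P)); last exact: Pd_setT_gt0.
by apply: le_ess_sup; apply: filterS H => x /(le_trans (cnorm_ge0 _)); rewrite lee_fin.
Qed.

Variable K : {fset lattice}.
Local Notation N := (size (K : seq lattice)).
Definition kpt (i : 'I_N) : lattice := nth 0 K i.
(** Passes from positions in [K] to frequencies. Outside [K] the index is out of range and the
    coefficient is 0. *)
Definition kcoef (a : 'rV[C]_N) (k : lattice) : C :=
  oapp (a 0) 0 (insub (index k K) : option 'I_N).

Lemma kcoefE a i : kcoef a (kpt i) = a 0 i.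
Proof. by rewrite /kcoef /kpt index_uniq ?fset_uniq // valK. Qed.

Lemma sum_kpt (V : nmodType) (F : lattice -> V) : \sum_(k <- K) F k = \sum_(i < N) F (kpt i).
Proof. by rewrite (big_nth 0) big_mkord. Qed.

(** Division by [W^s] makes the exponentials orthonormal in the Sobolev space, so row vectors embed
    isometrically. *)
Definition weighted (a : 'rV[C]_N) : lattice -> C :=
  fun k => kcoef a k * ((powR (W k) (- s))%:C)%C.

Lemma cnorm_real (t : R) : 0 <= t -> cnorm ((t%:C)%C) = t.
Proof. by move=> t0; rewrite /cnorm /= expr0n addr0 sqrtr_sqr ger0_norm. Qed.

Lemma powR_sqr_neg (k : lattice) : powR (W k) (- s) ^+ 2 = powR (W k) (- (2 * s)).
Proof.
have W0 : 0 < W k by exact: latW_gt0.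
by rewrite expr2 -powRD ?(gt_eqF W0) ?implybT //; congr powR; ring.
Qed.

Lemma cnorm_weighted a i : cnorm (weighted a (kpt i)) ^+ 2 =
  cnorm (a 0 i) ^+ 2 * powR (W (kpt i)) (- (2 * s)).
Proof.
by rewrite /weighted kcoefE cnormM cnorm_real ?powR_ge0 // exprMn powR_sqr_neg.
Qed.

Lemma Hnorm_weighted a :
  Hnorm s r (trigpoly n K (weighted a)) = Num.sqrt (\sum_(i < N) cnorm (a 0 i) ^+ 2).
Proof.
rewrite Hnorm_trigpoly sum_kpt; congr Num.sqrt; apply: eq_bigr => i _.
have W0 : 0 < W (kpt i) by exact: latW_gt0.
rewrite cnorm_weighted (sob_weightE n s r r_gt0) mulrCA -powRD ?subrr ?powRr0 ?mulr1 //.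
by rewrite (gt_eqF W0) implybT.
Qed.

(** The rank condition gives coefficients for each function separately, with no linear dependence on
    it. They are chosen for the exponentials only, as the rows of [cm], and linearity of [A] extends
    them to the span. *)
Lemma kernel_matrix : exists cm : 'M[C]_(N, m), forall a : 'rV[C]_N, a *m cm = 0 ->
  {ae P, forall x, A (trigpoly n K (weighted a)) x = 0}.
Proof.
have [g Hg] := A_rank.
have /choice [c Hc] : forall k : lattice, exists c : 'I_m -> C,
    {ae P, forall x, A (fun x => cexpi (dotk k x)) x = \sum_(i < m) c i * g i x}.
  by move=> k; apply: Hg; exact: inH_cexpi.
exists (\matrix_(i, j) (((powR (W (kpt i)) (- s))%:C)%C * c (kpt i) j)) => a aM.
have Hall : {ae P, forall x, forall i : 'I_N,
    A (fun x => cexpi (dotk (kpt i) x)) x = \sum_(j < m) c (kpt i) j * g j x}.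
  suff H (L : seq 'I_N) : {ae P, forall x, forall i, i \in L ->
      A (fun x => cexpi (dotk (kpt i) x)) x = \sum_(j < m) c (kpt i) j * g j x}.
    by apply: filterS (H (enum 'I_N)) => x Hx i; apply: Hx; rewrite mem_enum.
  elim: L => [|i L IH]; first exact: nearW.
  apply: filterS2 IH (Hc (kpt i)) => x H1 H2 j; rewrite in_cons => /orP[/eqP ->//|]; exact: H1.
apply: filterS2 Hall (op_trigpoly K (weighted a)) => x H1 ->.
rewrite sum_kpt; under eq_bigr => i _.
  rewrite H1 /weighted kcoefE mulr_sumr.
  under eq_bigr do rewrite mulrA -[a 0 i * _ * _]mulrA.
  over.
rewrite exchange_big /= big1 // => j _; rewrite -mulr_suml.
have := congr1 (fun u : 'rV[C]_m => u 0 j) aM; rewrite !mxE => E.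
by under eq_bigr do rewrite -[X in a 0 _ * X](mxE matrix_key (fun i j => ((powR (W (kpt i)) (- s))%:C)%C * c (kpt i) j)); rewrite E mul0r.
Qed.

Lemma trigpoly_weighted a (x : X) : trigpoly n K (weighted a) x =
  \sum_(i < N) a 0 i * (((powR (W (kpt i)) (- s))%:C)%C * cexpi (dotk (kpt i) x)).
Proof.
rewrite /trigpoly sum_kpt; apply: eq_bigr => i _.
by rewrite /weighted kcoefE mulrA.
Qed.

Lemma trigpoly_mul {L : nat} (y : 'rV[C]_L) (Q : 'M[C]_(L, N)) (x : X) :
  trigpoly n K (weighted (y *m Q)) x =
  \sum_(l < L) y 0 l * trigpoly n K (weighted (row l Q)) x.
Proof.
rewrite trigpoly_weighted; under [RHS]eq_bigr => l _ do rewrite trigpoly_weighted mulr_sumr.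
rewrite exchange_big /=; apply: eq_bigr => i _.
by rewrite [(y *m Q) 0 i]mxE mulr_suml; apply: eq_bigr => l _; rewrite mxE !mulrA.
Qed.

Lemma normsq_cnorm {L : nat} (y : 'rV[C]_L) :
  normsq y = ((\sum_(l < L) cnorm (y 0 l) ^+ 2)%:C)%C.
Proof.
rewrite rmorph_sum; apply: eq_bigr => l _.
by rewrite normcE_cnorm -rmorphXn.
Qed.

Lemma ae_countable (I : countType) (Q : I -> X -> Prop) :
  (forall i, {ae P, forall x, Q i x}) -> {ae P, forall x, forall i, Q i x}.
Proof.
move=> H.
have : {ae P, forall x, forall k : nat, if @choice.unpickle I k is Some i then Q i x else True}.
  apply/ae_foralln => k; case: (@choice.unpickle I k) => [i|]; first exact: H.
  exact: nearW.
by apply: filterS => x Hx i; have := Hx (choice.pickle i); rewrite choice.pickleK.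
Qed.

(** The weight [q i] is the squared norm of column [i] of [Q], a diagonal entry of the projection
    onto the row space. It is at most 1 by Bessel, and the total is the number [L] of rows. *)
Lemma lower_weights : exists q : 'I_N -> R, [/\ forall i, 0 <= q i <= 1,
  N%:R - m%:R <= \sum_(i < N) q i &
  \sum_(i < N) q i * powR (W (kpt i)) (- (2 * s)) <= M ^+ 2].
Proof.
have M0 := close_ge0.
have [cm Hcm] := kernel_matrix.
have [L [Q [NL uQ Qcm]]] := unitary_kernel cm.
pose phi l x := trigpoly n K (weighted (row l Q)) x.
(* A Gaussian integer vector [y] is coded by the integer vector [z] of length [2L]. The sign before
   the imaginary part makes the pairing equal to the real part of the sum of the [y_l * phi_l]. *)
have kerz (z : {ffun 'I_L * bool -> int}) : {ae P, forall x,
    \sum_i (z i)%:~R * (if i.2 then - complex.Im (phi i.1 x) else complex.Re (phi i.1 x)) <=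
    M * Num.sqrt (\sum_i (z i)%:~R ^+ 2)}.
  set S : R := \sum_i (z i)%:~R ^+ 2.
  have S0 : 0 <= S by apply: sumr_ge0 => i _; exact: sqr_ge0.
  pose y : 'rV[C]_L := \row_l Complex (z (l, false))%:~R (z (l, true))%:~R.
  have Sy : S = \sum_(l < L) cnorm (y 0 l) ^+ 2.
    rewrite /S (eq_bigr (fun p => (z (p.1, p.2))%:~R ^+ 2)); last by case.
    rewrite -(pair_bigA _ (fun l b => (z (l, b))%:~R ^+ 2)) /=.
    apply: eq_bigr => l _; rewrite big_bool /= cnorm_sqr mxE /= addrC //.
  have Ry x : \sum_i (z i)%:~R * (if i.2 then - complex.Im (phi i.1 x) else complex.Re (phi i.1 x)) =
      complex.Re (\sum_(l < L) y 0 l * phi l x).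
    rewrite Rez_sum (eq_bigr (fun p => (z (p.1, p.2))%:~R *
      (if p.2 then - complex.Im (phi p.1 x) else complex.Re (phi p.1 x)))); last by case.
    rewrite -(pair_bigA _ (fun l b => (z (l, b))%:~R *
      (if b then - complex.Im (phi l x) else complex.Re (phi l x)))) /=.
    by apply: eq_bigr => l _; rewrite big_bool /= mxE RezM /=; ring.
  have [SE|Sn0] := eqVneq S 0.
    apply: nearW => x; rewrite SE sqrtr0 mulr0 big1 // => i _.
    have /psumr_eq0P H : S = 0 by [].
    have := H (fun i _ => sqr_ge0 _) i isT => /eqP; rewrite sqrf_eq0 => /eqP ->.
    by rewrite mul0r.
  have S1 : 0 < S by rewrite lt_def Sn0.
  have sS : 0 < Num.sqrt S by rewrite sqrtr_gt0.
  (* After normalisation [y' *m Q] is a unit vector killed by [cm], so [A] drops out of the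
     closeness hypothesis. *)
  pose y' : 'rV[C]_L := (((Num.sqrt S)^-1)%:C)%C *: y.
  have ny : \sum_(l < L) cnorm (y' 0 l) ^+ 2 = 1.
    transitivity (S^-1 * S); last by rewrite mulVf.
    rewrite {2}Sy mulr_sumr; apply: eq_bigr => l _.
    rewrite mxE cnormM exprMn cnorm_real ?invr_ge0 ?sqrtr_ge0 //.
    by rewrite exprVn sqr_sqrtr.
  pose a := y' *m Q.
  have na : \sum_(i < N) cnorm (a 0 i) ^+ 2 = 1.
    have := normsq_mul_unitary y' Q uQ; rewrite !normsq_cnorm ny.
    by move=> /(congr1 (@complex.Re R)) /= ->.
  have acm : a *m cm = 0 by rewrite -mulmxA Qcm mulmx0.
  have Hn : Hnorm s r (trigpoly n K (weighted a)) <= 1 by rewrite Hnorm_weighted na sqrtr1.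
  have := A_close _ (inH_trigpoly K (weighted a)) Hn.
  apply: filterS2 (Hcm a acm) => x -> ; rewrite subr0 => Hx.
  rewrite Ry; apply: (le_trans (ler_norm _)); apply: (le_trans (abs_Re_le _)).
  have E : trigpoly n K (weighted a) x =
      (((Num.sqrt S)^-1)%:C)%C * (\sum_(l < L) y 0 l * phi l x).
    rewrite trigpoly_mul mulr_sumr; apply: eq_bigr => l _.
    by rewrite mxE mulrA.
  move: Hx; rewrite E cnormM cnorm_real ?invr_ge0 ?sqrtr_ge0 //.
  by rewrite ler_pdivrMl // mulrC.
have bound : {ae P, forall x, \sum_(l < L) cnorm (phi l x) ^+ 2 <= M ^+ 2}.
  have := ae_countable _ _ kerz; apply: filterS => x Hx.
  have := real_vector_dual_bound _ _ _ M0 Hx.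
  rewrite -(pair_bigA _ (fun l b =>
      (if b then - complex.Im (phi l x) else complex.Re (phi l x)) ^+ 2)) /=.
  apply: le_trans; apply: ler_sum => l _.
  by rewrite big_bool /= sqrrN addrC cnorm_sqr.
pose q i : R := \sum_(l < L) cnorm (Q l i) ^+ 2.
have qC i : \sum_(l < L) `|Q l i| ^+ 2 = ((q i)%:C)%C.
  by rewrite rmorph_sum; apply: eq_bigr => l _; rewrite normcE_cnorm -rmorphXn.
have bphi l : bmeas (fun x => cnorm (phi l x) ^+ 2).
  have bf : cbmeas (phi l) := cbmeas_trigpoly n K _.
  apply: bmeasX; split; first exact/measurable_cnorm/cbmeas_cmeasurable.
  have [N' HN'] := cbmeas_bound _ bf.
  by exists N' => x; rewrite ger0_norm ?cnorm_ge0.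
have pars l : (\int[P]_x (cnorm (phi l x) ^+ 2)%:E =
    (\sum_(i < N) cnorm (Q l i) ^+ 2 * powR (W (kpt i)) (- (2 * s)))%:E)%E.
  have := parseval_trigpoly n K (weighted (row l Q)) (fset_uniq K).
  rewrite sum_kpt => H.
  rewrite -(fineK (integrable_fin_num measurableT (bmeas_integrable P _ (bphi l)))) /=.
  congr EFin; rewrite -[LHS]/(Rintegral P setT (fun x => cnorm (phi l x) ^+ 2)) H.
  by apply: eq_bigr => i _; rewrite cnorm_weighted mxE.
exists q; split.
- move=> i; rewrite sumr_ge0 //= => [|l _]; last exact: sqr_ge0.
  by rewrite -lecR -qC; exact: unitary_col_normsq.
- rewrite /q exchange_big /=.
  have -> : \sum_(l < L) \sum_(i < N) cnorm (Q l i) ^+ 2 = \sum_(l < L) 1.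
    apply: eq_bigr => l _; have := unitary_row_normsq Q l uQ.
    under eq_bigr do rewrite normcE_cnorm -rmorphXn.
    by rewrite -rmorph_sum => /(congr1 (@complex.Re R)).
  rewrite sumr_const card_ord lerBlDr -natrD ler_nat.
  by rewrite addnC -leq_subLR.
- rewrite -lee_fin.
  have -> : (\sum_(i < N) q i * powR (W (kpt i)) (- (2 * s)))%:E =
      (\int[P]_x (\sum_(l < L) (cnorm (phi l x) ^+ 2)%:E))%E.
    rewrite ge0_integral_sum //; last 2 first.
    + by move=> l; apply/measurable_EFinP; case: (bphi l).
    + by move=> l x _; rewrite lee_fin sqr_ge0.
    under [RHS]eq_bigr do rewrite pars.
    rewrite sumEFin; congr EFin; rewrite exchange_big /=.
    by apply: eq_bigr => i _; rewrite mulr_suml.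
  apply: (@le_trans _ _ (\int[P]_x (M ^+ 2)%:E)%E); last first.
    rewrite integral_cst // [X in (_ * X)%E](_ : _ = 1%E) ?mule1 //.
    exact: probability_setT.
  apply: ae_ge0_le_integral => //.
  + by move=> x _; apply: sume_ge0 => l _; rewrite lee_fin sqr_ge0.
  + by apply: emeasurable_sum => l; apply/measurable_EFinP; case: (bphi l).
  + by move=> x _; rewrite lee_fin sqr_ge0.
  + by apply: filterS bound => x Hx _; rewrite sumEFin lee_fin.
Qed.

End LowerBound.

Section ApproxLower.
Context {R : realType} (n : nat) (s : R) (r : \bar R).
Hypothesis r_gt0 : (0 < r)%E.
Hypothesis s_ge0 : 0 <= s.
Local Notation C := (R[i]).
Local Notation X := (Td R n.+1).
Local Notation P := (Pd R n.+1).
Local Notation lattice := {ffun 'I_n.+1 -> int}.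
Local Notation W := (@latW R n r).

(** Linear programming duality with multiplier [tau = t^(-2s)], applied to the union of [latball t]
    and [K0]: for [q] in [[0, 1]], [q * (v - tau)] is at least the smaller of [v - tau] and 0, which
    is one term of the sum. *)
Lemma weights_lower_bound (t : R) (K0 : {fset lattice}) (m : nat) (B : R) : 0 < t ->
  (forall k, k \in K0 -> t <= W k) ->
  (forall K : {fset lattice}, exists q : 'I_(size (K : seq lattice)) -> R,
     [/\ forall i, 0 <= q i <= 1,
     (size (K : seq lattice))%:R - m%:R <= \sum_i q i &
     \sum_i q i * powR (W (kpt n K i)) (- (2 * s)) <= B]) ->
  latsum n r (2 * s) K0 + powR t (- (2 * s)) * ((latcount n r t)%:R - m%:R) <= B.
Proof.
move=> t0 HK0 HB; have ft := finite_latball n r r_gt0 t.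
pose LB := fset_set (latball n r t).
have inLB k : (k \in LB) = (W k < t).
  by rewrite in_fset_set //; apply/idP/idP => [/set_mem//|H]; exact/mem_set.
have [q [q01 qsum qB]] := HB (LB `|` K0)%fset.
set K := (LB `|` K0)%fset in q q01 qsum qB *.
apply: le_trans qB; set tau := powR t (- (2 * s)).
have tau0 : 0 <= tau by exact: powR_ge0.
have s20 : 0 <= 2 * s by rewrite mulr_ge0.
pose v k := powR (W k) (- (2 * s)).
(* [hi + lo] is the minimum of [v] and [tau]; the two parts sum to the tail and to [tau] times the
   lattice count. *)
pose hi k : R := if t <= W k then v k else 0.
pose lo k : R := if t <= W k then 0 else tau.
have perm : perm_eq K (LB ++ K0).
  apply: uniq_perm; [exact: fset_uniq| |by move=> k; rewrite in_fsetU mem_cat].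
  rewrite cat_uniq !fset_uniq andbT /=; apply/hasPn => k /HK0 tk.
  by rewrite /= inLB -leNgt.
have Shi : \sum_(k <- K) hi k = latsum n r (2 * s) K0.
  rewrite (perm_big _ perm) big_cat /= big_seq big1 ?add0r => [|k].
    by rewrite /latsum big_seq [RHS]big_seq; apply: eq_bigr => k /HK0 tk; rewrite /hi tk.
  by rewrite inLB /hi ltNge => /negbTE ->.
have Slo : \sum_(k <- K) lo k = tau * (latcount n r t)%:R.
  rewrite (perm_big _ perm) big_cat /= [X in _ + X]big_seq [X in _ + X]big1 ?addr0 => [|k /HK0 tk].
    rewrite big_seq (eq_bigr (fun=> tau)) => [|k]; last first.
      by rewrite inLB /lo ltNge => /negbTE ->.
    by rewrite -big_seq big_const_seq count_predT iter_addr_0 mulr_natr.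
  by rewrite /lo tk.
have term (i : 'I_(size (K : seq lattice))) :
    hi (kpt n K i) + lo (kpt n K i) + tau * (q i - 1) <= q i * v (kpt n K i).
  have /andP[q0 q1] := q01 i; rewrite /hi /lo; set k := kpt n K i.
  have W0 : 0 < W k by exact: latW_gt0.
  have [tk|tk] := leP t (W k).
    have vt : v k <= tau by exact: powR_neg_le.
    rewrite addr0 -subr_ge0.
    have -> : q i * v k - (v k + tau * (q i - 1)) = (1 - q i) * (tau - v k) by ring.
    by rewrite mulr_ge0 // subr_ge0.
  have vt : tau <= v k by apply: powR_neg_le => //; exact: ltW.
  have -> : 0 + tau + tau * (q i - 1) = q i * tau by ring.
  by rewrite ler_wpM2l.
apply: (@le_trans _ _ (\sum_i (hi (kpt n K i) + lo (kpt n K i) + tau * (q i - 1)))); last first.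
  by apply: ler_sum => i _; exact: term.
rewrite !big_split /= -!(sum_kpt n K) Shi Slo -addrA lerD2l mulrBr lerD2l.
rewrite -mulr_sumr sumrB sumr_const card_ord -mulrN ler_wpM2l //.
lra.
Qed.

(** Any [t] is allowed: if the argument is negative, [Num.sqrt] returns 0 and the bound is
    trivial. *)
Lemma approx_number_ge (t : R) (K0 : {fset lattice}) (m : nat) : 0 < t ->
  (forall k, k \in K0 -> t <= W k) ->
  ((Num.sqrt (latsum n r (2 * s) K0 +
     powR t (- (2 * s)) * ((latcount n r t)%:R - m%:R)))%:E <= approx_number n.+1 s r m)%E.
Proof.
move=> t0 HK0; apply: le_ereal_inf_tmp => _ [A [Abdd [m' [m'm Arank]]] <-].
have sup f : inH s r f -> Hnorm s r f <= 1 ->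
    (Linf_norm (fun x : X => (f x - A f x)%R) <= opnorm_IminusA s r A)%E.
  by move=> Hf f1; apply: ereal_sup_ubound; exists f.
case E : (opnorm_IminusA s r A) => [M| |]; last 2 first.
- exact: leey.
(* The value [-oo] is impossible: it would bound a norm by -1 almost everywhere. *)
- have close f : inH s r f -> Hnorm s r f <= 1 -> {ae P, forall x, cnorm (f x - A f x) <= -1}.
    by move=> Hf f1; apply/Linf_norm_le; apply: le_trans (sup f Hf f1) _; rewrite E leNye.
  by have := close_ge0 n s r r_gt0 A (-1) close; rewrite oppr_ge0 ler10.
have close f : inH s r f -> Hnorm s r f <= 1 -> {ae P, forall x, cnorm (f x - A f x) <= M}.
  by move=> Hf f1; apply/Linf_norm_le; rewrite -E; exact: sup.
have M0 : 0 <= M := close_ge0 n s r r_gt0 A M close.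
rewrite lee_fin -(ger0_norm M0) -sqrtr_sqr ler_wsqrtr //.
apply: weights_lower_bound => // K.
have [q [q01 qs qM]] := lower_weights n s r r_gt0 A Abdd m' M Arank close K.
exists q; split => //; apply: le_trans qs; rewrite lerD2l lerN2 ler_nat; exact: ltnW.
Qed.

End ApproxLower.

(** * The limit *)

Section Limit.
Context {R : realType}.

(** For each accuracy one fixed [e] suffices, so the range of [m] where the bounds hold may depend
    on [e]. *)
Lemma cvge_sandwich_family (u : nat -> \bar R) (lo up : R -> R) (L : R) :
  lo e @[e --> 0^'+] --> L -> up e @[e --> 0^'+] --> L ->
  (forall e, 0 < e -> e < 1 -> \forall m \near \oo, ((lo e)%:E <= u m <= (up e)%:E)%E) ->
  u @ \oo --> L%:E.
Proof.
move=> lcv ucv H; apply/fine_cvgP; split.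
  have h0 : 0 < (2^-1 : R) by lra.
  have h1 : (2^-1 : R) < 1 by lra.
  apply: filterS (H _ h0 h1) => m /andP[H1 H2].
  by rewrite fin_numElt (lt_le_trans (ltNyr _) H1) (le_lt_trans H2 (ltry _)).
apply/cvgrPdist_le => eps eps0.
have Hl : \forall e \near (0 : R)^'+, `|L - lo e| <= eps.
  by have /cvgrPdist_le := lcv; apply.
have Hu : \forall e \near (0 : R)^'+, `|L - up e| <= eps.
  by have /cvgrPdist_le := ucv; apply.
have H1 := nbhs_right_lt (@ltr01 R).
have H0 := nbhs_right_gt (0 : R).
have [e [[[e0 e1] el] eu]] := filter_ex (filterI (filterI (filterI H0 H1) Hl) Hu).
apply: filterS (H e e0 e1) => m /=.
case: (u m) => [x| |]; rewrite ?leNye ?leey ?andbF //= ?lee_fin ?leye_eq ?leeNy_eq ?andbF //.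
move=> /andP[xl xu]; move: el eu; rewrite !ler_norml => /andP[a1 a2] /andP[b1 b2].
by apply/andP; split; lra.
Qed.

Lemma cvg_sqrt {T : Type} (F : set_system T) {FF : Filter F} (f : T -> R) (l : R) :
  f x @[x --> F] --> l -> Num.sqrt (f x) @[x --> F] --> Num.sqrt l.
Proof. by move=> H; apply: (cvg_comp f Num.sqrt H); exact: sqrt_continuous. Qed.

Lemma powR_cvg1 (a : R) : powR (1 + e) a @[e --> 0^'+] --> (1 : R).
Proof.
apply: cvg_at_right_filter.
rewrite [X in _ --> X](_ : 1 = powR (1 + 0) a); last by rewrite addr0 powR1.
apply: (cvg_comp (fun e : R => 1 + e) (fun x => powR x a) (G := nbhs (1 + 0 : R))).
  by apply: cvgD; [exact: cvg_cst|exact: cvg_id].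
have : {for (1 + 0 : R), continuous (fun x : R => powR x a)}; last by [].
apply: differentiable_continuous; apply/derivable1_diffP.
by apply: derivable_powR; rewrite in_itv /= andbT addr0 ltr01.
Qed.

(** For [u = m / V * b] one has [V * u = m * b], and all powers of [m] cancel: this is why the
    scaled approximation numbers converge. *)
Lemma powR_scaling (V m b q : R) : 0 < V -> 0 < m -> 0 < b ->
  powR m (q - 1) * (powR (m / V * b) (- q) * (m * b)) = powR V q * powR b (1 - q).
Proof.
move=> V0 m0 b0.
have W0 : 0 <= V^-1 by rewrite invr_ge0 ltW.
rewrite powRM ?mulr_ge0 ?(ltW m0) ?(ltW b0) // powRM ?(ltW m0) //.
have -> : powR V^-1 (- q) = powR V q.
  by rewrite -powR_inv1 ?(ltW V0) // -powRrM mulN1r opprK.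
have -> : 1 - q = - q + 1 by ring.
rewrite (powRD (x := b)) ?(gt_eqF b0) ?implybT // (powRr1 (ltW b0)).
have E : powR m (q - 1) * powR m (- q) * m = 1.
  rewrite -{3}(powRr1 (ltW m0)) -!powRD ?(gt_eqF m0) ?implybT //.
  by rewrite (_ : q - 1 + - q + 1 = 0) ?powRr0 //; ring.
transitivity ((powR m (q - 1) * powR m (- q) * m) * (powR V q * (powR b (- q) * b))).
  ring.
by rewrite E mul1r.
Qed.

Variables (n : nat) (s : R) (r : \bar R).
Hypothesis r_gt0 : (0 < r)%E.
Hypothesis s_gt : n.+1%:R < 2 * s.
Local Notation D := (n.+1%:R : R).
Local Notation p := (2 * s).
Local Notation q := (2 * s / n.+1%:R).
Local Notation V := (gvol n r).
Local Notation cst := (n.+1%:R / (2 * s - n.+1%:R)).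

Let D0 : 0 < D. Proof. by rewrite ltr0n. Qed.
Let V0 : 0 < V. Proof. exact: gvol_gt0. Qed.
Let s0 : 0 <= s. Proof. by move: D0 s_gt; move: (n.+1%:R : R) => Q; lra. Qed.

Definition radius (u : R) : R := powR u D^-1.

Lemma radius_exp u : 0 <= u -> radius u ^+ n.+1 = u.
Proof.
move=> u0; rewrite -powR_mulrn ?powR_ge0 // /radius -powRrM mulVf ?(gt_eqF D0) //.
by rewrite powRr1.
Qed.

Lemma radius_pow u : powR (radius u) (- p) = powR u (- q).
Proof. by rewrite /radius -powRrM; congr powR; rewrite mulrN mulrC. Qed.

Lemma radius_ge (t u : R) : 0 < t -> t ^+ n.+1 <= u -> t <= radius u.
Proof.
move=> t0 tu; have u0 : 0 <= u by apply: le_trans tu; rewrite exprn_ge0 // ltW.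
by rewrite -(ler_pXn2r (ltn0Sn n)) ?nnegrE ?(ltW t0) ?powR_ge0 // radius_exp.
Qed.

Lemma radius_large (t b : R) : 0 < t -> 0 < b ->
  \forall m \near \oo, t <= radius (m%:R / V * b) /\ 0 < m%:R :> R.
Proof.
move=> t0 b0.
apply: filterS2 (nbhs_infty_ger (t ^+ n.+1 * V / b)) (nbhs_infty_ger (1 : R)) => m Hm m1; split.
  apply: radius_ge => //; rewrite -ler_pdivrMr // ler_pdivlMr //.
  by rewrite -mulrA [_^-1 * _]mulrC mulrA.
by apply: lt_le_trans m1.
Qed.

Lemma sqrt_scale (m : R) (x : R) :
  powR m (s / D - 2^-1) * Num.sqrt x = Num.sqrt (powR m (q - 1) * x).
Proof.
rewrite sqrtrM ?powR_ge0 //; congr (_ * _).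
have -> : q - 1 = (s / D - 2^-1) * 2%:R by field; rewrite gt_eqF.
by rewrite powRrM powR_mulrn ?powR_ge0 // sqrtr_sqr ger0_norm ?powR_ge0.
Qed.

Lemma scaled_le (e : R) : 0 < e -> e < 1 -> \forall m \near \oo,
  ((powR m%:R (s / D - 2^-1))%:E * approx_number n.+1 s r m <=
   (Num.sqrt (powR V q * cst * (1 + e) * powR (1 + e) (2 * (q - 1))))%:E)%E.
Proof.
move=> e0 e1; pose c : R := 1 + e; have c1 : 1 < c by rewrite /c; lra.
have c0 : 0 < c by lra.
(* With [V * u = m / c^2] the count is at most [m / c], strictly below [m] as the rank condition
   demands. *)
have b0 : 0 < (c ^+ 2)^-1 by rewrite invr_gt0 exprn_gt0.
have [t1 [t11 H1]] := latcount_sandwich n r r_gt0 c c1.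
have [t2 [t21 H2]] := tail_upper n r r_gt0 p e s_gt e0 e1.
have t10 : 0 < t1 by lra.
have t20 : 0 < t2 by lra.
apply: filterS2 (radius_large _ _ t10 b0) (radius_large _ _ t20 b0) => m [Hm1 m0] [Hm2 _].
set u := m%:R / V * (c ^+ 2)^-1 in Hm1 Hm2.
have u0 : 0 < u by rewrite /u mulr_gt0 ?divr_gt0.
have Ve : V * u = m%:R * (c ^+ 2)^-1 by rewrite /u; field; rewrite !gt_eqF.
have cnt : (latcount n r (radius u) < m)%N.
  have /andP[_] := H1 _ Hm1; rewrite radius_exp ?(ltW u0) // Ve => Hc.
  rewrite -(ltr_nat R); apply: le_lt_trans Hc _.
  have -> : c * (m%:R * (c ^+ 2)^-1) = m%:R / c by field; rewrite gt_eqF.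
  by rewrite ltr_pdivrMr // ltr_pMr.
have := approx_number_le n s r r_gt0 s_gt m _ _ (H2 _ Hm2) cnt.
move=> /(lee_wpmul2l (x := (powR m%:R (s / D - 2^-1))%:E)).
rewrite lee_fin powR_ge0 => /(_ isT) /le_trans; apply.
rewrite -EFinM lee_fin sqrt_scale ler_wsqrtr // radius_exp ?(ltW u0) // radius_pow.
set B := (X in X <= _); have -> : B = (1 + e) * cst *
    (powR m%:R (q - 1) * (powR u (- q) * (V * u))) by rewrite /B; ring.
rewrite Ve powR_scaling //.
have -> : powR (c ^+ 2)^-1 (1 - q) = powR c (2 * (q - 1)).
  rewrite -powR_inv1 ?exprn_ge0 ?(ltW c0) // -powR_mulrn ?(ltW c0) // -!powRrM.
  by congr powR; ring.
by rewrite -/c le_eqVlt; apply/orP; left; apply/eqP; ring.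
Qed.

(** Here [V * u = m] exactly. The term [N(t) - m] may be negative, but it is at least
    [m * (1 / (1 + e) - 1)], which contributes the summand vanishing with [e]. *)
Lemma scaled_ge (e : R) : 0 < e -> e < 1 -> \forall m \near \oo,
  ((Num.sqrt (powR V q * ((1 - e) ^+ 2 * cst + (1 + e)^-1 - 1)))%:E <=
   (powR m%:R (s / D - 2^-1))%:E * approx_number n.+1 s r m)%E.
Proof.
move=> e0 e1; pose c : R := 1 + e; have c1 : 1 < c by rewrite /c; lra.
have c0 : 0 < c by lra.
have [t1 [t11 H1]] := latcount_sandwich n r r_gt0 c c1.
have [t2 [t21 H2]] := tail_lower n r r_gt0 p e s_gt e0 e1.
have t10 : 0 < t1 by lra.
have t20 : 0 < t2 by lra.
apply: filterS2 (radius_large _ _ t10 ltr01) (radius_large _ _ t20 ltr01) => m [Hm1 m0] [Hm2 _].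
set u := m%:R / V * 1 in Hm1 Hm2.
have u0 : 0 < u by rewrite /u mulr_gt0 ?divr_gt0.
have Ve : V * u = m%:R * 1 by rewrite /u; field; rewrite !gt_eqF.
have [K [HK HS]] := H2 _ Hm2.
have rad0 : 0 < radius u by exact: lt_le_trans Hm1.
have := approx_number_ge n s r r_gt0 s0 (radius u) K m rad0 HK.
move=> /(lee_wpmul2l (x := (powR m%:R (s / D - 2^-1))%:E)).
rewrite lee_fin powR_ge0 => /(_ isT); apply: le_trans.
rewrite -EFinM lee_fin sqrt_scale ler_wsqrtr //.
have /andP[+ _] := H1 _ Hm1; move: HS; rewrite radius_exp ?(ltW u0) // radius_pow Ve mulr1.
move=> HS Hc.
have E : powR m%:R (q - 1) * (powR u (- q) * (m%:R * 1)) = powR V q.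
  by rewrite powR_scaling // powR1 mulr1.
have -> : powR V q * ((1 - e) ^+ 2 * cst + (1 + e)^-1 - 1) = powR m%:R (q - 1) *
   ((1 - e) ^+ 2 * (V * cst * (powR u (- q) * u)) + powR u (- q) * (m%:R / c - m%:R)).
  rewrite -E -Ve -/c.
  have -> : powR u (- q) * (m%:R / c - m%:R) = powR u (- q) * (V * u) * (c^-1 - 1).
    by rewrite Ve; ring.
  ring.
rewrite ler_wpM2l ?powR_ge0 // lerD // ler_wpM2l ?powR_ge0 //.
by rewrite lerB.
Qed.

Lemma scaled_limit :
  (fun m : nat => ((powR m%:R (s / D - 2^-1))%:E * approx_number n.+1 s r m)%E) @ \oo -->
  (Num.sqrt cst * powR V (s / D))%:E.
Proof.
have cst0 : 0 <= cst by rewrite divr_ge0 ?(ltW D0) // subr_ge0 ltW.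
have -> : Num.sqrt cst * powR V (s / D) = Num.sqrt (powR V q * cst).
  rewrite [LHS]mulrC [RHS]sqrtrM ?powR_ge0 //; congr (_ * _).
  have -> : q = s / D * 2%:R by ring.
  by rewrite [in RHS]powRrM powR_mulrn ?powR_ge0 // sqrtr_sqr ger0_norm ?powR_ge0.
have id0 : e @[e --> (0 : R)^'+] --> (0 : R) by exact: cvg_at_right_filter.
have p1 : (1 + e) @[e --> (0 : R)^'+] --> (1 : R).
  by rewrite -[X in _ --> X]addr0; apply: cvgD => //; exact: cvg_cst.
apply: (@cvge_sandwich_family _
  (fun e => Num.sqrt (powR V q * ((1 - e) ^+ 2 * cst + (1 + e)^-1 - 1)))
  (fun e => Num.sqrt (powR V q * cst * (1 + e) * powR (1 + e) (2 * (q - 1))))).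
- apply: cvg_sqrt.
  rewrite [X in _ --> X](_ : _ = powR V q * ((1 - 0) ^+ 2 * cst + 1^-1 - 1)); last first.
    by rewrite subr0 expr1n mul1r invr1 addrK.
  apply: cvgMr; apply: cvgB; last exact: cvg_cst.
  apply: cvgD; last by apply: cvgV => //; exact: oner_neq0.
  apply: cvgMl.
  apply: (cvg_comp (fun e : R => 1 - e) (fun x => x ^+ 2) (G := nbhs (1 - 0 : R))).
    by apply: cvgB => //; exact: cvg_cst.
  exact: exprn_continuous.
- apply: cvg_sqrt.
  rewrite [X in _ --> X](_ : _ = powR V q * cst * 1 * 1); last by rewrite !mulr1.
  apply: cvgM; last exact: powR_cvg1.
  by apply: cvgMr.
- by move=> e e0 e1; apply: filterS2 (scaled_ge e e0 e1) (scaled_le e e0 e1) => m -> ->.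
Qed.

End Limit.

Theorem theorem3 (R : realType) (d : nat) (s : R) (r : \bar R) :
  (0 < d)%N -> d%:R / 2 < s -> (0 < r)%E ->
  (fun n : nat => ((powR n%:R (s / d%:R - 2^-1))%:E * approx_number d s r n)%E)
    @ \oo -->
  ((Num.sqrt (d%:R / (2 * s - d%:R)) *
     powR (fine (@vold R d (@unit_ball R d r))) (s / d%:R))%:E : \bar R).
Proof.
case: d => [//|n] _ hs r0.
have s_gt : n.+1%:R < 2 * s by move: (n.+1%:R) hs => Q hs; lra.
have -> : fine (@vold R n.+1 (@unit_ball R n.+1 r)) = gvol n r.
  by rewrite /gvol lebmE.
exact: scaled_limit.
Qed.
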